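(* Let $n\ge3$, $1<p<\infty$, and let $q=ab$, where $a\in L_r(\mathbb{R}^n)$, $b\in L_s(\mathbb{R}^n)$ for $r,s$ satisfying $0<r\le\infty$, $p\le s\le\infty$, $r^{-1}-s^{-1}=1-2p^{-1}$, $2^{-1}-p^{-1}\le r^{-1}\le1-p^{-1}$ and $r^{-1}+s^{-1}<2n^{-1}$. Let $H$ be the Schrödinger operator in $L_p(\mathbb{R}^n)$ associated with $-\Delta+q$ and the factorization $q=ab$. Then every complex eigenvalue $\lambda$ of $H$ with $\operatorname{Im}\lambda\ne0$ satisfies $$|\operatorname{Im}\lambda|^{\alpha}\le(4\pi)^{\alpha-1}\,\Gamma(\alpha)\,\|a\|_r\,\|b\|_s,$$ where $\alpha=1-n(r^{-1}+s^{-1})/2$.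
   Context: $\Gamma$ is the gamma function and $1/\infty=0$. $\|\cdot\|_r$ denotes the usual $L_r(\mathbb{R}^n)$ norm (quasi-norm if $r<1$). For $1<p<\infty$, $p'$ is defined by $1/p+1/p'=1$. The potential $q=ab$ is a product of complex-valued measurable functions $a,b$ on $\mathbb{R}^n$. $H_0$ is the operator $-\Delta$ in $L_p(\mathbb{R}^n)$ with domain the Sobolev space $W_p^2(\mathbb{R}^n)$, and $A,B$ are the operators of multiplication by $a,b$ in $L_p(\mathbb{R}^n)$ with maximal domains. For $u\in L_{p,\mathrm{loc}}(\mathbb{R}^n)$ put $M_{\nu,p}(u)=\sup_{x}\int_{|x-y|<1}|u(y)|^p|x-y|^{\nu-n}\,dy$. Standing assumptions: $M_{\nu,p'}(a)<\infty$ for some $0<\nu<p'$; $M_{\mu,p}(b)<\infty$ for some $0<\mu<p$; and $\int_{|x-y|<1}|q(y)|\,dy\to0$ as $|x|\to\infty$. Under these assumptions, for $z\in\mathbb{C}\setminus[0,\infty)$ the operator $B(H_0-z)^{-1}A$ is densely defined and has a unique bounded extension $Q(z)$ to $L_p(\mathbb{R}^n)$, which is compact, and $H_0+AB$ admits a closed extension $H$ with $\sigma_{ess}(H)=\sigma_{ess}(H_0)=[0,\infty)$ such that $\lambda\in\mathbb{C}\setminus[0,\infty)$ is an eigenvalue of $H$ if and only if $-1$ is an eigenvalue of $Q(\lambda)$. This $H$ is the Schrödinger operator associated with $-\Delta+q$ and the factorization $q=ab$. *)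

(* Defs.v *)
(* Everything is over an arbitrary [R : realType]: complex numbers are [R[i]]
   and points of R^n are row vectors ['rV[R]_n]. *)
From HB Require Import structures.
From mathcomp Require Import all_boot all_order all_algebra.
From mathcomp Require Import complex.
From mathcomp Require Import all_classical all_reals all_analysis.
From mathcomp Require Import measurable_realfun.

Set Implicit Arguments.
Unset Strict Implicit.
Unset Printing Implicit Defensive.

Import Order.TTheory GRing.Theory Num.Theory numFieldNormedType.Exports.

Local Open Scope classical_set_scope.
Local Open Scope ring_scope.

(* mathcomp-analysis also has [Num.Re : C -> C] on numClosedFieldType; here the
   real and imaginary parts and the modulus take values in [R]. *)
Notation cRe := (@complex.Re _).
Notation cIm := (@complex.Im _).
Notation normc := Normc.normc.

(* Borel sigma-algebra of 'rV[T]_n, generated by the coordinates. *)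
Definition measure_rV_display : measure_display -> measure_display.
Proof. exact. Qed.

Section measurable_rV.
Context {d} {T : sigmaRingType d} (n : nat).

Let coors : 'I_n -> 'rV[T]_n -> T := fun i x => x ord0 i.

Let rV_set0 : g_sigma_preimage coors set0.
Proof. exact: sigma_algebra0. Qed.

Let rV_setC A : g_sigma_preimage coors A -> g_sigma_preimage coors (~` A).
Proof. exact: sigma_algebraC. Qed.

Let rV_bigcup (F : _^nat) : (forall i, g_sigma_preimage coors (F i)) ->
  g_sigma_preimage coors (\bigcup_i (F i)).
Proof. exact: sigma_algebra_bigcup. Qed.

HB.instance Definition _ := @isMeasurable.Build (measure_rV_display d)
  'rV[T]_n (g_sigma_preimage coors) rV_set0 rV_setC rV_bigcup.

End measurable_rV.

Lemma measurable_fun_rVP d1 d2 (T1 : measurableType d1)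
    (T2 : measurableType d2) n (f : T1 -> 'rV[T2]_n) :
  measurable_fun [set: T1] f <->
  forall i, measurable_fun [set: T1] (fun x => f x ord0 i).
Proof.
apply: (@iff_trans _ (g_sigma_preimage
    (fun i => (fun v : 'rV[T2]_n => v ord0 i) \o f) `<=` measurable)).
  rewrite g_sigma_preimage_comp; split=> [mf A [/= C preC <-]|prefS].
    exact: mf.
  by move=> _ A mA; apply: prefS; exists A.
split=> [fS i|mf].
- move=> _ A mA.
  apply: fS; apply: sub_sigma_algebra.
  case: n i => [[] []//|n i] in f *.
  rewrite -bigcup_mkord_ord.
  exists i; first exact: ltn_ord.
  by exists A => //; rewrite inord_val.
- apply: smallest_sub; first exact: sigma_algebra_measurable.
  case: n => [|n] in f mf *; first by rewrite big_ord0.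
  rewrite -bigcup_mkord_ord; apply: bigcup_sub => i Ii.
  by move=> A [B mB <-]; exact: mf.
Qed.

Section lebesgue_measure_Rn.
Context {R : realType}.

Definition rV_cons n (tx : R * 'rV[R]_n) : 'rV[R]_n.+1 :=
  row_mx (const_mx tx.1 : 'rV_1) tx.2.

Lemma measurable_rV_coord n (i : 'I_n) :
  measurable_fun setT (fun x : 'rV[R]_n => x ord0 i).
Proof. by move: i; apply/measurable_fun_rVP; exact: measurable_id. Qed.

Lemma measurable_rV_cons n :
  measurable_fun setT (@rV_cons n : measurableTypeR R * 'rV[R]_n -> _).
Proof.
apply/measurable_fun_rVP => i; rewrite /rV_cons.
case: (@split_ordP 1 n i) => j ->.
- rewrite (_ : (fun x => _) = fst); first exact: measurable_fst.
  by apply/funext => x; rewrite (row_mxEl (const_mx x.1 : 'rV_1)) mxE.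
- rewrite (_ : (fun x => _) = (fun v : 'rV[R]_n => v ord0 j) \o snd).
    by apply: measurableT_comp => //; exact: measurable_rV_coord.
  by apply/funext => x /=; rewrite (row_mxEr (const_mx x.1 : 'rV_1)).
Qed.


HB.instance Definition _ n := isMeasurableFun.Build _ _ _ _
  (@rV_cons n : measurableTypeR R * 'rV[R]_n -> 'rV[R]_n.+1)
  (@measurable_rV_cons n).

Section lebesgue_step.
Context n (m : {sigma_finite_measure set 'rV[R]_n -> \bar R}).

Definition lebesgue_step : set 'rV[R]_n.+1 -> \bar R :=
  pushforward (lebesgue_measure \x m)%E
    (@rV_cons n : measurableTypeR R * 'rV[R]_n -> 'rV[R]_n.+1).

Let lebesgue_step0 : lebesgue_step set0 = 0%E.
Proof. exact: measure0. Qed.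

Let lebesgue_step_ge0 A : (0 <= lebesgue_step A)%E.
Proof. exact: measure_ge0. Qed.

Let lebesgue_step_sigma_additive : semi_sigma_additive lebesgue_step.
Proof. exact: measure_semi_sigma_additive. Qed.

HB.instance Definition _ := isMeasure.Build _ _ _ lebesgue_step
  lebesgue_step0 lebesgue_step_ge0 lebesgue_step_sigma_additive.

Lemma lebesgue_step_box (A : set (measurableTypeR R)) (B : set 'rV[R]_n) :
  measurable A -> measurable B ->
  lebesgue_step [set y : 'rV[R]_(1 + n) | A (y ord0 ord0) /\ B (rsubmx y)] =
    (lebesgue_measure A * m B)%E.
Proof.
move=> mA mB; rewrite -product_measure1E// /lebesgue_step /pushforward.
congr (_ _); apply/seteqP; split => -[t x] /=;
  rewrite (_ : ord0 = lshift n (ord0 : 'I_1)) ?row_mxEl ?mxE ?row_mxKr//;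
  exact/val_inj.
Qed.

Let lebesgue_step_sigma_finite : sigma_finite setT lebesgue_step.
Proof.
have /sigma_finiteP[F [F_T F_nd F_oo]] :=
  @sigma_finiteT _ _ _ (@lebesgue_measure R).
have /sigma_finiteP[G [G_T G_nd G_oo]] := sigma_finiteT m.
exists (fun k => [set y : 'rV[R]_(1 + n) |
  F k (y ord0 ord0) /\ G k (rsubmx y)]).
  apply/seteqP; split => // y _.
  have [i _ Fi] : (\bigcup_i F i) ((y : 'rV_(1 + n)) ord0 ord0) by rewrite -F_T.
  have [j _ Gj] : (\bigcup_i G i) (@rsubmx R 1 1 n y) by rewrite -G_T.
  exists (maxn i j) => //; split.
    by move/subsetPset: (F_nd i (maxn i j) (leq_maxl _ _)); apply.
  by move/subsetPset: (G_nd j (maxn i j) (leq_maxr _ _)); apply.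
move=> k; have [mF Foo] := F_oo k; have [mG Goo] := G_oo k; split.
- apply: measurableI.
    rewrite -[X in measurable X]setTI.
    exact: (@measurable_rV_coord n.+1 ord0).
  rewrite -[X in measurable X]setTI.
  suff : measurable_fun setT (@rsubmx R 1 1 n : 'rV[R]_n.+1 -> 'rV[R]_n) by exact.
  apply/measurable_fun_rVP => i.
  rewrite (_ : (fun x => _) = (fun x : 'rV[R]_n.+1 => x ord0 (rshift 1 i))).
    exact: measurable_rV_coord.
  by apply/funext => x; rewrite mxE.
- by rewrite lebesgue_step_box//; apply: lte_mul_pinfty => //;
    rewrite ge0_fin_numE.
Qed.

HB.instance Definition _ := Measure_isSigmaFinite.Build _ _ _ lebesgue_step
  lebesgue_step_sigma_finite.

End lebesgue_step.

(* Lebesgue measure on R^n, as an iterated product measure. *)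
Fixpoint lebesgue_Rn n : {sigma_finite_measure set 'rV[R]_n -> \bar R} :=
  match n with
  | 0 => dirac (0 : 'rV[R]_0)
  | n'.+1 => lebesgue_step (lebesgue_Rn n')
  end.

End lebesgue_measure_Rn.

Section ComplexLp.
Context d (T : measurableType d) (R : realType).
Variable mu : {measure set T -> \bar R}.
Implicit Types f g : T -> R[i].

Definition cmeasurable f :=
  measurable_fun setT (cRe \o f) /\ measurable_fun setT (cIm \o f).

Definition cLnorm (p : \bar R) f : \bar R :=
  'N[mu]_p[(fun x => (normc (f x))%:E)]%E.

(* [p] ranges over ]0, +oo] here, +oo giving the essential supremum. *)
Definition mem_Lp (p : \bar R) f := cmeasurable f /\ (cLnorm p f < +oo)%E.

Lemma normcE (z : R[i]) : normc z = Num.sqrt (cRe z ^+ 2 + cIm z ^+ 2).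
Proof. by case: z. Qed.

Lemma normc_ge0 (z : R[i]) : 0 <= normc z.
Proof. by rewrite normcE sqrtr_ge0. Qed.

Lemma norm_normc (z : R[i]) : `|z| = (normc z)%:C%C.
Proof. by []. Qed.

Lemma ler_normcD (z w : R[i]) : normc (z + w) <= normc z + normc w.
Proof. by have := ler_normD z w; rewrite /= !norm_normc -rmorphD lecR. Qed.

Lemma normc_eq0 (z : R[i]) : normc z = 0 -> z = 0.
Proof. exact: Normc.eq0_normc. Qed.

Lemma cmeasurable_normc f : cmeasurable f ->
  measurable_fun setT (fun x => normc (f x)).
Proof.
move=> [mr mi].
rewrite (_ : (fun x => _) =
  (@Num.sqrt R) \o (fun x => cRe (f x) ^+ 2 + cIm (f x) ^+ 2)); last first.
  by apply/funext => x /=; rewrite normcE.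
apply: measurableT_comp; first by apply: continuous_measurable_fun; exact: sqrt_continuous.
by apply: measurable_funD; apply: measurable_funX.
Qed.

Lemma measurable_EFin_normc f : cmeasurable f ->
  measurable_fun setT (fun x => (normc (f x))%:E).
Proof. by move=> mf; exact/measurable_EFinP/cmeasurable_normc. Qed.

Lemma cmeasurable0 : cmeasurable 0.
Proof. by split; apply: measurable_cst. Qed.

Lemma cmeasurableD f g : cmeasurable f -> cmeasurable g -> cmeasurable (f + g).
Proof.
move=> [fr fi] [gr gi]; split.
- rewrite (_ : _ \o _ = (cRe \o f) \+ (cRe \o g)); first exact: measurable_funD.
  by apply/funext => x /=; rewrite fctE; case: (f x) (g x) => [? ?] [? ?].
- rewrite (_ : _ \o _ = (cIm \o f) \+ (cIm \o g)); first exact: measurable_funD.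
  by apply/funext => x /=; rewrite fctE; case: (f x) (g x) => [? ?] [? ?].
Qed.

Lemma cmeasurableZ (c : R[i]) f : cmeasurable f -> cmeasurable (c *: f).
Proof.
move=> [fr fi]; case: c => u v; split.
- rewrite (_ : _ \o _ = (cst u \* (cRe \o f)) \- (cst v \* (cIm \o f))).
    by apply: measurable_funB; apply: measurable_funM.
  by apply/funext => x /=; rewrite fctE; case: (f x).
- rewrite (_ : _ \o _ = (cst u \* (cIm \o f)) \+ (cst v \* (cRe \o f))).
    by apply: measurable_funD; apply: measurable_funM.
  by apply/funext => x /=; rewrite fctE; case: (f x).
Qed.

Lemma cLnorm_ge0 p f : (0 <= cLnorm p f)%E.
Proof. exact: Lnorm_ge0. Qed.

Lemma cLnorm0 p : (1 <= p)%E -> cLnorm p 0 = 0%E.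
Proof.
move=> p1; rewrite /cLnorm (_ : (fun x => _) = cst 0%E); last first.
  by apply/funext => x; rewrite Normc.normc0.
by rewrite Lnorm0// gt_eqF// (lt_le_trans _ p1).
Qed.

Lemma le_Lnorm_normc (p : R) (f g : T -> R) : 1 <= p ->
  measurable_fun setT f -> measurable_fun setT g ->
  (forall x, 0 <= f x <= g x) ->
  ('N[mu]_p%:E[EFin \o f] <= 'N[mu]_p%:E[EFin \o g])%E.
Proof.
move=> p1 mf mg fg; have p0 : 0 < p by exact: lt_le_trans p1.
have mp (h : T -> R) : measurable_fun setT h ->
    measurable_fun setT (fun x => (`|(EFin \o h) x| `^ p)%E).
  move=> mh; apply: (@measurableT_comp _ _ _ _ _ _ (fun x => x `^ p)%E).
    exact: (measurable_poweR p).
  by apply: (@measurableT_comp _ _ _ _ _ _ (@abse R)) => //; exact/measurable_EFinP.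
rewrite unlock /Lnorm.
apply: gt0_ler_poweR; rewrite ?invr_ge0 ?(ltW p0)//.
- by rewrite in_itv/= leey andbT; apply: integral_ge0 => x _; rewrite lee_fin powR_ge0.
- by rewrite in_itv/= leey andbT; apply: integral_ge0 => x _; rewrite lee_fin powR_ge0.
apply: ge0_le_integral => //=; do ?by move=> x _; rewrite lee_fin powR_ge0.
- exact: mp.
- exact: mp.
move=> x _; have /andP[f0 fg'] := fg x.
rewrite lee_fin !ger0_norm ?(le_trans f0)//.
by rewrite ge0_ler_powR ?nnegrE ?(ltW p0) ?(le_trans f0).
Qed.

Lemma cLnormD (p : R) f g : 1 <= p -> cmeasurable f -> cmeasurable g ->
  (cLnorm p%:E (f + g)%R <= cLnorm p%:E f + cLnorm p%:E g)%E.
Proof.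
move=> p1 mf mg.
have mnf := cmeasurable_normc mf; have mng := cmeasurable_normc mg.
apply: (@le_trans _ _ ('N[mu]_p%:E[EFin \o
   ((fun x => normc (f x)) \+ (fun x => normc (g x)))%R])%E); last first.
  exact: (@eminkowski _ _ _ mu (fun x => normc (f x)) (fun x => normc (g x)) p%:E).
apply: (@le_Lnorm_normc p (fun x => normc ((f + g) x))) => //.
- exact/cmeasurable_normc/cmeasurableD.
- exact: measurable_funD.
- by move=> x; rewrite normc_ge0/= ler_normcD.
Qed.

Lemma cLnormZ (p : R) (c : R[i]) f : 1 <= p -> mem_Lp p%:E f ->
  (cLnorm p%:E (c *: f)%R = (normc c)%:E * cLnorm p%:E f)%E.
Proof.
move=> p1 [mf ff].
have Lf : (fun x => normc (f x)) \in Lfun mu p%:E.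
  by apply/andP; split; rewrite inE/=; [exact: cmeasurable_normc|exact: ff].
have p1' : (1 <= p%:E)%E by [].
have := LnormZ (@Lfun_Sub _ _ _ mu _ p1' _ Lf) (normc c).
rewrite ger0_norm ?normc_ge0// => <-.
rewrite /cLnorm; congr (Lnorm _ _ _).
by apply/funext => x /=; rewrite fctE Normc.normcM.
Qed.


Variables (p : R) (p1 : 1 <= p).

Definition Lp_pred & 1 <= p : {pred T -> R[i]} := fun f => `[< mem_Lp p%:E f >].
Local Notation pred := (Lp_pred p1).

Lemma Lp_predP f : reflect (mem_Lp p%:E f) (f \in pred).
Proof. exact: asboolP. Qed.

Lemma Lp_submod_closed : submod_closed pred.
Proof.
split.
  by apply/Lp_predP; split; [exact: cmeasurable0|rewrite cLnorm0// ltry].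
move=> c f g /Lp_predP Lf /Lp_predP Lg; apply/Lp_predP; split.
  by apply: cmeasurableD; [apply: cmeasurableZ; case: Lf|case: Lg].
have [mf ff] := Lf; have [mg fg] := Lg.
apply: (le_lt_trans (cLnormD p1 (cmeasurableZ c mf) mg)).
by rewrite lte_add_pinfty// cLnormZ// lte_mul_pinfty// lee_fin normc_ge0.
Qed.
HB.instance Definition _ :=
  GRing.isSubmodClosed.Build _ _ pred Lp_submod_closed.

Definition Lp_fun := {f : T -> R[i] | f \in pred}.
HB.instance Definition _ := [isSub of Lp_fun for @sval _ _].
HB.instance Definition _ := [Choice of Lp_fun by <:].
HB.instance Definition _ := [SubChoice_isSubLmodule of Lp_fun by <:].

Lemma Lp_funP (f : Lp_fun) : mem_Lp p%:E (val f).
Proof. exact/Lp_predP/valP. Qed.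


Definition Lp_null : {pred Lp_fun} :=
  fun f : Lp_fun => `[< {ae mu, forall x, val f x = 0} >].

Lemma Lp_null_zmod_closed : zmod_closed Lp_null.
Proof.
split; first by apply/asboolP; apply/aeW => x.
move=> f g /asboolP f0 /asboolP g0; apply/asboolP.
apply: filterS2 f0 g0 => x f0 g0.
by rewrite raddfB -[LHS]/(val f x - val g x) f0 g0 subrr.
Qed.
HB.instance Definition _ :=
  GRing.isZmodClosed.Build _ Lp_null Lp_null_zmod_closed.

(* The complex L_p space: p-integrable functions modulo null functions, as a
   [normedModType R[i]]. *)
Definition Lp := Quotient.quot Lp_null.
HB.instance Definition _ := GRing.Zmodule.on Lp.
HB.instance Definition _ := EqQuotient.on Lp.

Definition Lp_repr (F : Lp) : T -> R[i] := val (repr F).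

Local Open Scope quotient_scope.

Definition Lp_class (u : Lp_fun) : Lp := \pi_Lp u.

Lemma Lp_classP (u v : Lp_fun) :
  Lp_class u = Lp_class v <-> {ae mu, forall x, val u x = val v x}.
Proof.
rewrite (rwP eqP) /Lp_class -(Quotient.idealrBE Lp_null).
split=> [/asboolP|uv]; last apply/asboolP; last first.
  by apply: filterS uv => x uv; rewrite raddfB -[LHS]/(val u x - val v x) uv subrr.
by apply: filterS => x; rewrite raddfB -[LHS]/(val u x - val v x) => /eqP; rewrite subr_eq0 => /eqP.
Qed.

Lemma Lp_reprK (F : Lp) : Lp_class (repr F) = F.
Proof. exact: reprK. Qed.

Lemma Lp_class_reprP (u : Lp_fun) :
  {ae mu, forall x, Lp_repr (Lp_class u) x = val u x}.
Proof. by apply/Lp_classP; rewrite Lp_reprK. Qed.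

Lemma Lp_classD (u v : Lp_fun) : Lp_class (u + v) = Lp_class u + Lp_class v.
Proof. by rewrite /Lp_class -raddfD. Qed.

Definition Lp_scale (c : R[i]) (F : Lp) : Lp := Lp_class (c *: repr F).

Lemma Lp_scale_class c (u : Lp_fun) :
  Lp_scale c (Lp_class u) = Lp_class (c *: u).
Proof.
apply/Lp_classP; apply: filterS (Lp_class_reprP u) => x.
move=> e; rewrite !linearZ -[LHS]/(c * Lp_repr (Lp_class u) x).
by rewrite e.
Qed.

Lemma Lp_scaleA a b F : Lp_scale a (Lp_scale b F) = Lp_scale (a * b) F.
Proof. by rewrite -(Lp_reprK F) !Lp_scale_class scalerA. Qed.

Lemma Lp_scale1 : left_id 1 Lp_scale.
Proof. by move=> F; rewrite -(Lp_reprK F) Lp_scale_class scale1r. Qed.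

Lemma Lp_scaleDr : right_distributive Lp_scale +%R.
Proof.
move=> c F G; rewrite -(Lp_reprK F) -(Lp_reprK G).
by rewrite -Lp_classD !Lp_scale_class scalerDr Lp_classD.
Qed.

Lemma Lp_scaleDl F : {morph Lp_scale^~ F : a b / a + b}.
Proof.
move=> a b; rewrite -(Lp_reprK F).
by rewrite !Lp_scale_class scalerDl Lp_classD.
Qed.

HB.instance Definition _ := GRing.Zmodule_isLmodule.Build R[i] Lp
  Lp_scaleA Lp_scale1 Lp_scaleDr Lp_scaleDl.

Definition Lp_norm (F : Lp) : R[i] := (fine (cLnorm p%:E (Lp_repr F)))%:C%C.

Lemma Lp_fun_norm_fin (u : Lp_fun) : cLnorm p%:E (val u) \is a fin_num.
Proof. by rewrite ge0_fin_numE ?cLnorm_ge0//; case: (Lp_funP u). Qed.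

Lemma eq_ae_cLnorm f g : cmeasurable f -> cmeasurable g ->
  {ae mu, forall x, f x = g x} -> cLnorm p%:E f = cLnorm p%:E g.
Proof.
move=> mf mg fg; rewrite /cLnorm unlock /Lnorm; congr (_ `^ _)%E.
have mp h : cmeasurable h ->
    measurable_fun setT (fun x => (`|(normc (h x))%:E| `^ p)%E).
  move=> mh; apply: (@measurableT_comp _ _ _ _ _ _ (fun x => x `^ p)%E).
    exact: (measurable_poweR p).
  apply: (@measurableT_comp _ _ _ _ _ _ (@abse R)) => //.
  exact/measurable_EFinP/cmeasurable_normc.
apply: ae_eq_integral => //; [exact: mp|exact: mp|].
by apply: filterS fg => x -> _.
Qed.

Lemma Lp_norm_class (u : Lp_fun) :
  Lp_norm (Lp_class u) = (fine (cLnorm p%:E (val u)))%:C%C.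
Proof.
rewrite /Lp_norm; congr ((fine _)%:C%C).
apply: eq_ae_cLnorm; last exact: Lp_class_reprP.
- by case: (Lp_funP (repr (Lp_class u))).
- by case: (Lp_funP u).
Qed.

Lemma Lp_ler_normD F G : Lp_norm (F + G) <= Lp_norm F + Lp_norm G.
Proof.
rewrite -(Lp_reprK F) -(Lp_reprK G) -Lp_classD !Lp_norm_class.
rewrite -rmorphD lecR -lee_fin EFinD !fineK ?Lp_fun_norm_fin//.
have [[mf _] [mg _]] := (Lp_funP (repr F), Lp_funP (repr G)).
by rewrite raddfD; apply: cLnormD.
Qed.

Lemma Lp_normZ (c : R[i]) F : Lp_norm (c *: F) = `|c| * Lp_norm F.
Proof.
rewrite -(Lp_reprK F) [_ *: _]Lp_scale_class !Lp_norm_class.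
rewrite norm_normc -rmorphM; congr (_%:C%C); apply: EFin_inj.
rewrite EFinM !fineK ?Lp_fun_norm_fin//.
by rewrite -cLnormZ//; exact: Lp_funP.
Qed.

Lemma Lp_norm_eq0 F : Lp_norm F = 0 -> F = 0.
Proof.
rewrite -(Lp_reprK F) Lp_norm_class => /(congr1 (@complex.Re _)) /= n0.
have mf : cmeasurable (val (repr F)) by case: (Lp_funP (repr F)).
have nf0 : cLnorm p%:E (val (repr F)) = 0%E.
  by rewrite -[LHS]fineK ?Lp_fun_norm_fin// n0.
have p0 : (0 < p%:E)%E by rewrite lte_fin (lt_le_trans _ p1).
have f0 := Lnorm_eq0_eq0 (measurable_EFin_normc mf) p0 nf0.
rewrite -[0](_ : Lp_class 0 = 0); last by rewrite /Lp_class raddf0.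
apply/Lp_classP; apply: filterS f0 => x /(_ I) [] /normc_eq0 e.
by rewrite raddf0; exact: e.
Qed.

HB.instance Definition _ := Lmodule_isNormed.Build R[i] Lp
  Lp_ler_normD Lp_normZ Lp_norm_eq0.

End ComplexLp.

(* Unbounded linear operators in a normed space, identified with their
   graphs. *)
Section operators.
Context (K : numFieldType) (X : normedModType K).

Definition operator := set (X * X).
Implicit Types (S T : operator) (z : K).

Definition is_operator T :=
  [/\ T (0, 0),
      forall c u v, T u -> T v -> T (c *: u.1 + v.1, c *: u.2 + v.2) &
      forall g, T (0, g) -> g = 0].

Definition op_domain T : set X := [set f | exists g, T (f, g)].
Definition op_range T : set X := [set g | exists f, T (f, g)].
Definition op_kernel T : set X := [set f | T (f, 0)].

Definition closed_operator T := is_operator T /\ closed T.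

Definition op_add S T : operator :=
  [set u | exists g h, [/\ S (u.1, g), T (u.1, h) & u.2 = g + h]].

(* [op_comp S T] is f |-> S (T f) *)
Definition op_comp S T : operator :=
  [set u | exists2 g, T (u.1, g) & S (g, u.2)].

Definition op_inv T : operator := [set u | T (u.2, u.1)].

(* T - z *)
Definition op_shift T z : operator := [set u | T (u.1, u.2 + z *: u.1)].

Definition op_of_fun (Q : X -> X) : operator := [set u | u.2 = Q u.1].

Definition op_eigenvalue T z := exists2 f, f != 0 & T (f, z *: f).

(* T is densely defined and Q is its (hence unique) extension to a bounded
   operator on the whole space. *)
Definition is_bounded_extension T (Q : {linear X -> X}) :=
  [/\ dense (op_domain T), continuous Q & T `<=` op_of_fun Q].

Definition finite_dim (V : set X) :=
  exists k (e : 'I_k -> X), forall f, V f ->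
    exists c : 'I_k -> K, f = \sum_i c i *: e i.

Definition finite_codim (V : set X) :=
  exists k (e : 'I_k -> X), forall f,
    exists2 g, V g & exists c : 'I_k -> K, f = g + \sum_i c i *: e i.

Definition fredholm T :=
  [/\ finite_dim (op_kernel T), closed (op_range T) &
      finite_codim (op_range T)].

Definition ess_spectrum T : set K := [set z | ~ fredholm (op_shift T z)].

End operators.

Section Rn.
Context {R : realType} {n : nat}.
Implicit Types (x y : 'rV[R]_n) (phi : 'rV[R]_n -> R).

(* The library norm on row vectors is the sup norm. *)
Definition enorm x : R := Num.sqrt (\sum_i x ord0 i ^+ 2).

(* [partial [:: i1; ...; ik] phi] is D_i1 (... (D_ik phi)) *)
Definition partial (s : seq 'I_n) phi : 'rV[R]_n -> R :=
  foldr (fun i g x => 'D_(delta_mx ord0 i) g x) phi s.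

Definition test_function phi :=
  [/\ forall s, continuous (partial s phi),
      forall s i x, derivable (partial s phi) x (delta_mx ord0 i) &
      compact (closure [set x | phi x != 0])].

Definition cintegral (f : 'rV[R]_n -> R[i]) : R[i] :=
  Complex (\int[lebesgue_Rn n]_x cRe (f x)) (\int[lebesgue_Rn n]_x cIm (f x)).

(* g is the weak derivative of order s of f *)
Definition weak_partial (s : seq 'I_n) (f g : 'rV[R]_n -> R[i]) :=
  forall phi, test_function phi ->
    cintegral (fun x => f x * (partial s phi x)%:C%C) =
    (-1) ^+ size s * cintegral (fun x => g x * (phi x)%:C%C).

Definition unit_ball x : set 'rV[R]_n := [set y | enorm (x - y) < 1].

Definition Mnorm (nu p : R) (u : 'rV[R]_n -> R[i]) : \bar R :=
  ereal_sup (range (fun x => (\int[lebesgue_Rn n]_(y in unit_ball x)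
    (normc (u y) `^ p * enorm (x - y) `^ (nu - n%:R))%:E)%E)).

Definition vanishes_at_infinity (q : 'rV[R]_n -> R[i]) :=
  forall eps : R, 0 < eps -> exists r : R, forall x, r < enorm x ->
    (\int[lebesgue_Rn n]_(y in unit_ball x) (normc (q y))%:E < eps%:E)%E.

End Rn.

Section schrodinger.
Context {R : realType} {n : nat} {p : R} (p1 : 1 <= p).
Local Notation X := (Lp (lebesgue_Rn n) p1 : normedModType R[i]).

Definition sobolev2 : set X :=
  [set f | forall s : seq 'I_n, (size s <= 2)%N ->
     exists g : X, weak_partial s (Lp_repr f) (Lp_repr g)].

(* -Delta in L_p with domain W_p^2 *)
Definition free_operator : operator X :=
  [set u | sobolev2 u.1 /\
     exists2 g : 'I_n -> X,
       forall i, weak_partial [:: i; i] (Lp_repr u.1) (Lp_repr (g i)) &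
       u.2 = - \sum_i g i].

(* multiplication by a with its maximal domain *)
Definition mul_operator (a : 'rV[R]_n -> R[i]) : operator X :=
  [set u | {ae lebesgue_Rn n,
     forall x, Lp_repr u.2 x = a x * Lp_repr u.1 x}].

(* B (H_0 - z)^-1 A *)
Definition birman_schwinger (a b : 'rV[R]_n -> R[i]) (z : R[i]) : operator X :=
  op_comp (mul_operator b)
    (op_comp (op_inv (op_shift free_operator z)) (mul_operator a)).

(* H is a Schroedinger operator associated with -Delta + ab and the
   factorization ab. In the order of R[i], [0 <= z] means that z is real and
   nonnegative. *)
Definition is_schrodinger (a b : 'rV[R]_n -> R[i]) (H : operator X) :=
  [/\ closed_operator H,
      op_add free_operator (op_comp (mul_operator a) (mul_operator b)) `<=` H,
      ess_spectrum H = [set z | 0 <= z] &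
      forall z : R[i], ~~ (0 <= z) ->
        op_eigenvalue H z <->
        exists2 Q : {linear X -> X},
          is_bounded_extension (birman_schwinger a b z) Q &
          op_eigenvalue (op_of_fun Q) (-1)].

End schrodinger.

Definition Gamma {R : realType} (x : R) : R :=
  \int[lebesgue_measure]_(t in `]0, +oo[%classic) (t `^ (x - 1) * expR (- t)).

(* Main.v *)
(* By the Birman-Schwinger principle it suffices to bound the norm of
   B (H_0 - lambda)^-1 A. For a unimodular om with Re om > 0 the resolvent is, up
   to a unimodular factor, the integral over s > 0 of e^(lambda z) e^(z Delta) at the
   complex time z = s / om. The kernel of e^(z Delta) has modulus at most
   (4 pi s)^(-n/2) and e^(z Delta) is a contraction of L_2, so by Riesz-Thorin it
   maps L_(1/t) to L_(1/(1-t)) with norm at most (4 pi s)^(-n(t - 1/2)). With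
   c = - Re (lambda / om) > 0, integration in s gives
   (4 pi)^(alpha - 1) Gamma(alpha) c^(-alpha), Hoelder's inequality adds the factors
   |a|_r and |b|_s, and c tends to |Im lambda| as om tends to the imaginary axis.

   No semigroup or resolvent is constructed: if u weakly solves
   (- Delta - lambda) u = f, then s |-> e^(lambda z) <phi, e^(z Delta) u> is
   differentiated directly, the weak equation being tested against Gaussians.
   Riesz-Thorin is proved for finite matrices by the tensor power trick and reaches
   integral kernels by approximation with functions of finitely many values. *)
Require Import Defs.
From HB Require Import structures.
From mathcomp Require Import all_boot all_order all_algebra.
From mathcomp Require Import complex.
From mathcomp Require Import all_classical all_reals all_analysis.
From mathcomp Require Import measurable_realfun ess_sup_inf.
From mathcomp Require Import ring lra.

Set Implicit Arguments.
Unset Strict Implicit.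
Unset Printing Implicit Defensive.

Import Order.TTheory GRing.Theory Num.Theory numFieldNormedType.Exports.

Local Open Scope classical_set_scope.
Local Open Scope ring_scope.

(** * Integration of complex-valued functions *)

Section complex_arithmetic.
Context {R : realType}.
Implicit Types z w : R[i].

(** Put rho = 1/r, sig = 1/s and t = rho + 1/p. The relation rho - sig = 1 - 2/p reads 1/p = sig +
    (1 - t): a maps L_p to L_(1/t), the resolvent maps L_(1/t) to its dual L_(1/(1-t)), and b maps
    back to L_p. As 2 t - 1 = rho + sig, the kernel bound at time tau is of order tau^(alpha - 1),
    integrable at 0 because alpha > 0. Two obstacles shape the proof. A solution u is only known to
    lie in L_p, so its L_(1/(1-t)) norm cannot be presupposed finite: u is paired with bounded,
    compactly supported functions, and membership follows from truncated extremals. And om cannot be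
    taken imaginary, since the kernel is then not integrable; constants depending on Re om enter
    integrability and limits but drop out of the estimate. The kernel is used without its unimodular
    factor om^(n/2). That factor does not depend on time, so the heat equation is respected and no
    root is chosen; in return the kernel integrates to a number of modulus 1 instead of 1. The
    contraction in L_2 comes not from Plancherel's theorem but from K K^*, a real Gaussian kernel of
    mass 1, and Schur's test. *)

Lemma complexP z w : cRe z = cRe w -> cIm z = cIm w -> z = w.
Proof. by case: z w => [a b] [c d] /= -> ->. Qed.

Lemma cReD z w : cRe (z + w) = cRe z + cRe w. Proof. by case: z w => ? ? []. Qed.
Lemma cImD z w : cIm (z + w) = cIm z + cIm w. Proof. by case: z w => ? ? []. Qed.
Lemma cReN z : cRe (- z) = - cRe z. Proof. by case: z. Qed.
Lemma cImN z : cIm (- z) = - cIm z. Proof. by case: z. Qed.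
Lemma cReM z w : cRe (z * w) = cRe z * cRe w - cIm z * cIm w.
Proof. by case: z w => ? ? []. Qed.
Lemma cImM z w : cIm (z * w) = cRe z * cIm w + cIm z * cRe w.
Proof. by case: z w => ? ? []. Qed.

Lemma cRe_sum (I : Type) (s : seq I) (P : pred I) (F : I -> R[i]) :
  cRe (\sum_(i <- s | P i) F i) = \sum_(i <- s | P i) cRe (F i).
Proof. by apply: (big_morph _ cReD). Qed.
Lemma cIm_sum (I : Type) (s : seq I) (P : pred I) (F : I -> R[i]) :
  cIm (\sum_(i <- s | P i) F i) = \sum_(i <- s | P i) cIm (F i).
Proof. by apply: (big_morph _ cImD). Qed.

Lemma normc_real (x : R) : normc (x%:C%C) = `|x|.
Proof. by rewrite Defs.normcE /= expr0n addr0 sqrtr_sqr. Qed.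

Lemma normc_conj z : normc (z^*)%C = normc z.
Proof. by case: z => a b /=; rewrite sqrrN. Qed.

Lemma mul_conjc z : z * (z^*)%C = (normc z ^+ 2)%:C%C.
Proof.
rewrite Defs.normcE sqr_sqrtr ?addr_ge0 ?sqr_ge0//.
by case: z => a b; apply: complexP; rewrite /=; ring.
Qed.

Lemma cRe_le_normc z : `|cRe z| <= normc z.
Proof. by rewrite Defs.normcE -sqrtr_sqr ler_wsqrtr// lerDl sqr_ge0. Qed.

Lemma cIm_le_normc z : `|cIm z| <= normc z.
Proof. by rewrite Defs.normcE -sqrtr_sqr ler_wsqrtr// lerDr sqr_ge0. Qed.

Lemma normc_sum (I : Type) (s : seq I) (P : pred I) (F : I -> R[i]) :
  normc (\sum_(i <- s | P i) F i) <= \sum_(i <- s | P i) normc (F i).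
Proof.
elim/big_ind2: _ => [|z x w y zx wy|i _] //; first by rewrite Normc.normc0.
by rewrite (le_trans (ler_normcD _ _))// lerD.
Qed.

(** Division by zero makes the phase 0 at z = 0, so that [mul_phase] and [conj_phase_mul] hold
    without exception while the modulus is at most 1 instead of equal to 1. *)
Definition phase z : R[i] := z / (normc z)%:C%C.

Lemma phase_le1 z : normc (phase z) <= 1.
Proof.
rewrite /phase Normc.normcM Normc.normcV normc_real ger0_norm ?normc_ge0//.
have [->|z0] := eqVneq (normc z) 0; first by rewrite invr0 mulr0.
by rewrite divff.
Qed.

Lemma mul_phase z : (normc z)%:C%C * phase z = z.
Proof.
rewrite /phase; have [/eqP z0|z0] := boolP (normc z == 0).
  by rewrite z0 mul0r (normc_eq0 z0).
by rewrite mulrCA divff ?mulr1// eq_complex /= (negbTE z0).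
Qed.

Lemma conj_phase_mul z : ((phase z)^*)%C * z = (normc z)%:C%C.
Proof.
have [/eqP z0|z0] := boolP (normc z == 0).
  by rewrite z0 (normc_eq0 z0) mulr0.
have nz0 : (normc z)%:C%C != 0 :> R[i].
  by apply: contra z0 => /eqP/(congr1 (@complex.Re R)) z0; apply/eqP.
have -> : ((phase z)^*)%C = (z^*)%C / (normc z)%:C%C.
  by rewrite /phase (rmorphM (@conjc R)) (fmorphV (@conjc R)) -[in RHS]conjc_real.
rewrite mulrAC [_ * z]mulrC mul_conjc.
by rewrite rmorphXn expr2 mulfK.
Qed.

Definition cexp z : R[i] := Complex (expR (cRe z) * cos (cIm z)) (expR (cRe z) * sin (cIm z)).

Lemma cexpD z w : cexp (z + w) = cexp z * cexp w.
Proof.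
by apply: complexP; rewrite /cexp ?cReM ?cImM /= cReD cImD expRD ?cosD ?sinD; ring.
Qed.

Lemma cexp0 : cexp 0 = 1.
Proof. by apply: complexP; rewrite /cexp /= expR0 ?cos0 ?sin0 ?mulr1 ?mulr0. Qed.

Lemma normc_cexp z : normc (cexp z) = expR (cRe z).
Proof.
rewrite Defs.normcE /= !exprMn -mulrDr cos2Dsin2 mulr1 sqrtr_sqr ger0_norm//.
Qed.

Lemma cexp_conj z : cexp (z^*)%C = ((cexp z)^*)%C.
Proof. by case: z => a b; rewrite /cexp /= cosN sinN mulrN. Qed.

Lemma cexp_real (x : R) : cexp (x%:C%C) = (expR x)%:C%C.
Proof. by rewrite /cexp /= cos0 sin0 mulr1 mulr0. Qed.

Lemma cexp_sum (I : Type) (s : seq I) (P : pred I) (F : I -> R[i]) :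
  cexp (\sum_(i <- s | P i) F i) = \prod_(i <- s | P i) cexp (F i).
Proof. by apply: (big_morph _ cexpD); exact: cexp0. Qed.

End complex_arithmetic.

Section cmeasurable_theory.
Context d (T : measurableType d) (R : realType).
Implicit Types f g : T -> R[i].

Lemma cmeasurable_cst (c : R[i]) : cmeasurable (fun _ : T => c).
Proof. by split; exact: measurable_cst. Qed.

Lemma cmeasurable_add f g : cmeasurable f -> cmeasurable g ->
  cmeasurable (fun x => f x + g x).
Proof. exact: cmeasurableD. Qed.

Lemma cmeasurableM f g : cmeasurable f -> cmeasurable g ->
  cmeasurable (fun x => f x * g x).
Proof.
move=> [fr fi] [gr gi]; split.
- rewrite (_ : _ \o _ = ((cRe \o f) \* (cRe \o g)) \- ((cIm \o f) \* (cIm \o g))).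
    by apply: measurable_funB; apply: measurable_funM.
  by apply/funext => x /=; rewrite cReM.
- rewrite (_ : _ \o _ = ((cRe \o f) \* (cIm \o g)) \+ ((cIm \o f) \* (cRe \o g))).
    by apply: measurable_funD; apply: measurable_funM.
  by apply/funext => x /=; rewrite cImM.
Qed.

Lemma cmeasurable_real (h : T -> R) : measurable_fun setT h ->
  cmeasurable (fun x => (h x)%:C%C).
Proof. by move=> mh; split => //; exact: measurable_cst. Qed.

Lemma cmeasurableN f : cmeasurable f -> cmeasurable (fun x => - f x).
Proof.
move=> mf; rewrite (_ : (fun _ => _) = (fun x => (-1) * f x)).
  by apply: cmeasurableM => //; exact: cmeasurable_cst.
by apply/funext => x; rewrite mulN1r.
Qed.

Lemma cmeasurable_conj f : cmeasurable f -> cmeasurable (fun x => ((f x)^*)%C).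
Proof.
move=> [fr fi]; split.
- by rewrite (_ : _ \o _ = cRe \o f)//; apply/funext => x /=; case: (f x).
- rewrite (_ : _ \o _ = \- (cIm \o f)); first exact: measurableT_comp.
  by apply/funext => x /=; case: (f x).
Qed.

Lemma cmeasurable_cexp f : cmeasurable f -> cmeasurable (fun x => cexp (f x)).
Proof.
move=> [fr fi]; split; rewrite /comp /cexp /=; apply: measurable_funM;
  try exact: (measurableT_comp (@measurable_expR R) fr).
- apply: measurableT_comp => //; apply: continuous_measurable_fun.
  exact: continuous_cos.
- apply: measurableT_comp => //; apply: continuous_measurable_fun.
  exact: continuous_sin.
Qed.

Lemma cmeasurable_phase f : cmeasurable f -> cmeasurable (fun x => phase (f x)).
Proof.
move=> mf; rewrite (_ : (fun _ => _) =
    (fun x => f x * ((normc (f x))^-1)%:C%C)); last first.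
  by apply/funext => x; rewrite /phase fmorphV.
apply: cmeasurableM => //; apply: cmeasurable_real.
rewrite (_ : (fun _ => _) = (fun x => normc (f x) `^ (-1))).
  by apply: (measurableT_comp (measurable_powR _)) => //; exact: cmeasurable_normc.
by apply/funext => x; rewrite powR_inv1 ?normc_ge0.
Qed.

Lemma cmeasurable_prod (I : Type) (s : seq I) (f : I -> T -> R[i]) : (forall i, cmeasurable (f i)) ->
  cmeasurable (fun x => \prod_(i <- s) f i x).
Proof.
move=> mf; elim: s => [|i s ih].
  by under eq_fun do [rewrite big_nil]; exact: cmeasurable_cst.
by under eq_fun do [rewrite big_cons]; exact: cmeasurableM.
Qed.

End cmeasurable_theory.

Lemma cmeasurable_comp d1 d2 (T1 : measurableType d1) (T2 : measurableType d2)
    (R : realType) (f : T2 -> R[i]) (h : T1 -> T2) :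
  measurable_fun setT h -> cmeasurable f -> cmeasurable (fun x => f (h x)).
Proof.
by move=> mh [fr fi]; split; [apply: (measurableT_comp fr)|apply: (measurableT_comp fi)].
Qed.

Section complex_integral.
Context d (T : measurableType d) (R : realType) (mu : {measure set T -> \bar R}).
Implicit Types (f : T -> R[i]) (h g : T -> R).

Definition rintble h := mu.-integrable setT (EFin \o h).

(** For Lebesgue measure on R^n this is convertible with the [cintegral] that occurs in
    [weak_partial]. *)
Definition cint f : R[i] := Complex (\int[mu]_x cRe (f x)) (\int[mu]_x cIm (f x)).

Definition cintble f := cmeasurable f /\ rintble (fun x => normc (f x)).

Lemma rintble_le h g : measurable_fun setT h -> rintble g ->
  (forall x, `|h x| <= g x) -> rintble h.
Proof.
move=> mh ig hg; apply: (le_integrable measurableT _ _ ig); first exact/measurable_EFinP.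
by move=> x _; rewrite /= lee_fin (le_trans (hg x))// ler_norm.
Qed.

Lemma rintble_measurable h : rintble h -> measurable_fun setT h.
Proof. by move=> /measurable_int/measurable_EFinP. Qed.

Lemma rintbleD h g : rintble h -> rintble g -> rintble (fun x => h x + g x).
Proof. by move=> ih ig; have := integrableD measurableT ih ig. Qed.

Lemma rintbleZ c h : rintble h -> rintble (fun x => c * h x).
Proof. by move=> ih; have := integrableZl measurableT c ih. Qed.

Lemma rintbleP h : measurable_fun setT h -> (forall x, 0 <= h x) ->
  (\int[mu]_x (h x)%:E < +oo)%E -> rintble h.
Proof.
move=> mh h0 hoo; apply/integrableP; split; first exact/measurable_EFinP.
by under eq_integral do rewrite /= ger0_norm//.
Qed.

Lemma rintble_ltey h : rintble h -> (forall x, 0 <= h x) ->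
  (\int[mu]_x (h x)%:E < +oo)%E.
Proof.
move=> /integrableP[_ +] h0.
by under eq_integral do rewrite /= ger0_norm//.
Qed.

Lemma EFin_rint h : rintble h -> (\int[mu]_x h x)%:E = (\int[mu]_x (h x)%:E)%E.
Proof. by move=> ih; rewrite /Rintegral fineK//; exact: integrable_fin_num. Qed.

Lemma cintble_le f h : cmeasurable f -> rintble h ->
  (forall x, normc (f x) <= h x) -> cintble f.
Proof.
move=> mf ih fh; split => //; apply: (rintble_le _ ih).
  exact: cmeasurable_normc.
by move=> x; rewrite ger0_norm ?normc_ge0.
Qed.

Lemma cintble_Re f : cintble f -> rintble (fun x => cRe (f x)).
Proof. by move=> [[mr mi] inf]; apply: (rintble_le mr inf) => x; exact: cRe_le_normc. Qed.

Lemma cintble_Im f : cintble f -> rintble (fun x => cIm (f x)).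
Proof. by move=> [[mr mi] inf]; apply: (rintble_le mi inf) => x; exact: cIm_le_normc. Qed.

Lemma cintbleD f (g : T -> R[i]) : cintble f -> cintble g -> cintble (fun x => f x + g x).
Proof.
move=> [mf jf] [mg jg]; apply: (cintble_le _ (rintbleD jf jg)).
  exact: cmeasurable_add.
by move=> x; exact: ler_normcD.
Qed.

Lemma cintbleZ c f : cintble f -> cintble (fun x => c * f x).
Proof.
move=> [mf jf]; apply: (cintble_le _ (rintbleZ (normc c) jf)).
  by apply: cmeasurableM => //; exact: cmeasurable_cst.
by move=> x; rewrite Normc.normcM.
Qed.

Lemma cintbleN f : cintble f -> cintble (fun x => - f x).
Proof.
by move=> /(cintbleZ (-1)); under eq_fun do rewrite mulN1r.
Qed.

Lemma cintD f (g : T -> R[i]) : cintble f -> cintble g ->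
  cint (fun x => f x + g x) = cint f + cint g.
Proof.
move=> jf jg; apply: complexP; rewrite ?cReD ?cImD /=.
- under eq_Rintegral do rewrite cReD.
  by rewrite RintegralD//; exact: cintble_Re.
- under eq_Rintegral do rewrite cImD.
  by rewrite RintegralD//; exact: cintble_Im.
Qed.

Lemma cintZ c f : cintble f -> cint (fun x => c * f x) = c * cint f.
Proof.
move=> jf; have [jr ji] := (cintble_Re jf, cintble_Im jf).
apply: complexP; rewrite ?cReM ?cImM /=.
- under eq_Rintegral do rewrite cReM.
  by rewrite RintegralB//; [rewrite !RintegralZl|exact: rintbleZ..].
- under eq_Rintegral do rewrite cImM.
  by rewrite RintegralD//; [rewrite !RintegralZl|exact: rintbleZ..].
Qed.

Lemma cintN f : cintble f -> cint (fun x => - f x) = - cint f.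
Proof.
by move=> jf; rewrite -mulN1r -cintZ//; congr cint; apply/funext => x; rewrite mulN1r.
Qed.

Lemma cintB f (g : T -> R[i]) : cintble f -> cintble g ->
  cint (fun x => f x - g x) = cint f - cint g.
Proof. by move=> jf jg; rewrite cintD ?cintN//; exact: cintbleN. Qed.

Lemma cintble_cst0 : cintble (fun _ => 0).
Proof.
split; first exact: cmeasurable_cst.
rewrite (_ : (fun _ => _) = fun _ => 0); last by apply/funext => x; rewrite Normc.normc0.
exact: integrable0.
Qed.

Lemma cintble_sum (I : Type) (s : seq I) (P : pred I) (F : I -> T -> R[i]) :
  (forall i, cintble (F i)) -> cintble (fun x => \sum_(i <- s | P i) F i x).
Proof.
move=> jF; elim: s => [|i s ih].
  by under eq_fun do [rewrite big_nil]; exact: cintble_cst0.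
case Pi: (P i); under eq_fun do rewrite big_cons Pi; last exact: ih.
exact: cintbleD.
Qed.

Lemma cint_cst0 : cint (fun _ => 0) = 0.
Proof.
by apply: complexP; rewrite /= Rintegral_cst// ?mul0r// fin_numE.
Qed.

Lemma cint_sum (I : Type) (s : seq I) (P : pred I) (F : I -> T -> R[i]) :
  (forall i, cintble (F i)) ->
  cint (fun x => \sum_(i <- s | P i) F i x) = \sum_(i <- s | P i) cint (F i).
Proof.
move=> jF; elim: s => [|i s ih].
  by under eq_fun do [rewrite big_nil]; rewrite big_nil cint_cst0.
rewrite big_cons; case Pi: (P i); under eq_fun do rewrite big_cons Pi; last exact: ih.
by rewrite cintD ?ih//; exact: cintble_sum.
Qed.

Lemma cint_real h : cint (fun x => (h x)%:C%C) = (\int[mu]_x h x)%:C%C.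
Proof. by apply: complexP => //=; rewrite Rintegral_cst// mul0r. Qed.

Lemma cint_conj f : cintble f -> cint (fun x => ((f x)^*)%C) = ((cint f)^*)%C.
Proof.
move=> jf; apply: complexP => /=.
  by apply: eq_Rintegral => x _; case: (f x).
rewrite -mulN1r -RintegralZl//; last exact: cintble_Im.
by apply: eq_Rintegral => x _; case: (f x) => ? ? /=; rewrite mulN1r.
Qed.

(** Multiplication by the conjugate phase of the integral turns the integral into its modulus, and
    the real part of the rotated integrand is at most the modulus of f. *)
Lemma normc_cint f : cintble f -> normc (cint f) <= \int[mu]_x normc (f x).
Proof.
move=> jf; set c := cint f.
have [/eqP c0|c0] := boolP (c == 0).
  by rewrite c0 Normc.normc0; apply: Rintegral_ge0 => x _; exact: normc_ge0.
pose e : R[i] := ((phase c)^*)%C.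
have e1 : normc e <= 1 by rewrite normc_conj phase_le1.
have ec : e * c = (normc c)%:C%C by exact: conj_phase_mul.
rewrite -lecR -ec -cintZ// lecE /= ; apply/andP; split.
  by have := congr1 (@complex.Im R) ec; rewrite -cintZ//= => ->.
apply: le_Rintegral => //; first exact/cintble_Re/cintbleZ.
  exact: jf.2.
move=> x _; rewrite (le_trans (ler_norm _))// (le_trans (cRe_le_normc _))//.
by rewrite Normc.normcM ler_piMl ?normc_ge0.
Qed.

Lemma eq_ae_cint f (g : T -> R[i]) : cmeasurable f -> cmeasurable g ->
  {ae mu, forall x, f x = g x} -> cint f = cint g.
Proof.
move=> [fr fi] [gr gi] fg.
by apply: complexP; rewrite /= /Rintegral; congr fine; apply: ae_eq_integral => //;
  try (exact/measurable_EFinP); apply: filterS fg => x -> _.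
Qed.

Lemma rint_cvg0 (F : nat -> T -> R) g :
  (forall k, measurable_fun setT (F k)) -> rintble g ->
  (forall k x, `|F k x| <= g x) ->
  (forall x, F ^~ x @ \oo --> 0) ->
  (fun k => \int[mu]_x F k x) @ \oo --> 0.
Proof.
move=> mF ig Fg F0.
have [|||||_ _] := @dominated_convergence _ _ _ mu _ measurableT
    (fun k => EFin \o F k) (cst 0%E) (EFin \o g).
- by move=> k; exact/measurable_EFinP.
- exact: measurable_cst.
- by apply/aeW => x _; apply: cvg_EFin; [exact: nearW|exact: F0].
- exact: ig.
- by apply/aeW => x k _; rewrite /= lee_fin.
- by rewrite integral0 => /fine_cvgP[_].
Qed.

End complex_integral.

Section complex_fubini.
Context d1 d2 (T1 : measurableType d1) (T2 : measurableType d2) (R : realType).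
Variables (m1 : {sigma_finite_measure set T1 -> \bar R})
  (m2 : {sigma_finite_measure set T2 -> \bar R}).

(** An integrable extended-real function is finite almost everywhere, so [fine] changes it only on a
    null set. This converts the extended-real Fubini theorem into one for real inner integrals. *)
Lemma rintble_fine d (T : measurableType d) (mu : {measure set T -> \bar R})
    (F : T -> \bar R) : mu.-integrable setT F ->
  rintble mu (fun x => fine (F x)) /\ (\int[mu]_x (fine (F x))%:E = \int[mu]_x F x)%E.
Proof.
move=> iF; have mF := measurable_int _ iF.
have mfF : measurable_fun setT (fun x => (fine (F x))%:E).
  by apply/measurable_EFinP; exact: measurableT_comp.
have FF : {ae mu, forall x, setT x -> (fine (F x))%:E = F x}.
  by apply: filterS (integrable_ae measurableT iF) => x /[apply] Fx; rewrite fineK.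
split; last exact: ae_eq_integral.
apply: (le_integrable measurableT mfF _ iF) => x _.
by case: (F x) => [r| |] //=; rewrite ?normr0 ?leey.
Qed.

Lemma rintble_prod (f : T1 * T2 -> R) : measurable_fun setT f ->
  (\int[m1]_x \int[m2]_y `|f (x, y)|%:E < +oo)%E -> rintble (m1 \x m2)%E f.
Proof.
move=> mf foo; apply/(integrable12ltyP m1 m2) => //; exact/measurable_EFinP.
Qed.

Lemma rfubini1 (f : T1 * T2 -> R) : rintble (m1 \x m2)%E f ->
  rintble m1 (fun x => \int[m2]_y f (x, y)) /\
  \int[m1]_x \int[m2]_y f (x, y) = \int[(m1 \x m2)%E]_z f z.
Proof.
move=> jf; have [jF eF] := rintble_fine (integrable_fubini_F jf).
by split => //; congr fine; exact: etrans eF (integral12_prod_meas1 jf).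
Qed.

Lemma rfubini2 (f : T1 * T2 -> R) : rintble (m1 \x m2)%E f ->
  rintble m2 (fun y => \int[m1]_x f (x, y)) /\
  \int[m2]_y \int[m1]_x f (x, y) = \int[(m1 \x m2)%E]_z f z.
Proof.
move=> jf; have mf := measurable_int _ jf.
have jf' : (m2 \x m1)%E.-integrable setT (fun z => (f (z.2, z.1))%:E).
  apply/(integrable12ltyP m2 m1); last exact: (iffLR (integrable21ltyP m1 m2 mf)).
  by apply: (measurableT_comp mf); exact: measurable_fun_pair.
have [jF eF] := rintble_fine (integrable_fubini_F jf').
by split => //; congr fine; exact: etrans eF (integral21_prod_meas1 jf).
Qed.

Lemma cfubini1 (f : T1 * T2 -> R[i]) : cintble (m1 \x m2)%E f ->
  cint m1 (fun x => cint m2 (fun y => f (x, y))) = cint (m1 \x m2)%E f.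
Proof.
move=> jf; have [_ eR] := rfubini1 (cintble_Re jf).
by have [_ eI] := rfubini1 (cintble_Im jf); apply: complexP.
Qed.

Lemma cfubini2 (f : T1 * T2 -> R[i]) : cintble (m1 \x m2)%E f ->
  cint m2 (fun y => cint m1 (fun x => f (x, y))) = cint (m1 \x m2)%E f.
Proof.
move=> jf; have [_ eR] := rfubini2 (cintble_Re jf).
by have [_ eI] := rfubini2 (cintble_Im jf); apply: complexP.
Qed.

Lemma cintble_fubini1 (f : T1 * T2 -> R[i]) : cintble (m1 \x m2)%E f ->
  cintble m1 (fun x => cint m2 (fun y => f (x, y))).
Proof.
move=> jf; have [iR _] := rfubini1 (cintble_Re jf).
have [iI _] := rfubini1 (cintble_Im jf).
apply: (@cintble_le _ _ _ _ _ (fun x => `|\int[m2]_y cRe (f (x, y))| + `|\int[m2]_y cIm (f (x, y))|)).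
- by split; [exact: (rintble_measurable iR)|exact: (rintble_measurable iI)].
- by apply: rintbleD; [have := integrable_norm iR|have := integrable_norm iI].
- move=> x; rewrite /cint Defs.normcE /= -[leRHS]ger0_norm ?addr_ge0// -sqrtr_sqr.
  rewrite ler_sqrt ?sqr_ge0// sqrrD !real_normK ?num_real//.
  by rewrite -addrA addrCA -[leLHS]add0r lerD2r mulrn_wge0// mulr_ge0.
Qed.

Lemma cintble_fubini2 (f : T1 * T2 -> R[i]) : cintble (m1 \x m2)%E f ->
  cintble m2 (fun y => cint m1 (fun x => f (x, y))).
Proof.
move=> jf; have [iR _] := rfubini2 (cintble_Re jf).
have [iI _] := rfubini2 (cintble_Im jf).
apply: (@cintble_le _ _ _ _ _ (fun y => `|\int[m1]_x cRe (f (x, y))| + `|\int[m1]_x cIm (f (x, y))|)).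
- by split; [exact: (rintble_measurable iR)|exact: (rintble_measurable iI)].
- by apply: rintbleD; [have := integrable_norm iR|have := integrable_norm iI].
- move=> x; rewrite /cint Defs.normcE /= -[leRHS]ger0_norm ?addr_ge0// -sqrtr_sqr.
  rewrite ler_sqrt ?sqr_ge0// sqrrD !real_normK ?num_real//.
  by rewrite -addrA addrCA -[leLHS]add0r lerD2r mulrn_wge0// mulr_ge0.
Qed.

End complex_fubini.

Section complex_pushforward.
Context d1 d2 (T1 : measurableType d1) (T2 : measurableType d2) (R : realType).
Variables (m1 : {measure set T1 -> \bar R}) (m2 : {measure set T2 -> \bar R}).
Variables (h : T1 -> T2) (mh : measurable_fun setT h).
Hypothesis pushE : forall A, measurable A -> m1 (h @^-1` A) = m2 A.

Let h_mixin := isMeasurableFun.Build _ _ _ _ _ mh.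
Let h_pack : {mfun T1 >-> T2} := HB.pack h h_mixin.

Lemma ge0_integral_push (f : T2 -> \bar R) : measurable_fun setT f ->
  (forall x, 0 <= f x)%E -> (\int[m2]_y f y = \int[m1]_x f (h x))%E.
Proof.
move=> mf f0.
have := ge0_integral_pushforward mh m1 measurableT mf (fun y _ => f0 y).
rewrite preimage_setT => <-.
by apply: (@eq_measure_integral _ _ _ _ (pushforward m1 h_pack)) => A mA _; rewrite -pushE.
Qed.

Lemma rintble_push (f : T2 -> R) : measurable_fun setT f ->
  rintble m1 (fun x => f (h x)) <-> rintble m2 f.
Proof.
move=> mf; have mfh : measurable_fun setT (f \o h) by exact: measurableT_comp.
split=> /integrableP[_ foo]; apply/integrableP; split; try exact/measurable_EFinP.
- rewrite (ge0_integral_push (f := fun y => `|(f y)%:E|%E))//.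
  by apply: measurableT_comp => //; exact/measurable_EFinP.
- rewrite -(ge0_integral_push (f := fun y => `|(f y)%:E|%E))//.
  by apply: measurableT_comp => //; exact/measurable_EFinP.
Qed.

Lemma rint_push (f : T2 -> R) : measurable_fun setT f ->
  \int[m2]_y f y = \int[m1]_x f (h x).
Proof.
move=> mf; have mEf : measurable_fun setT (EFin \o f) by exact/measurable_EFinP.
have e1 := @ge0_integral_push ((EFin \o f)^\+)%E (measurable_funepos mEf)
  (funepos_ge0 _).
have e2 := @ge0_integral_push ((EFin \o f)^\-)%E (measurable_funeneg mEf)
  (funeneg_ge0 _).
rewrite /Rintegral [in LHS]integralE; congr fine.
have := integralE m1 setT ((EFin \o f) \o h); rewrite funepos_comp funeneg_comp => ->.
by move: e1 e2; rewrite /comp => -> ->.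
Qed.

Lemma cint_push (f : T2 -> R[i]) : cmeasurable f ->
  cint m2 f = cint m1 (fun x => f (h x)).
Proof. by move=> [fr fi]; apply: complexP; exact: rint_push. Qed.

Lemma cintble_push (f : T2 -> R[i]) : cmeasurable f ->
  cintble m1 (fun x => f (h x)) <-> cintble m2 f.
Proof.
move=> mf; have e := @rintble_push (fun y => normc (f y)) (cmeasurable_normc mf).
split=> -[_] jf; split; [exact: mf|exact/e|exact: cmeasurable_comp|exact/e].
Qed.

End complex_pushforward.

Arguments ge0_integral_push {d1 d2 T1 T2 R m1 m2 h} mh pushE f.
Arguments rintble_push {d1 d2 T1 T2 R m1 m2 h} mh pushE f.
Arguments rint_push {d1 d2 T1 T2 R m1 m2 h} mh pushE f.
Arguments cint_push {d1 d2 T1 T2 R m1 m2 h} mh pushE f.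
Arguments cintble_push {d1 d2 T1 T2 R m1 m2 h} mh pushE f.

(** * Riesz-Thorin interpolation for matrices *)

Section growth.
Context {R : realType}.

(** If S > B, Bernoulli's inequality for the (k + 1)-st root of S / B makes (S / B)^N at least a
    positive multiple of (N + 1)^(k + 1), which outgrows (N + 1)^k. This closes the tensor power
    trick: a bound with polynomial loss for all powers is a bound without loss. *)
Lemma le_of_expr_le_poly (S B : R) k : 0 <= S -> 0 <= B ->
  (forall N, S ^+ N <= N.+1%:R ^+ k * B ^+ N) -> S <= B.
Proof.
move=> S0 B0 SB; rewrite leNgt; apply/negP => BS.
have {S0} S0 : 0 < S by exact: le_lt_trans BS.
have {B0} B0 : 0 < B.
  rewrite lt_neqAle B0 andbT; apply/eqP => B00.
  by have := SB 1%N; rewrite -B00 !expr1 mulr0 leNgt S0.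
pose q := S / B; pose rho := q `^ (k.+1%:R^-1).
have q1 : 1 < q by rewrite ltr_pdivlMr ?mul1r.
have rho1 : 1 < rho.
  have : 1 `^ (k.+1%:R^-1) < rho; last by rewrite powR1.
  by apply: gt0_ltr_powR; rewrite ?nnegrE ?invr_gt0// ltW// (lt_trans _ q1).
have rhoq : rho ^+ k.+1 = q.
  by rewrite -powR_mulrn ?powR_ge0// -powRrM mulVf ?pnatr_eq0// powRr1// ltW// (lt_trans _ q1).
(* The minimum with 1 makes [bern] true at N = 0. *)
pose e := Num.min (rho - 1) 1.
have e0 : 0 < e by rewrite lt_min subr_gt0 rho1 ltr01.
have bern N : e * N.+1%:R <= rho ^+ N.
  elim: N => [|N ih]; first by rewrite mulr1 expr0 ge_min lexx orbT.
  rewrite exprS -[N.+2%:R]natr1 mulrDr mulr1.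
  have r1 : 1 <= rho ^+ N by rewrite exprn_ege1// ltW.
  rewrite -[X in X * rho ^+ N](subrK 1 rho) mulrDl mul1r addrC lerD//.
  rewrite (le_trans _ (ler_wpM2l _ r1)) ?mulr1 ?subr_ge0 ?(ltW rho1)//.
  by rewrite ge_min lexx.
have key N : e ^+ k.+1 * N.+1%:R <= 1.
  have h : (e * N.+1%:R) ^+ k.+1 <= N.+1%:R ^+ k.
    rewrite (@le_trans _ _ ((rho ^+ N) ^+ k.+1))//.
      by rewrite lerXn2r ?nnegrE ?mulr_ge0 ?(ltW e0) ?exprn_ge0 ?(ltW (lt_trans ltr01 rho1)).
    by rewrite exprAC rhoq expr_div_n ler_pdivrMr ?exprn_gt0.
  move: h; rewrite exprMn [N.+1%:R ^+ k.+1]exprS mulrA.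
  by rewrite -[leRHS]mul1r ler_pM2r// exprn_gt0.
have := key (Num.truncn (e ^+ k.+1)^-1).
by apply/negP; rewrite -ltNge mulrC -ltr_pdivrMr ?exprn_gt0// ?mul1r ?div1r truncnS_gt.
Qed.

(** Lagrange's identity: the right side minus the left is half the double sum of the squares of a_i
    b_j - a_j b_i. *)
Lemma cauchy_schwarz_sum (I : finType) (P : pred I) (a b : I -> R) :
  (\sum_(i | P i) a i * b i) ^+ 2 <=
  (\sum_(i | P i) a i ^+ 2) * (\sum_(i | P i) b i ^+ 2).
Proof.
have h : 0 <= \sum_(i | P i) \sum_(j | P j) (a i * b j - a j * b i) ^+ 2.
  by apply: sumr_ge0 => i _; apply: sumr_ge0 => j _; exact: sqr_ge0.
have E : \sum_(i | P i) \sum_(j | P j) (a i * b j - a j * b i) ^+ 2 =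
    2 * ((\sum_(i | P i) a i ^+ 2) * (\sum_(i | P i) b i ^+ 2) -
    (\sum_(i | P i) a i * b i) ^+ 2).
  transitivity (\sum_(i | P i) \sum_(j | P j) ((a i ^+ 2 * b j ^+ 2 +
      b i ^+ 2 * a j ^+ 2) - (a i * b i) * (a j * b j) *+ 2)).
    by apply: eq_bigr => i _; apply: eq_bigr => j _; ring.
  under eq_bigr do rewrite big_split big_split /= -!mulr_sumr sumrN sumrMnl -mulr_sumr.
  rewrite !big_split /= -!mulr_suml sumrN sumrMnl -mulr_suml; ring.
by move: h; rewrite E pmulr_rge0// subr_ge0.
Qed.

End growth.

Section tensor_power.
Context {R : realType}.
Implicit Types (I J : finType) (N : nat).

(** The power I^N as nested pairs, a shape on which tensor powers of vectors and matrices are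
    recursive functions. *)
Fixpoint tpow I N : finType :=
  if N is N'.+1 then (I * tpow I N')%type else unit.

Fixpoint tprod {A : comPzRingType} I (v : I -> A) N : tpow I N -> A :=
  if N is N'.+1 then fun f => v f.1 * tprod v f.2 else fun=> 1.

Fixpoint tmat I J (m : I -> J -> R[i]) N : tpow I N -> tpow J N -> R[i] :=
  if N is N'.+1 then fun f g => m f.1 g.1 * tmat m f.2 g.2 else fun _ _ => 1.

(** The multiplicities of a multi-index. By [tprod_count] a product vector depends on the
    multi-index only through them, and they take at most (N + 1)^|I| values, a polynomial number for
    fixed I. *)
Fixpoint tcount I N : tpow I N -> I -> nat :=
  if N is N'.+1 then fun f i => ((i == f.1) + tcount f.2 i)%N else fun _ _ => 0%N.

Lemma sum_tprod (A : comPzRingType) I (v : I -> A) N :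
  \sum_(f : tpow I N) tprod v f = (\sum_i v i) ^+ N.
Proof.
elim: N => [|N ih] /=; first by rewrite (big_pred1 tt) => [|[]].
rewrite -(pair_bigA _ (fun i f => v i * tprod v f)) /= exprS -ih mulr_suml.
by apply: eq_bigr => i _; rewrite mulr_sumr.
Qed.

Lemma tprodM (A : comPzRingType) I (v w : I -> A) N (f : tpow I N) :
  tprod (fun i => v i * w i) f = tprod v f * tprod w f.
Proof. by elim: N f => [|N ih] f /=; rewrite ?mul1r// ih mulrACA. Qed.

Lemma sum_tmat I J (m : I -> J -> R[i]) N :
  \sum_(f : tpow I N) \sum_(g : tpow J N) tmat m f g = (\sum_i \sum_j m i j) ^+ N.
Proof.
elim: N => [|N ih] /=.
  by rewrite (big_pred1 tt) => [|[]]//; rewrite (big_pred1 tt) => [|[]].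
rewrite -(pair_bigA _ (fun i f => \sum_g m i g.1 * tmat m f g.2)) /= exprS -ih mulr_suml.
apply: eq_bigr => i _; rewrite mulr_sumr; apply: eq_bigr => f _.
rewrite -(pair_bigA _ (fun j g => m i j * tmat m f g)) /= mulr_suml.
by apply: eq_bigr => j _; rewrite mulr_sumr.
Qed.

Lemma tmatM I J (m : I -> J -> R[i]) (v : I -> R[i]) (w : J -> R[i]) N
    (f : tpow I N) (g : tpow J N) :
  tmat (fun i j => m i j * v i * w j) f g = tmat m f g * tprod v f * tprod w g.
Proof. by elim: N f g => [|N ih] f g /=; rewrite ?mul1r// ih; ring. Qed.

Lemma tprod_count (A : comPzRingType) I (v : I -> A) N (f : tpow I N) :
  tprod v f = \prod_i v i ^+ tcount f i.
Proof.
elim: N f => [|N ih] f /=; first by rewrite big1.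
rewrite ih; under [RHS]eq_bigr do rewrite exprD.
rewrite big_split /=; congr (_ * _).
rewrite (bigD1 f.1)//= eqxx expr1 big1 ?mulr1// => i /negbTE ->.
by rewrite expr0.
Qed.

Lemma tcount_le I N (f : tpow I N) i : (tcount f i < N.+1)%N.
Proof.
elim: N f => //= N ih f; rewrite ltnS -add1n leq_add//; last exact: ih.
by case: (_ == _).
Qed.

Lemma tprod_ge0 I (v : I -> R) N (f : tpow I N) : (forall i, 0 <= v i) ->
  0 <= tprod v f.
Proof. by move=> v0; elim: N f => //= N ih f; rewrite mulr_ge0. Qed.

Lemma tprod_powR I (v : I -> R) t N (f : tpow I N) : (forall i, 0 <= v i) ->
  tprod (fun i => v i `^ t) f = tprod v f `^ t.
Proof.
move=> v0; elim: N f => [|N ih] f /=; first by rewrite powR1.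
by rewrite ih powRM ?tprod_ge0.
Qed.

Lemma tprod_real I (v : I -> R) N (f : tpow I N) :
  tprod (fun i => (v i)%:C%C) f = (tprod v f)%:C%C.
Proof. by elim: N f => [|N ih] f //=; rewrite ih rmorphM. Qed.

Definition contraction I J (m : I -> J -> R[i]) :=
  forall x : I -> R[i],
    \sum_j normc (\sum_i m i j * x i) ^+ 2 <= \sum_i normc (x i) ^+ 2.

(** The tensor product is the composition of m' acting on the second factor with m acting on the
    first, and each of these is a direct sum of copies of a contraction. *)
Lemma contraction_tensor I J I' J' (m : I -> J -> R[i]) (m' : I' -> J' -> R[i]) :
  contraction m -> contraction m' ->
  contraction (fun (p : I * I') (q : J * J') => m p.1 q.1 * m' p.2 q.2).
Proof.
move=> cm cm' x.
pose y i j' := \sum_i' m' i' j' * x (i, i').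
rewrite -(pair_bigA _ (fun j j' =>
  normc (\sum_p m p.1 j * m' p.2 j' * x p) ^+ 2)) exchange_big /=.
apply: (@le_trans _ _ (\sum_j' \sum_i normc (y i j') ^+ 2)).
  apply: ler_sum => j' _; apply: le_trans (cm (y^~ j')).
  apply: ler_sum => j _; rewrite le_eqVlt; apply/orP; left; apply/eqP.
  congr (normc _ ^+ 2).
  rewrite (eq_bigr (fun p => m p.1 j * m' p.2 j' * x (p.1, p.2))); last by case.
  rewrite -(pair_bigA _ (fun i i' => m i j * m' i' j' * x (i, i'))) /=.
  by apply: eq_bigr => i _; rewrite mulr_sumr; apply: eq_bigr => i' _; rewrite mulrA.
rewrite exchange_big /=.
rewrite [leRHS](eq_bigr (fun p => normc (x (p.1, p.2)) ^+ 2)); last by case.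
rewrite -(pair_bigA _ (fun i i' => normc (x (i, i')) ^+ 2)) /=.
by apply: ler_sum => i _; exact: cm'.
Qed.

Lemma contraction_tmat I J (m : I -> J -> R[i]) N : contraction m ->
  contraction (@tmat I J m N).
Proof.
move=> cm; elim: N => [|N ih] /=; last exact: contraction_tensor.
move=> x; rewrite (big_pred1 tt) => [|[]]//; rewrite (big_pred1 tt) => [|[]]//.
by rewrite (big_pred1 tt) => [|[]]//; rewrite mul1r.
Qed.

Lemma tmat_le I J (m : I -> J -> R[i]) (M : R) (om : I -> R) (om' : J -> R) N
    (f : tpow I N) (g : tpow J N) : 0 <= M ->
  (forall i, 0 <= om i) -> (forall j, 0 <= om' j) ->
  (forall i j, normc (m i j) <= M * om i * om' j) ->
  normc (tmat m f g) <= M ^+ N * tprod om f * tprod om' g.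
Proof.
move=> M0 om0 om'0 mM; elim: N f g => [|N ih] f g /=.
  by rewrite expr1n expr0n addr0 sqrtr1 expr0 !mul1r.
rewrite Normc.normcM (le_trans (ler_pM _ _ (mM _ _) (ih _ _))) ?normc_ge0//.
by rewrite exprS le_eqVlt; apply/orP; left; apply/eqP; ring.
Qed.

End tensor_power.

Section riesz.
Context {R : realType}.

(** The vectors are the indicators of P and Q over atoms of mass om^2 and om'^2, in orthonormal
    coordinates. Summing the entries gives S <= M W W'; Cauchy-Schwarz and the contraction give S <=
    (W W')^(1/2); and S = S^(2 - 2 t) S^(2 t - 1) combines the two, the exponent of W W' being (1 -
    t) + (2 t - 1) = t. *)
Lemma riesz_one_level (I J : finType) (m : I -> J -> R[i]) (M t : R)
    (om : I -> R) (om' : J -> R) (P : pred I) (Q : pred J) :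
  contraction m -> 0 <= M -> (forall i, 0 <= om i) -> (forall j, 0 <= om' j) ->
  (forall i j, normc (m i j) <= M * om i * om' j) -> 2^-1 <= t <= 1 ->
  normc (\sum_(i | P i) \sum_(j | Q j) m i j * (om i)%:C%C * (om' j)%:C%C) <=
  M `^ (2 * t - 1) * ((\sum_(i | P i) om i ^+ 2) * (\sum_(j | Q j) om' j ^+ 2)) `^ t.
Proof.
move=> cm M0 om0 om'0 mM /andP[t12 t1].
set S := normc _; set W := \sum_(i | P i) om i ^+ 2.
set W' := \sum_(j | Q j) om' j ^+ 2.
have W0 : 0 <= W by apply: sumr_ge0 => i _; exact: sqr_ge0.
have W'0 : 0 <= W' by apply: sumr_ge0 => i _; exact: sqr_ge0.
have S0 : 0 <= S by exact: normc_ge0.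
have S2 : S <= M * (W * W').
  apply: (le_trans (normc_sum _ _ _)).
  rewrite mulrCA mulr_suml; apply: ler_sum => i _.
  apply: (le_trans (normc_sum _ _ _)).
  rewrite !mulr_sumr; apply: ler_sum => j _.
  rewrite !Normc.normcM !normc_real !ger0_norm//.
  rewrite [leRHS](_ : _ = (M * om i * om' j) * om i * om' j); last by ring.
  by rewrite ler_wpM2r// ler_wpM2r.
have S1 : S <= (W * W') `^ 2^-1.
  rewrite powR12_sqrt ?mulr_ge0// -[leLHS]ger0_norm// -sqrtr_sqr ler_wsqrtr//.
  pose x i : R[i] := if P i then (om i)%:C%C else 0.
  pose y j := normc (\sum_i m i j * x i).
  have Wx : \sum_i normc (x i) ^+ 2 = W.
    rewrite /W [RHS]big_mkcond /=; apply: eq_bigr => i _; rewrite /x.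
    by case: ifP => _; rewrite ?normc_real ?Normc.normc0 ?real_normK ?num_real ?expr0n.
  have Sy : S <= \sum_(j | Q j) om' j * y j.
    rewrite /S exchange_big /=; apply: (le_trans (normc_sum _ _ _)).
    apply: ler_sum => j _; rewrite -mulr_suml Normc.normcM normc_real ger0_norm//.
    rewrite mulrC le_eqVlt; apply/orP; left; apply/eqP; congr (_ * normc _).
    rewrite [LHS]big_mkcond /=; apply: eq_bigr => i _; rewrite /x.
    by case: ifP; rewrite ?mulr0.
  apply: (@le_trans _ _ ((\sum_(j | Q j) om' j * y j) ^+ 2)).
    by rewrite lerXn2r ?nnegrE// (le_trans S0).
  apply: (le_trans (cauchy_schwarz_sum _ _ _)); rewrite mulrC ler_wpM2r//.
  rewrite -Wx; apply: le_trans (cm x).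
  rewrite [leRHS](bigID Q) /= lerDl; apply: sumr_ge0 => j _; exact: sqr_ge0.
have [->|Sn0] := eqVneq S 0; first by rewrite mulr_ge0 ?powR_ge0.
have {S0} S0 : 0 < S by rewrite lt_neqAle eq_sym Sn0.
have WW0 : W * W' != 0.
  by apply: contraTneq S0 => WW; rewrite -leNgt (le_trans S2)// WW mulr0.
rewrite -[leLHS]powRr1 ?(ltW S0)//.
rewrite [X in S `^ X](_ : 1 = (2 - 2 * t) + (2 * t - 1)); last by ring.
rewrite powRD ?Sn0 ?implybT//.
have -> : (W * W') `^ t = ((W * W') `^ 2^-1) `^ (2 - 2 * t) * (W * W') `^ (2 * t - 1).
  by rewrite -powRrM -powRD ?WW0 ?implybT//; congr (_ `^ _); field.
rewrite mulrCA -powRM ?mulr_ge0//.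
apply: ler_pM; rewrite ?powR_ge0//; apply: ge0_ler_powR;
  rewrite ?nnegrE ?mulr_ge0 ?powR_ge0 ?(ltW S0)//; lra.
Qed.

(* Tensor power trick: the N-th tensor power of the matrix satisfies the same
   two endpoint bounds, and on a product vector it only sees polynomially many
   (in N) distinct moduli, each of which is handled by [riesz_one_level]. *)
Theorem riesz_interpolation (I J : finType) (m : I -> J -> R[i]) (M t : R)
    (om v : I -> R) (om' v' : J -> R) :
  contraction m -> 0 <= M -> (forall i, 0 <= om i) -> (forall j, 0 <= om' j) ->
  (forall i j, normc (m i j) <= M * om i * om' j) -> 2^-1 <= t <= 1 ->
  (forall i, 0 <= v i) -> (forall j, 0 <= v' j) ->
  normc (\sum_i \sum_j m i j * (om i * v i)%:C%C * (om' j * v' j)%:C%C) <=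
  M `^ (2 * t - 1) * (\sum_i om i ^+ 2 * v i `^ t^-1) `^ t *
    (\sum_j om' j ^+ 2 * v' j `^ t^-1) `^ t.
Proof.
move=> cm M0 om0 om'0 mM /[dup] t01 /andP[t12 t1] v0 v'0.
have t0 : 0 < t by lra.
set S := \sum_i \sum_j _; set X := \sum_i om i ^+ 2 * _.
set Y := \sum_j om' j ^+ 2 * _.
have X0 : 0 <= X by apply: sumr_ge0 => i _; rewrite mulr_ge0 ?sqr_ge0 ?powR_ge0.
have Y0 : 0 <= Y by apply: sumr_ge0 => i _; rewrite mulr_ge0 ?sqr_ge0 ?powR_ge0.
apply: (@le_of_expr_le_poly _ _ _ (#|I| + #|J|)); rewrite ?normc_ge0 ?mulr_ge0 ?powR_ge0//.
move=> N.
have normX : normc S ^+ N = normc (S ^+ N).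
  by elim: (N) => [|k ih]; rewrite ?expr0 ?Normc.normc1// !exprS Normc.normcM ih.
(* The level of a multi-index is its family of multiplicities. On a level the tensor powers of v and
   v' are constant, so that they leave the sum and only the weights remain. *)
pose lev (K : finType) (f : tpow K N) : {ffun K -> 'I_N.+1} :=
  [ffun i => Ordinal (tcount_le f i)].
pose V (K : finType) (w : K -> R) (c : {ffun K -> 'I_N.+1}) := \prod_i w i ^+ c i.
have levV (K : finType) (w : K -> R) (f : tpow K N) : tprod w f = V K w (lev K f).
  by rewrite tprod_count; apply: eq_bigr => i _; rewrite ffunE.
have V0 (K : finType) (w : K -> R) c : (forall i, 0 <= w i) -> 0 <= V K w c.
  by move=> w0; apply: prodr_ge0 => i _; rewrite exprn_ge0.
(* The value on a level, raised to the power 1/t, multiplies the mass of that level. The result is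
   one part of a sum of nonnegative terms over all multi-indices, and the whole sum is the N-th
   power of the sum over K. *)
have levX (K : finType) (o w : K -> R) c : (forall i, 0 <= o i) -> (forall i, 0 <= w i) ->
    V K w c * (\sum_(f | lev K f == c) tprod o f ^+ 2) `^ t <=
    ((\sum_i o i ^+ 2 * w i `^ t^-1) `^ t) ^+ N.
  move=> o0 w0.
  have -> : V K w c = (V K w c `^ t^-1) `^ t.
    by rewrite -powRrM mulVf ?gt_eqF// powRr1// V0.
  have o20 (f : tpow K N) : 0 <= tprod o f ^+ 2 by exact: sqr_ge0.
  rewrite -powRM ?powR_ge0 ?sumr_ge0//.
  rewrite -powR_mulrn ?powR_ge0// powRAC powR_mulrn; last first.
    by apply: sumr_ge0 => i _; rewrite mulr_ge0 ?sqr_ge0 ?powR_ge0.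
  apply: ge0_ler_powR; rewrite ?(ltW t0) ?nnegrE ?mulr_ge0 ?powR_ge0 ?sumr_ge0//.
    by rewrite exprn_ge0// sumr_ge0// => i _; rewrite mulr_ge0 ?sqr_ge0 ?powR_ge0.
  rewrite -sum_tprod [leRHS](bigID (fun f => lev K f == c)) /= mulr_sumr.
  rewrite -[leLHS]addr0 lerD//; last first.
    by apply: sumr_ge0 => f _; apply: tprod_ge0 => i; rewrite mulr_ge0 ?sqr_ge0 ?powR_ge0.
  apply: ler_sum => f /eqP fc.
  rewrite tprodM tprod_powR// (levV _ w) fc mulrC.
  rewrite (_ : tprod (fun i => o i ^+ 2) f = tprod o f ^+ 2)//.
  by rewrite expr2 -tprodM.
rewrite normX -sum_tmat.
have -> : \sum_(f : tpow I N) \sum_(g : tpow J N) tmat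
     (fun i j => m i j * (om i * v i)%:C%C * (om' j * v' j)%:C%C) f g =
  \sum_(c : {ffun I -> 'I_N.+1}) \sum_(c' : {ffun J -> 'I_N.+1})
    (V I v c * V J v' c')%:C%C *
    \sum_(f | lev I f == c) \sum_(g | lev J g == c')
      tmat m f g * (tprod om f)%:C%C * (tprod om' g)%:C%C.
  rewrite (partition_big (lev I) predT) //=; apply: eq_bigr => c _.
  under [RHS]eq_bigr do rewrite mulr_sumr; rewrite [RHS]exchange_big /=.
  apply: eq_bigr => f /eqP fc.
  rewrite (partition_big (lev J) predT) //=; apply: eq_bigr => c' _.
  rewrite mulr_sumr; apply: eq_bigr => g /eqP gc.
  rewrite (tmatM m (fun i => (om i * v i)%:C%C) (fun j => (om' j * v' j)%:C%C)).
  by rewrite !tprod_real !tprodM !levV fc gc !rmorphM; ring.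
apply: (le_trans (normc_sum _ _ _)).
pose B := M `^ (2 * t - 1) * X `^ t * Y `^ t.
(* Each pair of levels contributes at most B^N, and there are (N + 1)^(|I| + |J|) pairs: this is the
   polynomial loss. *)
apply: (@le_trans _ _ (\sum_(c : {ffun I -> 'I_N.+1})
    \sum_(c' : {ffun J -> 'I_N.+1}) B ^+ N)); last first.
  rewrite exprD -!natrX -natrM mulr_natl.
  by rewrite !sumr_const !card_ffun !card_ord -mulrnA mulnC.
apply: ler_sum => c _; apply: (le_trans (normc_sum _ _ _)); apply: ler_sum => c' _.
rewrite Normc.normcM normc_real ger0_norm ?mulr_ge0 ?V0//.
have := riesz_one_level (fun f => lev I f == c) (fun g => lev J g == c')
  (contraction_tmat (N := N) cm) (exprn_ge0 N M0) (fun f => tprod_ge0 f om0)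
  (fun f => tprod_ge0 f om'0) (fun f g => tmat_le f g M0 om0 om'0 mM) t01.
move=> /(ler_wpM2l (mulr_ge0 (V0 I v c v0) (V0 J v' c' v'0))) /le_trans; apply.
rewrite powRM ?sumr_ge0// => [|i _|i _]; [|exact: sqr_ge0..].
have -> : (M ^+ N) `^ (2 * t - 1) = (M `^ (2 * t - 1)) ^+ N.
  by rewrite -powR_mulrn// powRAC powR_mulrn ?powR_ge0.
rewrite /B !exprMn mulrCA -mulrA ler_wpM2l ?exprn_ge0 ?powR_ge0//.
rewrite mulrACA; apply: ler_pM; rewrite ?mulr_ge0 ?V0 ?powR_ge0//; exact: levX.
Qed.

End riesz.

(** * Lebesgue measure on R^n *)

Section lebesgue_affine.
Context {R : realType}.
Local Notation leb := (@lebesgue_measure R).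

(** The maps x |-> v + e x with such an e cover translations and point reflections at once, which
    are the changes of variables needed for convolutions. *)
Definition is_sign (e : R) := e = 1 \/ e = -1.

Lemma measurable_affine (v e : R) :
  measurable_fun setT (fun x : measurableTypeR R => v + e * x : measurableTypeR R).
Proof. by apply: measurable_funD => //; apply: measurable_funM. Qed.

(** The image measure agrees with Lebesgue measure on half-open intervals, hence everywhere. A
    reflection only moves the closed end of the interval. *)
Lemma lebesgue_affine (v e : R) (A : set (measurableTypeR R)) : is_sign e ->
  measurable A -> leb ((fun x : R => v + e * x) @^-1` A) = leb A.
Proof.
move=> he mA; pose h (x : measurableTypeR R) : measurableTypeR R := v + e * x.
have mh : measurable_fun setT h by exact: measurable_affine.
pose h_mixin := isMeasurableFun.Build _ _ _ _ _ mh.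
pose h_pack : {mfun measurableTypeR R >-> measurableTypeR R} := HB.pack h h_mixin.
symmetry; apply: (@lebesgue_measure_unique R (pushforward lebesgue_measure h_pack)) => //.
move=> X /ocitvP[->|[[a b] /= ab ->]]; first by rewrite !measure0.
rewrite /pushforward /=.
case: he => e1.
- rewrite (_ : _ @^-1` _ = `](a - v), (b - v)]%classic); last first.
    apply/seteqP; split=> x; rewrite /= /h e1 mul1r !in_itv /=;
    by rewrite lerBrDl ltrBlDl.
  by rewrite !lebesgue_measure_itv /= !lte_fin ltrD2r -!EFinB; congr (if _ then _%:E else _); ring.
- rewrite (_ : _ @^-1` _ = `[(v - b), (v - a)[%classic); last first.
    apply/seteqP; split=> x; rewrite /= /h e1 mulN1r !in_itv /= => /andP[? ?];
    apply/andP; split; lra.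
  rewrite !lebesgue_measure_itv /= !lte_fin ltrD2l ltrN2 -!EFinB; congr (if _ then _%:E else _); ring.
Qed.

End lebesgue_affine.

Section lebesgue_Rn_theory.
Context {R : realType}.
Local Notation leb := (@lebesgue_measure R).
Local Notation mu n := (@lebesgue_Rn R n).

Lemma ge0_integral_rV_cons n (f : 'rV[R]_n.+1 -> \bar R) : measurable_fun setT f ->
  (forall x, 0 <= f x)%E ->
  (\int[mu n.+1]_x f x = \int[leb]_t \int[mu n]_x f (rV_cons (t, x)))%E.
Proof.
move=> mf f0.
rewrite (ge0_integral_push (m1 := (leb \x mu n)%E) (@measurable_rV_cons R n))//.
by rewrite fubini_tonelli1//; exact: (measurableT_comp mf (@measurable_rV_cons R n)).
Qed.

Lemma rV_cons_head n (t : R) (x : 'rV[R]_n) (k : 'I_1) :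
  rV_cons (t, x) ord0 (lshift n k) = t.
Proof. by rewrite /rV_cons (row_mxEl (const_mx t : 'rV_1)) mxE. Qed.

Lemma rV_cons_tail n (t : R) (x : 'rV[R]_n) (k : 'I_n) :
  rV_cons (t, x) ord0 (rshift 1 k) = x ord0 k.
Proof. by rewrite /rV_cons (row_mxEr (const_mx t : 'rV_1)). Qed.

Definition affine_rV n (v : 'rV[R]_n) (e : R) : 'rV[R]_n -> 'rV[R]_n := fun x => v + e *: x.

Lemma measurable_affine_rV n (v : 'rV[R]_n) e : measurable_fun setT (affine_rV v e).
Proof.
apply/measurable_fun_rVP => i.
rewrite (_ : (fun x => _) = (fun x : 'rV[R]_n => v ord0 i + e * x ord0 i)).
  by apply: measurable_funD => //; apply: measurable_funM => //; exact: measurable_rV_coord.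
by apply/funext => x; rewrite !mxE.
Qed.

(** By induction along the iterated product: the head coordinate undergoes an affine map of the
    line, the tail an affine map in one dimension less. *)
Lemma ge0_integral_affine n (v : 'rV[R]_n) e (f : 'rV[R]_n -> \bar R) : is_sign e ->
  measurable_fun setT f -> (forall x, 0 <= f x)%E ->
  (\int[mu n]_x f (affine_rV v e x) = \int[mu n]_x f x)%E.
Proof.
move=> he; elim: n => [|n ih] in v f * => mf f0.
  by apply: eq_integral => x _; rewrite (thinmx0 (affine_rV v e x)) (thinmx0 x).
have mfa : measurable_fun setT (fun x => f (affine_rV v e x)).
  by apply: (measurableT_comp mf); exact: measurable_affine_rV.
rewrite (ge0_integral_rV_cons mfa (fun x => f0 _)) (ge0_integral_rV_cons mf f0).
pose v' : 'rV[R]_n := @rsubmx R 1 1 n v.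
have E t x : affine_rV v e (rV_cons (t, x)) = rV_cons (v ord0 ord0 + e * t, affine_rV v' e x).
  apply/rowP => j; rewrite /affine_rV; case: (@split_ordP 1 n j) => k ->.
  - rewrite mxE [X in _ + X]mxE !rV_cons_head ord1 /=.
    by congr (v _ _ + _); exact/val_inj.
  - by rewrite mxE [X in _ + X]mxE !rV_cons_tail !mxE.
have mF : measurable_fun setT (fun t : measurableTypeR R => (\int[mu n]_x f (rV_cons (t, x)))%E).
  apply: (measurable_fun_fubini_tonelli_F (fun z : measurableTypeR R * 'rV[R]_n => f (rV_cons z))).
    exact: (measurableT_comp mf (@measurable_rV_cons R n)).
  by move=> z; exact: f0.
have F0 (t : measurableTypeR R) : (0 <= \int[mu n]_x f (rV_cons (t, x)))%E.
  by apply: integral_ge0 => x _; exact: f0.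
have e1 := ge0_integral_push (m1 := leb) (measurable_affine (v ord0 ord0) e)
  (fun A mA => lebesgue_affine (v ord0 ord0) he mA)
  (fun t => (\int[mu n]_x f (rV_cons (t, x)))%E) mF F0.
rewrite [RHS]e1.
apply: eq_integral => t _.
under eq_integral do rewrite E.
have -> := ih v' (fun x => f (rV_cons (v ord0 ord0 + e * t, x))) _ (fun x => f0 _) => //.
apply: (measurableT_comp mf); apply: (measurableT_comp (@measurable_rV_cons R n)).
exact: measurable_pair1.
Qed.

Lemma lebesgue_Rn_affine n (v : 'rV[R]_n) e A : is_sign e -> measurable A ->
  mu n (affine_rV v e @^-1` A) = mu n A.
Proof.
move=> he mA.
have mB : measurable (affine_rV v e @^-1` A).
  rewrite -[X in measurable X]setTI; exact: measurable_affine_rV.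
have mI : measurable_fun setT (fun x : 'rV[R]_n => (\1_A x : R)%:E).
  by apply/measurable_EFinP; exact: measurable_indic.
have I0 (x : 'rV[R]_n) : (0 <= (\1_A x : R)%:E)%E by rewrite lee_fin.
have iE B : measurable B -> mu n B = (\int[mu n]_x (\1_B x : R)%:E)%E.
  by move=> mB'; rewrite integral_indic// setIT.
by rewrite (iE _ mA) (iE _ mB) -(ge0_integral_affine v he mI I0).
Qed.

End lebesgue_Rn_theory.

Section complex_product.
Context d1 d2 (T1 : measurableType d1) (T2 : measurableType d2) (R : realType).
Variables (m1 : {sigma_finite_measure set T1 -> \bar R})
  (m2 : {sigma_finite_measure set T2 -> \bar R}).

Lemma cintble_mul (f : T1 -> R[i]) (g : T2 -> R[i]) : cintble m1 f -> cintble m2 g ->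
  cintble (m1 \x m2)%E (fun z => f z.1 * g z.2).
Proof.
move=> [mf jf] [mg jg].
have mfg : cmeasurable (fun z : T1 * T2 => f z.1 * g z.2).
  by apply: cmeasurableM; [apply: (cmeasurable_comp _ mf)|apply: (cmeasurable_comp _ mg)].
split => //; apply: rintble_prod; first exact: cmeasurable_normc.
have E x : (\int[m2]_y `|normc (f (x, y).1 * g (x, y).2)|%:E =
    (normc (f x))%:E * \int[m2]_y (normc (g y))%:E)%E.
  rewrite -ge0_integralZl//; last 3 first.
  - exact: measurable_EFin_normc.
  - by move=> y _; rewrite lee_fin normc_ge0.
  - by rewrite lee_fin normc_ge0.
  by apply: eq_integral => y _; rewrite ger0_norm ?normc_ge0//= Normc.normcM EFinM.
under eq_integral do rewrite E.
rewrite -(EFin_rint jg); under eq_integral do rewrite -EFinM mulrC.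
apply: rintble_ltey; first exact: rintbleZ.
by move=> x; rewrite mulr_ge0 ?normc_ge0//; apply: Rintegral_ge0 => y _; exact: normc_ge0.
Qed.

Lemma cint_mul (f : T1 -> R[i]) (g : T2 -> R[i]) : cintble m1 f -> cintble m2 g ->
  cint (m1 \x m2)%E (fun z => f z.1 * g z.2) = cint m1 f * cint m2 g.
Proof.
move=> jf jg; rewrite -cfubini1; last exact: cintble_mul.
rewrite [RHS]mulrC -cintZ//; congr cint; apply/funext => x /=.
by rewrite cintZ// mulrC.
Qed.

End complex_product.

Section lebesgue_Rn_product.
Context {R : realType}.
Local Notation leb := (@lebesgue_measure R).
Local Notation mu n := (@lebesgue_Rn R n).

Lemma cint_prod n (f : 'I_n -> measurableTypeR R -> R[i]) : (forall i, cintble leb (f i)) ->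
  cintble (mu n) (fun x => \prod_i f i (x ord0 i)) /\
  cint (mu n) (fun x => \prod_i f i (x ord0 i)) = \prod_i cint leb (f i).
Proof.
elim: n => [|n ih] in f * => jf.
  rewrite (_ : (fun x => _) = (fun _ => (1 : R)%:C%C)); last by apply/funext => x; rewrite big_ord0.
  have j1 : rintble (mu 0) (fun _ => 1).
    apply: rintbleP => //; rewrite integral_cst//= mul1e.
    by rewrite /dirac indicE in_setT ltry.
  split; last by rewrite cint_real Rintegral_cst//= /dirac indicE in_setT mul1r big_ord0.
  apply: (cintble_le _ j1); first exact: cmeasurable_cst.
  by move=> x; rewrite normc_real normr1.
have [j e] := ih (fun i => f (lift ord0 i)) (fun i => jf _).
pose g (x : 'rV[R]_n) := \prod_i f (lift ord0 i) (x ord0 i).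
have E z : \prod_i f i (rV_cons z ord0 i) = f ord0 z.1 * g z.2.
  case: z => t x; rewrite big_ord_recl; congr (_ * _).
    congr (f _ _); rewrite -[RHS](rV_cons_head t x ord0).
    by congr (rV_cons _ _ _); exact/val_inj.
  apply: eq_bigr => i _; congr (f _ _); rewrite -[RHS](rV_cons_tail t).
  by congr (rV_cons _ _ _); exact/val_inj.
have mh := @measurable_rV_cons R n.
have mp : cmeasurable (fun x : 'rV[R]_n.+1 => \prod_i f i (x ord0 i)).
  apply: cmeasurable_prod => i.
  by apply: cmeasurable_comp; [exact: measurable_rV_coord|case: (jf i)].
have pE A : measurable A -> (leb \x mu n)%E (@rV_cons R n @^-1` A) = mu n.+1 A by [].
split.
  apply: (iffLR (cintble_push (m1 := (leb \x mu n)%E) (m2 := mu n.+1) mh pE _ mp)).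
  under eq_fun do rewrite E.
  exact: cintble_mul.
rewrite (cint_push (m1 := (leb \x mu n)%E) (m2 := mu n.+1) mh pE _ mp).
under eq_fun do rewrite E.
by rewrite cint_mul// big_ord_recl e.
Qed.

Definition sqnorm n (x : 'rV[R]_n) : R := \sum_i x ord0 i ^+ 2.

(** Up to the factor sqrt(pi / A) the integrand is the centred normal density of variance 1 / (2
    A). *)
Lemma gauss_integral (A : R) : 0 < A ->
  rintble leb (fun t => expR (- (A * t ^+ 2))) /\
  \int[leb]_t expR (- (A * t ^+ 2)) = Num.sqrt (pi / A).
Proof.
move=> A0; pose s := Num.sqrt ((2 * A)^-1).
have s2 : s ^+ 2 *+ 2 = A^-1.
  by rewrite sqr_sqrtr ?invr_ge0 ?mulr_ge0 ?(ltW A0)// -mulr_natr; field; rewrite gt_eqF.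
have s0 : s != 0.
  by apply: contraTneq isT => s0; move: s2; rewrite s0 expr0n mul0rn => /esym/eqP;
    rewrite invr_eq0 gt_eqF.
have E : (fun t => expR (- (A * t ^+ 2))) = (fun t => Num.sqrt (pi / A) * normal_pdf 0 s t).
  apply/funext => t; rewrite normal_pdfE// /normal_peak /normal_fun subr0.
  have -> : s ^+ 2 * pi *+ 2 = pi / A by rewrite -mulrnAl s2 mulrC.
  rewrite s2 invrK [RHS]mulrA divff ?mul1r.
    by congr expR; rewrite mulNr mulrC.
  by rewrite sqrtr_eq0 -ltNge divr_gt0 ?pi_gt0.
rewrite E; have jn : rintble leb (normal_pdf 0 s) := integrable_normal_pdf 0 s.
split; first exact: rintbleZ.
rewrite RintegralZl// -[RHS]mulr1; congr (_ * _).
by rewrite /Rintegral integral_normal_pdf.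
Qed.

Lemma sqnorm_gauss_integral n (A : R) : 0 < A ->
  rintble (mu n) (fun x => expR (- (A * sqnorm x))) /\
  \int[mu n]_x expR (- (A * sqnorm x)) = Num.sqrt (pi / A) ^+ n.
Proof.
move=> A0; have [j e] := gauss_integral A0.
have jc : cintble leb (fun t => (expR (- (A * t ^+ 2)))%:C%C).
  apply: (cintble_le _ j); last by move=> t; rewrite normc_real ger0_norm ?expR_ge0.
  by apply: cmeasurable_real; exact: (rintble_measurable j).
have [] := @cint_prod n (fun=> fun t => (expR (- (A * t ^+ 2)))%:C%C) (fun=> jc).
have -> : (fun x : 'rV[R]_n => \prod_i (expR (- (A * x ord0 i ^+ 2)))%:C%C) =
    (fun x => (expR (- (A * sqnorm x)))%:C%C).
  apply/funext => x; rewrite -rmorph_prod /=; congr (_%:C%C).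
  by rewrite /sqnorm mulr_sumr -sumrN expR_sum.
rewrite !cint_real prodr_const card_ord e -rmorphXn => /cintble_Re jx /complexI ex.
by split.
Qed.

End lebesgue_Rn_product.

Lemma ge0_le_int d (T : measurableType d) (R : realType) (mu : {measure set T -> \bar R})
    (h g : T -> R) : measurable_fun setT h -> measurable_fun setT g ->
  (forall x, 0 <= h x) -> (forall x, h x <= g x) ->
  (\int[mu]_x (h x)%:E <= \int[mu]_x (g x)%:E)%E.
Proof.
move=> mh mg h0 hg; apply: ge0_le_integral.
- exact: measurableT.
- by move=> x _; rewrite lee_fin.
- exact/measurable_EFinP.
- exact/measurable_EFinP.
- by move=> x _; rewrite lee_fin.
Qed.

(** * Continuity of translations in measure *)

Section translation_continuity.
Context {R : realType} (n : nat).
Local Notation mu := (@lebesgue_Rn R n).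
Local Notation X := ('rV[R]_n).
Implicit Types (E : set X) (h x : X).

Lemma sqnorm_ge0 x : 0 <= sqnorm x.
Proof. by apply: sumr_ge0 => i _; exact: sqr_ge0. Qed.

Lemma sqnorm_coord x (i : 'I_n) : x ord0 i ^+ 2 <= sqnorm x.
Proof. by rewrite /sqnorm (bigD1 i)//= lerDl; apply: sumr_ge0 => j _; exact: sqr_ge0. Qed.

Lemma sqnormD_le x h : sqnorm (x + h) <= 2 * sqnorm x + 2 * sqnorm h.
Proof.
rewrite /sqnorm !mulr_sumr -big_split; apply: ler_sum => i _ /=.
rewrite mxE; have := sqr_ge0 (x ord0 i - h ord0 i); nra.
Qed.

Lemma measurable_sqnorm : measurable_fun setT (@sqnorm R n).
Proof.
by apply: measurable_sum => i; apply: measurable_funX; exact: measurable_rV_coord.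
Qed.

Definition sqball (m : R) : set X := [set x | sqnorm x <= m].

Lemma measurable_sqball m : measurable (sqball m).
Proof.
rewrite -[X in measurable X]setTI (_ : sqball m = @sqnorm R n @^-1` `]-oo, m]%classic).
  exact: measurable_sqnorm.
by apply/seteqP; split=> x /=; rewrite in_itv.
Qed.

(** On the ball the indicator is at most exp(m) times the standard Gaussian exp(- |x|^2), whose
    integral factorizes over the coordinates: the coordinate of the slab contributes at most its
    width 2 d, the others a constant J each. *)
Lemma sqball_slab m : exists2 C : R, 0 <= C & forall (i : 'I_n) (a d : R), 0 <= d ->
  (mu (sqball m `&` [set x : X | (`|x ord0 i - a| <= d)%R]) <= (C * d)%:E)%E.
Proof.
pose J := \int[@lebesgue_measure R]_t expR (- (1 * t ^+ 2)).
have J0 : 0 <= J by apply: Rintegral_ge0 => t _; exact: expR_ge0.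
have [j1 _] := @gauss_integral R 1 ltr01.
exists (expR m * (2 * J ^+ n.-1)); first by rewrite mulr_ge0 ?expR_ge0 ?mulr_ge0 ?exprn_ge0.
move=> i a d d0.
pose I := (`[a - d, a + d]%classic : set (measurableTypeR R)).
pose g (k : 'I_n) (t : measurableTypeR R) : R :=
  (if k == i then \1_I t else 1) * expR (- (1 * t ^+ 2)).
have g0 k t : 0 <= g k t by rewrite /g mulr_ge0 ?expR_ge0//; case: ifP.
have mI : measurable I by exact: measurable_itv.
have mg k : measurable_fun setT (g k).
  apply: measurable_funM; last exact: (rintble_measurable j1).
  by case: (k == i); [exact: measurable_indic|exact: measurable_cst].
have g1 k t : g k t <= expR (- (1 * t ^+ 2)).
  by rewrite /g ler_piMl ?expR_ge0//; case: ifP.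
have jg k : rintble lebesgue_measure (g k).
  by apply: (rintble_le (mg k) j1) => t; rewrite ger0_norm.
have jgc k : cintble lebesgue_measure (fun t => (g k t)%:C%C).
  apply: (cintble_le _ (jg k)); first exact: cmeasurable_real.
  by move=> t; rewrite normc_real ger0_norm.
have [jp ep] := cint_prod jgc.
pose G (x : X) := \prod_k g k (x ord0 k).
have G0 x : 0 <= G x by apply: prodr_ge0.
have EG : (fun x : X => \prod_k (g k (x ord0 k))%:C%C) = (fun x => (G x)%:C%C).
  by apply/funext => x; rewrite -rmorph_prod.
have eG : \int[mu]_x G x = \prod_k \int[lebesgue_measure]_t g k t.
  apply: complexI; rewrite -cint_real -EG ep rmorph_prod; apply: eq_bigr => k _.
  by rewrite cint_real.
have jG : rintble mu G by move: jp; rewrite EG => /cintble_Re.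
have gi : \int[lebesgue_measure]_t g i t <= 2 * d.
  have gI t : g i t <= \1_I t.
    by rewrite /g eqxx ler_piMr// mul1r -[leRHS]expR0 ler_expR oppr_le0 sqr_ge0.
  rewrite -lee_fin EFin_rint//.
  apply: (@le_trans _ _ (\int[lebesgue_measure]_t (\1_I t)%:E)%E).
    by apply: ge0_le_int => //; exact: measurable_indic.
  rewrite integral_indic// setIT.
  rewrite [leLHS](lebesgue_measure_itv `[a - d, a + d]%R) /=; case: ifP => _; last first.
    by rewrite lee_fin mulr_ge0.
  by rewrite -EFinB lee_fin; lra.
have gk k : k != i -> \int[lebesgue_measure]_t g k t = J.
  by move=> /negbTE ki; apply: eq_Rintegral => t _; rewrite /g ki mul1r.
have leG : \int[mu]_x G x <= 2 * d * J ^+ n.-1.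
  rewrite eG (bigD1 i)//= (eq_bigr (fun=> J))//.
  rewrite prodr_const (_ : #|_| = n.-1); last first.
    by rewrite cardC1 card_ord.
  by rewrite ler_wpM2r ?exprn_ge0.
set A := _ `&` _.
have mA : measurable A.
  apply: measurableI; first exact: measurable_sqball.
  rewrite -[X in measurable X]setTI.
  rewrite (_ : [set x | _] = (fun x : X => x ord0 i) @^-1` I); last first.
    by apply/seteqP; split=> x; rewrite /I /= in_itv /= ler_distl.
  exact: measurable_rV_coord.
have AG x : (\1_A x : R) <= expR m * G x.
  rewrite indicE; have [xA|_] := boolP (x \in A); last by rewrite mulr_ge0 ?expR_ge0.
  move: xA; rewrite inE => -[/= xm xi].
  have -> : G x = expR (- sqnorm x).
    rewrite /G /sqnorm -sumrN expR_sum; apply: eq_bigr => k _; rewrite /g mul1r.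
    case: ifP => [/eqP ->|_]; last by rewrite mul1r.
    by rewrite indicE mem_set ?mul1r// /I /= in_itv /= -ler_distl.
  by rewrite -expRD -[leLHS]expR0 ler_expR subr_ge0.
have -> : mu A = (\int[mu]_x (\1_A x : R)%:E)%E by rewrite integral_indic// setIT.
apply: (@le_trans _ _ (\int[mu]_x (expR m * G x)%:E)%E).
  apply: ge0_le_int => //.
  by apply: measurable_funM => //; exact: rintble_measurable jG.
rewrite -EFin_rint; last exact: rintbleZ.
rewrite RintegralZl// lee_fin -mulrA ler_wpM2l ?expR_ge0//.
by rewrite (le_trans leG)// mulrAC.
Qed.

Lemma sqball_fin m : (mu (sqball m) < +oo)%E.
Proof.
have [j1 _] := @sqnorm_gauss_integral R n 1 ltr01.
have -> : mu (sqball m) = (\int[mu]_x (\1_(sqball m) x : R)%:E)%E.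
  by rewrite integral_indic ?setIT//; exact: measurable_sqball.
have j := rintbleZ (expR m) j1.
apply: le_lt_trans (rintble_ltey j _); last by move=> x; rewrite mulr_ge0 ?expR_ge0.
apply: ge0_le_int => //.
- by apply: measurable_indic; exact: measurable_sqball.
- exact: rintble_measurable j.
move=> x; rewrite indicE; have [|_] := boolP (x \in _); last first.
  by rewrite mulr_ge0 ?expR_ge0.
by rewrite inE /sqball /= => xm; rewrite -expRD -[leLHS]expR0 ler_expR mul1r subr_ge0.
Qed.

Definition shift_diff E h : set X :=
  ((fun x => affine_rV h 1 x) @^-1` E `\` E) `|` (E `\` (fun x => affine_rV h 1 x) @^-1` E).

Lemma measurable_shift h E : measurable E -> measurable ((fun x => affine_rV h 1 x) @^-1` E).
Proof. by move=> mE; rewrite -[X in measurable X]setTI; exact: measurable_affine_rV. Qed.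

Lemma measurable_shift_diff h E : measurable E -> measurable (shift_diff E h).
Proof.
by move=> mE; apply: measurableU; apply: measurableD => //; exact: measurable_shift.
Qed.

(** Continuity of translation at E, localized to balls. Balls have finite measure, and this is what
    makes the sets with the property stable under countable unions. *)
Definition shift_cont E := forall m e : R, 0 < e -> exists2 d : R, 0 < d &
  forall h, sqnorm h <= d -> (mu (sqball m `&` shift_diff E h) <= e%:E)%E.

Lemma shift_cont0 : shift_cont set0.
Proof.
move=> m e e0; exists 1 => // h _.
by rewrite /shift_diff preimage_set0 !set0D setU0 setI0 measure0 lee_fin ltW.
Qed.

Lemma shift_contC E : shift_cont E -> shift_cont (~` E).
Proof.
move=> cE m e e0; have [d d0 hd] := cE m e e0; exists d => // h hh.
rewrite (_ : shift_diff (~` E) h = shift_diff E h); first exact: hd.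
by apply/seteqP; split=> x; rewrite /shift_diff /=; have [] := pselect (E x);
  have [] := pselect (E (affine_rV h 1 x)); tauto.
Qed.

Lemma shift_contU E F : measurable E -> measurable F ->
  shift_cont E -> shift_cont F -> shift_cont (E `|` F).
Proof.
move=> mE mF cE cF m e e0; have e20 : 0 < e / 2 by rewrite divr_gt0.
have [d1 d10 h1] := cE m _ e20; have [d2 d20 h2] := cF m _ e20.
exists (Num.min d1 d2); first by rewrite lt_min d10.
move=> h; rewrite le_min => /andP[hd1 hd2].
have ms := measurable_sqball m.
have mDE := measurable_shift_diff h mE; have mDF := measurable_shift_diff h mF.
have mDEF := measurable_shift_diff h (measurableU _ _ mE mF).
apply: (@le_trans _ _ (mu ((sqball m `&` shift_diff E h) `|` (sqball m `&` shift_diff F h)))).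
  apply: le_measure; rewrite ?inE; do ?[exact: measurableI|apply: measurableU; exact: measurableI].
  by move=> x; rewrite /shift_diff /=; tauto.
apply: (le_trans (measureU2 _ _ _)); [exact: measurableI..|].
by rewrite [e]splitr EFinD leeD ?h1 ?h2.
Qed.

(** On a larger ball a finite union exhausts the countable one up to measure e / 3. The remainder
    enters twice, at x and at x + h, with equal measure by translation invariance; the finite union
    accounts for the last third. *)
Lemma shift_cont_bigcup (F : (set X)^nat) : (forall k, measurable (F k)) ->
  (forall k, shift_cont (F k)) -> shift_cont (\bigcup_k F k).
Proof.
move=> mF cF m e e0.
pose G k := \big[setU/set0]_(i < k) F i.
have mG k : measurable (G k) by apply: bigsetU_measurable.
have cG k : shift_cont (G k).
  elim: k => [|k ih]; first by rewrite /G big_ord0; exact: shift_cont0.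
  rewrite /G big_ord_recr; apply: shift_contU => //; exact: mG.
pose U := \bigcup_k F k.
have mU : measurable U by exact: bigcup_measurable.
(* The ball [sqball m2] contains x + h whenever x is in [sqball m] and |h|^2 <= 1, since |x + h|^2
   <= 2 |x|^2 + 2 |h|^2. *)
pose m2 := Num.max m (2 * m + 2).
have e30 : 0 < e / 3 by rewrite divr_gt0.
have [k kP] : exists k, (mu (sqball m2 `&` (U `\` G k)) <= (e / 3)%:E)%E.
  pose T k := sqball m2 `&` (U `\` G k).
  have mT k : measurable (T k).
    by apply: measurableI; [exact: measurable_sqball|exact: measurableD].
  have : mu \o T @ \oo --> mu (\bigcap_k T k).
    apply: nonincreasing_cvg_mu => //.
    - apply: le_lt_trans (sqball_fin m2); apply: le_measure; rewrite ?inE//.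
        exact: measurable_sqball.
      by move=> x [].
    - exact: bigcapT_measurable.
    - move=> a b ab; apply/subsetPset => x [xm [xU xG]]; split => //; split => // xa.
      by apply: xG; exact: (@subset_bigsetU _ F a b ab x xa).
  have -> : \bigcap_k T k = set0.
    apply/seteqP; split=> // x xT; have [_ [[k _ Fk] _]] := xT 0%N I.
    have [_ [_]] := xT k.+1 I; apply.
    by rewrite /G big_ord_recr; right.
  rewrite measure0 => /fine_cvgP[/= fin /cvgrPdist_le /(_ _ e30)] cv.
  near \oo => k; exists k.
  rewrite -[leLHS]fineK; last by near: k.
  rewrite lee_fin (le_trans (ler_norm _))// -normrN -[X in `|X|]add0r.
  by near: k.
have [d d0 hd] := cG k m _ e30.
exists (Num.min d 1); first by rewrite lt_min d0 ltr01.
move=> h; rewrite le_min => /andP[hd1 h1].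
pose B := U `\` G k; have mB : measurable B by exact: measurableD.
have ms := measurable_sqball.
pose S1 := sqball m `&` shift_diff (G k) h.
pose S2 := sqball m2 `&` B.
pose S3 := (fun x => affine_rV h 1 x) @^-1` (sqball m2 `&` B).
have mS1 : measurable S1 by apply: measurableI => //; exact: measurable_shift_diff.
have mS2 : measurable S2 by apply: measurableI.
have mS3 : measurable S3 by exact: measurable_shift.
have GU : G k `<=` U by exact: bigsetU_bigcup.
apply: (@le_trans _ _ (mu ((S1 `|` S2) `|` S3))).
  apply: le_measure; rewrite ?inE.
  - by apply: measurableI => //; exact: measurable_shift_diff.
  - by apply: measurableU => //; exact: measurableU.
  move=> x [xm xU].
  have xm2 : sqball m2 x by rewrite /sqball /= le_max xm.
  have xh2 : sqball m2 (affine_rV h 1 x).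
    rewrite /sqball /= le_max; apply/orP; right.
    rewrite /affine_rV scale1r addrC (le_trans (sqnormD_le _ _))//.
    by rewrite lerD ?ler_wpM2l// -[leRHS]mulr1 ler_wpM2l.
  have GUx := GU x; have GUh := GU (affine_rV h 1 x).
  move: xU; rewrite /S1 /S2 /S3 /B /shift_diff /= => xU.
  by have [?|?] := pselect (G k x); have [?|?] := pselect (G k (affine_rV h 1 x));
    tauto.
have s1 : is_sign (1 : R) by left.
apply: (le_trans (measureU2 _ _ _)) => //; first exact: measurableU.
rewrite (_ : e = e / 3 + e / 3 + e / 3); last by field.
have eS3 : mu S3 = mu S2 := lebesgue_Rn_affine h s1 mS2.
rewrite [leRHS]EFinD; apply: leeD; last by apply: le_trans kP; rewrite le_eqVlt;
  apply/orP; left; apply/eqP; exact: eS3.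
rewrite EFinD; apply: (le_trans (measureU2 _ _ _)) => //.
by apply: leeD; [exact: hd|exact: kP].
Unshelve. all: by end_near. Qed.

(** A half-space and its translate differ only in a slab of half-width |h_i| around the boundary. *)
Lemma shift_cont_ray (i : 'I_n) (a : R) :
  shift_cont [set x | a < x ord0 i].
Proof.
move=> m e e0; have [C C0 hC] := sqball_slab m.
pose d := e / (C + 1).
have d0 : 0 < d by rewrite divr_gt0// ltr_wpDl.
exists (d ^+ 2); first by rewrite exprn_gt0.
move=> h hh; apply: (@le_trans _ _ (C * d)%:E); last first.
  by rewrite lee_fin /d mulrCA ler_piMr ?(ltW e0)// ler_pdivrMr ?mul1r ?lerDl ?ltr_wpDl.
have mr : measurable [set x : X | a < x ord0 i].
  rewrite -[X in measurable X]setTI.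
  rewrite (_ : [set x | _] = (fun x : X => x ord0 i) @^-1` `]a, +oo[%classic).
    exact: measurable_rV_coord.
  by apply/seteqP; split=> x /=; rewrite in_itv /= andbT.
apply: le_trans (hC i a d (ltW d0)); apply: le_measure; rewrite ?inE.
- by apply: measurableI; [exact: measurable_sqball|exact: measurable_shift_diff].
- apply: measurableI; first exact: measurable_sqball.
  rewrite -[X in measurable X]setTI.
  rewrite (_ : [set x | _] = (fun x : X => x ord0 i) @^-1` `[a - d, a + d]%classic); last first.
    by apply/seteqP; split=> x /=; rewrite in_itv /= ler_distl.
  exact: measurable_rV_coord.
move=> x [xm]; rewrite /shift_diff /= /affine_rV !mxE mul1r => hx; split => //=.
have : `|h ord0 i| <= d.
  rewrite -[leRHS]ger0_norm ?(ltW d0)// -ler_sqr ?nnegrE//.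
  by rewrite !real_normK ?num_real// (le_trans (sqnorm_coord h i)).
rewrite !ler_norml => /andP[h1 h2].
by case: hx => -[/= + /negP]; rewrite -leNgt => h3 h4; apply/andP; split; lra.
Qed.

(** The sets with the property form a sigma-algebra, and it contains the coordinate half-spaces,
    which generate the Borel sets. *)
Lemma measurable_shift_cont E : measurable E -> shift_cont E.
Proof.
move=> mE; suff : measurable E /\ shift_cont E by case.
pose L := [set A : set X | measurable A /\ shift_cont A].
have sL : sigma_algebra setT L.
  split.
  - by split; [exact: measurable0|exact: shift_cont0].
  - by move=> A [mA cA]; rewrite setTD; split; [exact: measurableC|exact: shift_contC].
  - move=> F LF; split; first by apply: bigcup_measurable => k _; case: (LF k).
    by apply: shift_cont_bigcup => k; case: (LF k).
rewrite -/(L E); move: mE; apply: (smallest_sub sL) => A.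
have gen (i : 'I_n) (B : set (measurableTypeR R)) : measurable B ->
    L ((fun x : X => x ord0 i) @^-1` B).
  rewrite RGenOInfty.measurableE => mB.
  have sB : sigma_algebra setT [set B | L ((fun x : X => x ord0 i) @^-1` B)].
    case: sL => L0 LC LU; split => /=.
    - by rewrite preimage_set0.
    - by move=> D LD; rewrite setTD preimage_setC -setTD; exact: LC.
    - by move=> F LF; rewrite preimage_bigcup; exact: LU.
  move: B mB; apply: (smallest_sub sB) => _ [a ->] /=.
  rewrite (_ : _ @^-1` _ = [set x : X | a < x ord0 i]); last first.
    by apply/seteqP; split=> x /=; rewrite in_itv /= andbT.
  split; last exact: shift_cont_ray.
  rewrite -[X in measurable X]setTI.
  rewrite (_ : [set x | _] = (fun x : X => x ord0 i) @^-1` `]a, +oo[%classic).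
    exact: measurable_rV_coord.
  by apply/seteqP; split=> x /=; rewrite in_itv /= andbT.
elim/big_ind : _ => [//|U V hU hV|i _]; first by move=> [/hU|/hV].
by move=> [B mB <-]; rewrite setTI; exact: gen.
Qed.

End translation_continuity.

(** * Gaussian integrals and the complex-time heat kernel *)

Section rint_linear.
Context d (T : measurableType d) (R : realType) (mu : {measure set T -> \bar R}).
Implicit Types f g : T -> R.

Lemma rintZ c f : rintble mu f -> \int[mu]_x (c * f x) = c * \int[mu]_x f x.
Proof. by move=> jf; apply: RintegralZl. Qed.

Lemma rintD f g : rintble mu f -> rintble mu g ->
  \int[mu]_x (f x + g x) = \int[mu]_x f x + \int[mu]_x g x.
Proof. by move=> jf jg; apply: RintegralD. Qed.

Lemma rintB f g : rintble mu f -> rintble mu g ->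
  \int[mu]_x (f x - g x) = \int[mu]_x f x - \int[mu]_x g x.
Proof. by move=> jf jg; apply: RintegralB. Qed.

Lemma le_rint f g : rintble mu f -> rintble mu g -> (forall x, f x <= g x) ->
  \int[mu]_x f x <= \int[mu]_x g x.
Proof. by move=> jf jg fg; apply: le_Rintegral. Qed.

End rint_linear.

Lemma is_derive_rint d (T : measurableType d) (R : realType)
    (mu : {measure set T -> \bar R}) (f df : R -> T -> R) (a u v : R) (G : T -> R) :
  a \in `]u, v[%R -> (forall x, x \in `]u, v[%R -> rintble mu (f x)) ->
  (forall x y, x \in `]u, v[%R -> is_derive x 1 (f^~ y) (df x y)) ->
  rintble mu G -> (forall x y, x \in `]u, v[%R -> `|df x y| <= G y) ->
  is_derive a 1 (fun x => \int[mu]_y f x y) (\int[mu]_y df a y).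
Proof.
move=> auv jf f_df jG dfG.
have G0 y : 0 <= G y by apply: le_trans (dfG a y auv).
have e x y : x \in `]u, v[%R -> partial1of2 f x y = df x y.
  by move=> /f_df xuv; rewrite partial1of2E; apply: derive_val.
have H1 x y : `]u, v[%classic x -> setT y -> derivable (f ^~ y) x 1.
  by move=> xuv _; apply: ex_derive; exact: f_df.
have H2 x y : `]u, v[%classic x -> setT y -> `|partial1of2 f x y| <= G y.
  by move=> xuv _; rewrite e//; exact: dfG.
have D := derivable_under_integral measurableT auv jf H1 G0 jG H2.
apply: DeriveDef => //.
rewrite -derive1E (differentiation_under_integral measurableT auv jf H1 G0 jG H2).
by apply: eq_Rintegral => y _; rewrite e.
Qed.

(** * The Fourier transform of a Gaussian *)

Section oscillatory_gauss.
Context {R : realType}.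
Local Notation leb := (@lebesgue_measure R).
Variables (A : R) (A0 : 0 < A).

Let g (t : R) := expR (- (A * t ^+ 2)).

Lemma mul_gauss_le (t : R) :
  `|t| * expR (- (A * t ^+ 2)) <= (1 + 2 / A) * expR (- (A / 2 * t ^+ 2)).
Proof.
have t1 : `|t| <= 1 + t ^+ 2.
  have [h|h] := lerP `|t| 1; first by rewrite (le_trans h)// lerDl sqr_ge0.
  by rewrite -real_normK ?num_real// (@le_trans _ _ (`|t| ^+ 2)) ?lerDr// ler_eXnr// ltW.
have t2 : t ^+ 2 <= 2 / A * expR (A / 2 * t ^+ 2).
  have := expR_ge1Dx (A / 2 * t ^+ 2) => h.
  rewrite mulrAC ler_pdivlMr//; nra.
have A2 : expR (- (A * t ^+ 2)) = expR (- (A / 2 * t ^+ 2)) * expR (- (A / 2 * t ^+ 2)).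
  by rewrite -expRD; congr expR; field.
have e1 : 1 <= expR (A / 2 * t ^+ 2).
  by rewrite -[leLHS]expR0 ler_expR mulr_ge0 ?sqr_ge0// divr_ge0// ltW.
rewrite A2 mulrA ler_wpM2r ?expR_ge0// expRN ler_pdivrMr ?expR_gt0//.
rewrite (le_trans t1)// mulrDl mul1r lerD//.
Qed.

Lemma rintble_gauss_mul (p : R -> R) (C : R) : measurable_fun setT p ->
  (forall t, `|p t| <= C * (1 + `|t|)) -> rintble leb (fun t => p t * g t).
Proof.
move=> mp pC; have A20 : 0 < A / 2 by rewrite divr_gt0.
have [j1 _] := gauss_integral A0; have [j2 _] := gauss_integral A20.
have C0 : 0 <= C by have := pC 0; rewrite normr0 addr0 mulr1; apply: le_trans.
apply: (rintble_le _ (rintbleD (rintbleZ C j1) (rintbleZ C (rintbleZ (1 + 2 / A) j2)))).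
  by apply: measurable_funM => //; exact: (rintble_measurable j1).
move=> t; rewrite normrM [`|g t|]ger0_norm ?expR_ge0//.
rewrite (le_trans (ler_wpM2r _ (pC t))) ?expR_ge0//.
rewrite -[leRHS]mulrDr -[leLHS]mulrA ler_wpM2l//.
by rewrite [leLHS]mulrDl mul1r lerD2l mul_gauss_le.
Qed.

Let F (xi : R) := \int[leb]_t (cos (xi * t) * g t).

Let measurable_cosM (xi : R) : measurable_fun setT (fun t : R => cos (xi * t)).
Proof.
apply: (measurableT_comp (continuous_measurable_fun (@continuous_cos R))).
exact: measurable_funM.
Qed.

Let measurable_sinM (xi : R) : measurable_fun setT (fun t : R => sin (xi * t)).
Proof.
apply: (measurableT_comp (continuous_measurable_fun (@continuous_sin R))).
exact: measurable_funM.
Qed.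

Lemma ler_cos1 (t : R) : `|cos t| <= 1.
Proof. by rewrite ler_norml cos_geN1 cos_le1. Qed.

Lemma ler_sin1 (t : R) : `|sin t| <= 1.
Proof. by rewrite ler_norml sin_geN1 sin_le1. Qed.

Let jcos xi : rintble leb (fun t => cos (xi * t) * g t).
Proof.
apply: (@rintble_gauss_mul (fun t => cos (xi * t)) 1) => // t.
by rewrite mul1r (le_trans (ler_cos1 _))// lerDl.
Qed.

Let jsin xi : rintble leb (fun t => sin (xi * t) * g t).
Proof.
apply: (@rintble_gauss_mul (fun t => sin (xi * t)) 1) => // t.
by rewrite mul1r (le_trans (ler_sin1 _))// lerDl.
Qed.

Let jtsin xi : rintble leb (fun t => t * sin (xi * t) * g t).
Proof.
apply: (@rintble_gauss_mul (fun t => t * sin (xi * t)) 1) => [|t].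
  exact: measurable_funM.
by rewrite mul1r normrM (@le_trans _ _ `|t|) ?lerDr// ler_piMr ?ler_sin1.
Qed.

Let dF (xi : R) : is_derive xi (1 : R) F (\int[leb]_t (- (t * sin (xi * t) * g t))).
Proof.
have [C1 C2] : xi - 1 < xi /\ xi < xi + 1 by split; lra.
apply: (@is_derive_rint _ _ _ leb (fun x t => cos (x * t) * g t)
    (fun x t => - (t * sin (x * t) * g t)) xi (xi - 1) (xi + 1) (fun t => `|t| * g t)).
- by rewrite in_itv /= C1 C2.
- by move=> x _; exact: jcos.
- move=> x t _.
  apply: is_derive_eq; rewrite /GRing.scale/= ; ring.
- have := @rintble_gauss_mul (fun t => `|t|) 1; apply; first exact: measurableT_comp.
  by move=> t; rewrite normr_id mul1r lerDr.
- move=> x t _; rewrite normrN !normrM [`|g t|]ger0_norm ?expR_ge0//.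
  by rewrite ler_wpM2r ?expR_ge0// ler_piMr ?ler_sin1.
Qed.

(* Integration by parts, obtained by differentiating the translation invariant
   integral of [sin (xi t) g t]. *)
Let ibp (xi : R) : 2 * A * (\int[leb]_t (t * sin (xi * t) * g t)) = xi * F xi.
Proof.
pose k t := sin (xi * t) * g t.
pose dk t := (xi * cos (xi * t) - 2 * A * t * sin (xi * t)) * g t.
have kdk (t : R) : is_derive t (1 : R) k (dk t).
  by apply: is_derive_eq; rewrite /GRing.scale/= /dk /g; ring.
pose S (h : R) := \int[leb]_t k (h + 1 * t).
have mk : measurable_fun setT k by exact: (rintble_measurable (jsin xi)).
have s1 : is_sign (1 : R) by left.
have SE h : S h = \int[leb]_t k t.
  by rewrite (rint_push (m1 := leb) (m2 := leb) (measurable_affine h 1)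
    (fun B mB => lebesgue_affine h s1 mB) k mk).
(* For |h| < 1 one has (h + t)^2 >= t^2 / 2 - 1, so half of the exponent at h + t is dominated by
   exp(A / 2) times a Gaussian in t alone; the other half has absorbed the linear factor. *)
pose C := (`|xi| + 2 * A * (1 + 2 / A)) * expR (A / 2).
have dS : is_derive (0 : R) (1 : R) S (\int[leb]_t dk (0 + 1 * t)).
  apply: (@is_derive_rint _ _ _ leb (fun h t => k (h + 1 * t)) (fun h t => dk (h + 1 * t))
     0 (-1) 1 (fun t => C * expR (- (A / 4 * t ^+ 2)))).
  - by rewrite in_itv /= ltrN10 ltr01.
  - move=> h _; apply: (iffRL (rintble_push (m1 := leb) (m2 := leb) (measurable_affine h 1)
      (fun B mB => lebesgue_affine h s1 mB) k mk)); exact: jsin.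
  - move=> h t _.
    have := is_derive1_comp (f := k) (g := fun h => h + 1 * t) (x := h).
    move=> /(_ (dk (h + 1 * t)) 1 (kdk _)); rewrite mulr1; apply.
    by apply: is_derive_eq; rewrite addr0.
  - apply: rintbleZ; have A40 : 0 < A / 4 by rewrite divr_gt0.
    by have [] := gauss_integral A40.
  - move=> h t; rewrite in_itv /= => /andP[h1 h2]; set s := h + 1 * t.
    have gs : expR (- (A / 2 * s ^+ 2)) <= expR (A / 2) * expR (- (A / 4 * t ^+ 2)).
      rewrite -expRD ler_expR /s mul1r.
      have hh : 0 <= A * (1 - h) * (1 + h) by rewrite !mulr_ge0 ?(ltW A0)//; lra.
      have := mulr_ge0 (ltW A0) (sqr_ge0 (t + 2 * h)).
      nra.
    have gg : g s <= expR (- (A / 2 * s ^+ 2)).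
      by rewrite /g ler_expR lerN2; have := mulr_ge0 (ltW A0) (sqr_ge0 s); lra.
    rewrite /dk normrM [`|g s|]ger0_norm ?expR_ge0//.
    have h3 : `|xi * cos (xi * s) - 2 * A * s * sin (xi * s)| <= `|xi| + 2 * A * `|s|.
      rewrite (le_trans (ler_normB _ _))// lerD// !normrM.
        by rewrite ler_piMr ?ler_cos1.
      by rewrite [`|2|]ger0_norm// [`|A|]ger0_norm ?(ltW A0)// ler_piMr ?ler_sin1 ?mulr_ge0 ?(ltW A0).
    rewrite (le_trans (ler_wpM2r _ h3)) ?expR_ge0//.
    have C'0 : 0 <= `|xi| + 2 * A * (1 + 2 / A).
      by rewrite addr_ge0 ?mulr_ge0 ?addr_ge0 ?divr_ge0 ?(ltW A0).
    rewrite /C -[leRHS]mulrA; apply: le_trans (ler_wpM2l C'0 gs).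
    rewrite [leLHS]mulrDl [leRHS]mulrDl lerD//; first by rewrite ler_wpM2l.
    rewrite -[leLHS]mulrA -[leRHS]mulrA ler_wpM2l ?mulr_ge0 ?(ltW A0)//.
    exact: mul_gauss_le.
have dS0 : is_derive (0 : R) (1 : R) S 0.
  rewrite (_ : S = cst (\int[leb]_t k t)); first exact: is_derive_cst.
  by apply/funext => h; rewrite SE.
have e0 : \int[leb]_t dk t = 0.
  have := @derive_val _ _ _ _ _ _ _ dS; rewrite (@derive_val _ _ _ _ _ _ _ dS0) => ->.
  by apply: eq_Rintegral => t _; rewrite add0r mul1r.
have : \int[leb]_t dk t = xi * F xi - 2 * A * (\int[leb]_t (t * sin (xi * t) * g t)).
  transitivity (\int[leb]_t (xi * (cos (xi * t) * g t) -
      2 * A * (t * sin (xi * t) * g t))).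
    by apply: eq_Rintegral => t _; rewrite /dk; ring.
  have jc := rintbleZ xi (jcos xi); have js := rintbleZ (2 * A) (jtsin xi).
  by rewrite (rintB jc js) (rintZ _ (jcos xi)) (rintZ _ (jtsin xi)).
by rewrite e0 => /esym/eqP; rewrite subr_eq0 => /eqP ->.
Qed.

(** Differentiation under the integral and [ibp] give F' = - xi F / (2 A). Hence F exp(xi^2 / (4 A))
    is constant, and its value at 0 is the Gaussian integral. *)
Lemma gauss_cos_integral xi :
  \int[leb]_t (cos (xi * t) * expR (- (A * t ^+ 2))) =
  Num.sqrt (pi / A) * expR (- (xi ^+ 2 / (4 * A))).
Proof.
pose y x := F x * expR (x ^+ 2 / (4 * A)).
have dy (x : R) : is_derive x (1 : R) y 0.
  have dFx := dF x.
  apply: is_derive_eq; rewrite /GRing.scale /=.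
  have -> : \int[leb]_t (- (t * sin (x * t) * g t)) = - (x / (2 * A) * F x).
    transitivity (\int[leb]_t ((-1) * (t * sin (x * t) * g t))).
      by apply: eq_Rintegral => t _; rewrite mulN1r.
    rewrite (rintZ _ (jtsin x)) mulN1r; congr (- _).
    by rewrite mulrAC -ibp; field; rewrite gt_eqF.
  by field; rewrite gt_eqF.
have := is_derive_0_is_cst xi 0 dy.
rewrite /y expr0n mul0r expR0 mulr1 -/(F xi) => /(canRL (mulfK _)) -> //; last first.
  by rewrite gt_eqF ?expR_gt0.
rewrite expRN; congr (_ / _); have [_ <-] := gauss_integral A0.
by apply: eq_Rintegral => t _; rewrite mul0r cos0 mul1r.
Qed.

Lemma gauss_sin_integral xi :
  \int[leb]_t (sin (xi * t) * expR (- (A * t ^+ 2))) = 0.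
Proof.
have s1 : is_sign (-1 : R) by right.
have mk := rintble_measurable (jsin xi).
have e := rint_push (m1 := leb) (m2 := leb) (measurable_affine 0 (-1))
    (fun B mB => lebesgue_affine 0 s1 mB) _ mk.
have : \int[leb]_t (sin (xi * t) * g t) = - \int[leb]_t (sin (xi * t) * g t).
  transitivity (\int[leb]_t ((-1) * (sin (xi * t) * g t))); last first.
    by rewrite (rintZ _ (jsin xi)) mulN1r.
  rewrite [LHS]e; apply: eq_Rintegral => t _.
  by rewrite add0r !mulN1r mulrN sinN mulNr /g sqrrN.
by move/eqP; rewrite -addr_eq0 -mulr2n mulrn_eq0 => /eqP.
Qed.

Lemma cint_gauss_osc xi :
  cintble leb (fun t => cexp (Complex (- (A * t ^+ 2)) (xi * t))) /\
  cint leb (fun t => cexp (Complex (- (A * t ^+ 2)) (xi * t))) =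
  (Num.sqrt (pi / A) * expR (- (xi ^+ 2 / (4 * A))))%:C%C.
Proof.
have [j1 _] := gauss_integral A0.
split.
  apply: (cintble_le _ j1); last by move=> t; rewrite normc_cexp.
  apply: cmeasurable_cexp; split => /=.
    by apply: measurableT_comp => //; apply: measurable_funM => //; exact: measurable_funX.
  exact: measurable_funM.
apply: complexP => /=.
  by rewrite -gauss_cos_integral; apply: eq_Rintegral => t _; rewrite mulrC.
by rewrite -(gauss_sin_integral xi); apply: eq_Rintegral => t _; rewrite mulrC.
Qed.

End oscillatory_gauss.

Section convolution_integral.
Context {R : realType} (n : nat).
Local Notation mu := (@lebesgue_Rn R n).
Local Notation X := ('rV[R]_n).

Lemma measurable_sub1 (y : X) : measurable_fun setT (fun x : X => x - y).
Proof.
rewrite (_ : (fun x => _) = affine_rV (- y) 1); first exact: measurable_affine_rV.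
by apply/funext => x; rewrite /affine_rV scale1r addrC.
Qed.

Lemma measurable_sub : measurable_fun setT (fun z : X * X => z.1 - z.2).
Proof.
apply/measurable_fun_rVP => i.
rewrite (_ : (fun x => _) = (fun z : X * X => z.1 ord0 i - z.2 ord0 i)).
  apply: measurable_funB; exact: (measurableT_comp (@measurable_rV_coord R n i)).
by apply/funext => z; rewrite !mxE.
Qed.

Lemma push_subr (x : X) A : measurable A ->
  mu ((fun y => x - y) @^-1` A) = mu A.
Proof.
move=> mA; have s1 : is_sign (-1 : R) by right.
rewrite -(lebesgue_Rn_affine x s1 mA) (_ : (fun y => _) = affine_rV x (-1))//.
by apply/funext => y; rewrite /affine_rV scaleN1r.
Qed.

Lemma push_subl (y : X) A : measurable A ->
  mu ((fun x => x - y) @^-1` A) = mu A.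
Proof.
move=> mA; have s1 : is_sign (1 : R) by left.
rewrite -(lebesgue_Rn_affine (- y) s1 mA) (_ : (fun y => _) = affine_rV (- y) 1)//.
by apply/funext => x; rewrite /affine_rV scale1r addrC.
Qed.

Lemma measurable_subr (x : X) : measurable_fun setT (fun y : X => x - y).
Proof.
rewrite (_ : (fun y => _) = affine_rV x (-1)); first exact: measurable_affine_rV.
by apply/funext => y; rewrite /affine_rV scaleN1r.
Qed.

Variables (a k : X -> R).
Hypotheses (ja : rintble mu a) (jk : rintble mu k).
Hypotheses (a0 : forall x, 0 <= a x) (k0 : forall x, 0 <= k x).

Let mk := rintble_measurable jk.
Let ma := rintble_measurable ja.

(** The weight sits on the first variable here and on the second in [int_conv2]. A product of
    functions of the two variables is bounded by a sum of such weights, as in Schur's test and in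
    Young's inequality. *)
Lemma int_conv1 : rintble (mu \x mu)%E (fun z => a z.1 * k (z.1 - z.2)) /\
  \int[(mu \x mu)%E]_z (a z.1 * k (z.1 - z.2)) = \int[mu]_x a x * \int[mu]_x k x.
Proof.
have mz : measurable_fun setT (fun z : X * X => a z.1 * k (z.1 - z.2)).
  apply: measurable_funM; first exact: (measurableT_comp ma).
  by apply: (measurableT_comp mk); exact: measurable_sub.
have jkx x : rintble mu (fun y => k (x - y)).
  by apply/(rintble_push (m1 := mu) (m2 := mu) (measurable_subr x) (push_subr x) k mk).
have Ek x : \int[mu]_y k (x - y) = \int[mu]_y k y.
  by rewrite (rint_push (m1 := mu) (m2 := mu) (measurable_subr x) (push_subr x) k mk).
have j : rintble (mu \x mu)%E (fun z => a z.1 * k (z.1 - z.2)).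
  apply: rintble_prod => //=.
  have E x : (\int[mu]_y `|a x * k (x - y)|%:E = (\int[mu]_y k y * a x)%:E)%E.
    rewrite -(Ek x) mulrC -(rintZ _ (jkx x)) EFin_rint; last exact: rintbleZ.
    by apply: eq_integral => y _; rewrite ger0_norm// mulr_ge0.
  under eq_integral do rewrite E.
  apply: rintble_ltey; first exact: rintbleZ.
  by move=> x; rewrite mulr_ge0// Rintegral_ge0.
split => //; have [_ <-] := rfubini1 j => /=.
rewrite mulrC -(rintZ _ ja); apply: eq_Rintegral => x _.
by rewrite (rintZ _ (jkx x)) Ek mulrC.
Qed.

Lemma int_conv2 : rintble (mu \x mu)%E (fun z => a z.2 * k (z.1 - z.2)) /\
  \int[(mu \x mu)%E]_z (a z.2 * k (z.1 - z.2)) = \int[mu]_x a x * \int[mu]_x k x.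
Proof.
have mz : measurable_fun setT (fun z : X * X => a z.2 * k (z.1 - z.2)).
  apply: measurable_funM; first exact: (measurableT_comp ma).
  by apply: (measurableT_comp mk); exact: measurable_sub.
have jky y : rintble mu (fun x => k (x - y)).
  by apply/(rintble_push (m1 := mu) (m2 := mu) (measurable_sub1 y) (push_subl y) k mk).
have Ek y : \int[mu]_x k (x - y) = \int[mu]_x k x.
  by rewrite (rint_push (m1 := mu) (m2 := mu) (measurable_sub1 y) (push_subl y) k mk).
have j : rintble (mu \x mu)%E (fun z => a z.2 * k (z.1 - z.2)).
  apply: (iffRL (integrable21ltyP mu mu _)); first exact/measurable_EFinP.
  have E y : (\int[mu]_x `|(a y * k (x - y))%:E| = (\int[mu]_y k y * a y)%:E)%E.
    rewrite -(Ek y) mulrC -(rintZ _ (jky y)) EFin_rint; last exact: rintbleZ.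
    by apply: eq_integral => x _; rewrite /= ger0_norm// mulr_ge0.
  under eq_integral do rewrite /= E.
  apply: rintble_ltey; first exact: rintbleZ.
  by move=> x; rewrite mulr_ge0// Rintegral_ge0.
split => //; have [_ <-] := rfubini2 j => /=.
rewrite mulrC -(rintZ _ ja); apply: eq_Rintegral => y _.
by rewrite (rintZ _ (jky y)) Ek mulrC.
Qed.

End convolution_integral.

(** * The heat kernel at complex time and its contraction property in L_2 *)

Section heat_kernel.
Context {R : realType} (n : nat) (om : R[i]).
Hypotheses (om1 : normc om = 1) (om0 : 0 < cRe om).
Local Notation mu := (@lebesgue_Rn R n).
Local Notation leb := (@lebesgue_measure R).
Local Notation X := ('rV[R]_n).

(** The amplitude (4 pi s)^(-k/2), written as an exponential so that it merges with the argument of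
    [cexp] in products and derivatives. *)
Definition heat_amp (k : nat) (s : R) : R := expR (- (k%:R / 2 * ln (4 * pi * s))).

(* The heat kernel (4 pi s)^(-k/2) exp(- om N / (4 s)) of e^(z Delta) in dimension k
   at complex time z = s / om, as a function of N = |x|^2, up to a unimodular factor. *)
Definition heat (k : nat) (s N : R) : R[i] :=
  cexp (Complex (- (k%:R / 2 * ln (4 * pi * s)) - cRe om * (N / (4 * s)))
    (- (cIm om * (N / (4 * s))))).

Definition heatk (s : R) (w : X) : R[i] := heat n s (sqnorm w).

Lemma om_sqr : cRe om ^+ 2 + cIm om ^+ 2 = 1.
Proof.
have := om1; rewrite Defs.normcE => h.
by rewrite -[LHS]sqr_sqrtr ?h ?expr1n// addr_ge0 ?sqr_ge0.
Qed.

Lemma normc_heat k s N : normc (heat k s N) = heat_amp k s * expR (- (cRe om / (4 * s) * N)).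
Proof.
by rewrite normc_cexp /= expRD; congr (_ * expR (- _)); rewrite mulrA mulrAC.
Qed.

Lemma heat_amp_ge0 k s : 0 <= heat_amp k s.
Proof. exact: expR_ge0. Qed.

Lemma heat_ampE s : 0 < s -> heat_amp n s = (Num.sqrt (4 * pi * s))^-1 ^+ n.
Proof.
move=> s0; have p0 : 0 < 4 * pi * s by rewrite !mulr_gt0 ?pi_gt0.
rewrite -powR12_sqrt ?(ltW p0)// -powRN -powR_mulrn ?powR_ge0// -powRrM.
by rewrite /powR gt_eqF//; congr expR; rewrite -mulNr; congr (_ * _); field.
Qed.

Lemma normc_heat_le s N : 0 < s -> 0 <= N -> normc (heat n s N) <= heat_amp n s.
Proof.
move=> s0 N0; rewrite normc_heat ler_piMr ?heat_amp_ge0//.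
by rewrite -[leRHS]expR0 ler_expR oppr_le0 mulr_ge0// divr_ge0 ?(ltW om0)// mulr_ge0 ?(ltW s0).
Qed.

Lemma cmeasurable_heatk s : cmeasurable (heatk s).
Proof.
apply: cmeasurable_cexp; split => /=.
- apply: measurable_funB => //; apply: measurable_funM => //.
  by apply: measurable_funM => //; exact: measurable_sqnorm.
- apply: measurableT_comp => //; apply: measurable_funM => //.
  by apply: measurable_funM => //; exact: measurable_sqnorm.
Qed.

(** The L_1 norm (Re om)^(-n/2) does not depend on s, but it is not 1 in general and degenerates as
    om approaches the imaginary axis. It serves for integrability, decay and limits; the
    quantitative estimate rests on [heatk_L2]. *)
Lemma cintble_heatk s : 0 < s -> cintble mu (heatk s) /\
  \int[mu]_w normc (heatk s w) = (Num.sqrt (cRe om))^-1 ^+ n.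
Proof.
move=> s0; have A0 : 0 < cRe om / (4 * s) by rewrite divr_gt0 ?mulr_gt0.
have [j e] := @sqnorm_gauss_integral R n _ A0.
have nE : (fun w => normc (heatk s w)) =
    (fun w => heat_amp n s * expR (- (cRe om / (4 * s) * sqnorm w))).
  by apply/funext => w; rewrite /heatk normc_heat.
split.
  split; first exact: cmeasurable_heatk.
  by rewrite nE; exact: rintbleZ.
rewrite nE (rintZ _ j) e heat_ampE// -exprMn; congr (_ ^+ n).
have p0 : 0 < 4 * pi * s by rewrite !mulr_gt0 ?pi_gt0.
have -> : pi / (cRe om / (4 * s)) = (4 * pi * s) / cRe om by field; rewrite !gt_eqF.
rewrite (sqrtrM _ (ltW p0)) mulrA mulVf ?mul1r; last by rewrite gt_eqF// sqrtr_gt0.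
by rewrite sqrtrV// ltW.
Qed.

(** The real heat kernel at time T has the exponent - |w|^2 / (4 T); here 4 T = tau s, that is T = 2
    s Re om. *)
Let tau s : R := 8 * s * cRe om.
Let J s (w : X) : R := (Num.sqrt (tau s * pi))^-1 ^+ n * expR (- ((tau s)^-1 * sqnorm w)).

Let tau0 s : 0 < s -> 0 < tau s.
Proof. by move=> s0; rewrite /tau !mulr_gt0. Qed.

Let jJ s : 0 < s -> rintble mu (J s) /\ \int[mu]_w J s w = 1.
Proof.
move=> s0; have A0 : 0 < (tau s)^-1 by rewrite invr_gt0 tau0.
have [j e] := @sqnorm_gauss_integral R n _ A0.
split; first exact: rintbleZ.
rewrite /J (rintZ _ j) e invrK -exprMn [pi * _]mulrC mulVf ?expr1n//.
by rewrite gt_eqF// sqrtr_gt0 mulr_gt0 ?tau0 ?pi_gt0.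
Qed.

(** In the variable centred at the midpoint of x and x', the exponent is a constant, minus a real
    square and plus an imaginary linear term, so the integral is the Fourier transform of a
    Gaussian. Collecting the terms in (x - x')^2 gives Re om + (Im om)^2 / Re om, which equals 1 /
    Re om since |om| = 1. *)
Let heat1D (s x x' : R) : 0 < s ->
  cintble leb (fun t => heat 1 s ((x - t) ^+ 2) * ((heat 1 s ((x' - t) ^+ 2))^*)%C) /\
  cint leb (fun t => heat 1 s ((x - t) ^+ 2) * ((heat 1 s ((x' - t) ^+ 2))^*)%C) =
  ((Num.sqrt (tau s * pi))^-1 * expR (- ((tau s)^-1 * (x - x') ^+ 2)))%:C%C.
Proof.
move=> s0; pose A := cRe om / (2 * s); pose d := x - x'.
have A0 : 0 < A by rewrite divr_gt0 ?mulr_gt0.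
pose xi := cIm om * d / (2 * s).
pose C := expR (- ln (4 * pi * s) - cRe om * d ^+ 2 / (8 * s)).
have [j e] := cint_gauss_osc A0 xi.
have mf := j.1.
pose m := (x + x') / 2.
have s1 : is_sign (1 : R) by left.
have E t : heat 1 s ((x - t) ^+ 2) * ((heat 1 s ((x' - t) ^+ 2))^*)%C =
    C%:C%C * cexp (Complex (- (A * (- m + 1 * t) ^+ 2)) (xi * (- m + 1 * t))).
  rewrite /heat -cexp_conj -cexpD /C -cexp_real -cexpD; congr cexp.
  by apply: complexP; rewrite /= /A /xi /m /d; field; rewrite gt_eqF.
have pE := fun B mB => @lebesgue_affine R (- m) 1 B s1 mB.
have mh := measurable_affine (- m) 1.
have j' := iffRL (cintble_push (m1 := leb) (m2 := leb) mh pE _ mf) j.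
have e' := cint_push (m1 := leb) (m2 := leb) mh pE _ mf.
under eq_fun do rewrite E.
split; first exact: cintbleZ.
rewrite (cintZ _ j') -e' e -rmorphM; congr (_%:C%C).
have p0 : 0 < 4 * pi * s by rewrite !mulr_gt0 ?pi_gt0.
have -> : C = (4 * pi * s)^-1 * expR (- (cRe om * d ^+ 2 / (8 * s))).
  by rewrite /C expRD expRN lnK.
rewrite mulrACA -expRD; congr (_ * expR _); last first.
  have -> : (tau s)^-1 * (x - x') ^+ 2 = (tau s)^-1 * d ^+ 2 * (cRe om ^+ 2 + cIm om ^+ 2).
    by rewrite om_sqr mulr1.
  rewrite /tau /A /xi; field.
  by rewrite !gt_eqF.
have q0 : Num.sqrt (tau s * pi) != 0 by rewrite gt_eqF// sqrtr_gt0 mulr_gt0 ?tau0 ?pi_gt0.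
apply: (mulIf q0); rewrite mulVf// -[LHS]mulrA -sqrtrM; last first.
  by rewrite divr_ge0 ?pi_ge0 ?(ltW A0).
have -> : pi / A * (tau s * pi) = (4 * pi * s) ^+ 2.
  by rewrite /A /tau; field; rewrite !gt_eqF.
by rewrite sqrtr_sqr gtr0_norm// mulVf// gt_eqF.
Qed.

Lemma heatk_prod s (x y : X) : heatk s (x - y) = \prod_i heat 1 s ((x ord0 i - y ord0 i) ^+ 2).
Proof.
rewrite /heatk /heat -cexp_sum; congr cexp; apply: complexP; rewrite ?cRe_sum ?cIm_sum /=.
- rewrite sumrB sumrN sumr_const card_ord; congr (- _ - _).
    by rewrite -mulr_natl; field.
  rewrite -mulr_sumr -mulr_suml; congr (_ * (_ / _)).
  by apply: eq_bigr => i _; rewrite !mxE.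
- rewrite sumrN -mulr_sumr -mulr_suml; congr (- (_ * (_ / _))).
  by apply: eq_bigr => i _; rewrite !mxE.
Qed.

(* K K^* is the real heat kernel at the real time 2 Re z. *)
Lemma heatk_conv_conj s (x x' : X) : 0 < s ->
  cintble mu (fun y => heatk s (x - y) * ((heatk s (x' - y))^*)%C) /\
  cint mu (fun y => heatk s (x - y) * ((heatk s (x' - y))^*)%C) = (J s (x - x'))%:C%C.
Proof.
move=> s0.
have E y : heatk s (x - y) * ((heatk s (x' - y))^*)%C =
    \prod_i (heat 1 s ((x ord0 i - y ord0 i) ^+ 2) *
      ((heat 1 s ((x' ord0 i - y ord0 i) ^+ 2))^*)%C).
  rewrite big_split !heatk_prod; congr (_ * _).
  exact: (big_morph _ (rmorphM (@conjc R)) (rmorph1 (@conjc R))).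
have := @cint_prod R n (fun i t => heat 1 s ((x ord0 i - t) ^+ 2) *
  ((heat 1 s ((x' ord0 i - t) ^+ 2))^*)%C) (fun i => (heat1D _ _ s0).1).
rewrite (funext E); move=> [j ->]; split => //.
under eq_bigr do rewrite (heat1D _ _ s0).2.
rewrite -rmorph_prod big_split /= prodr_const card_ord /J; congr ((_ * _)%:C%C).
rewrite -expR_sum sumrN -mulr_sumr; congr (expR (- (_ * _))).
by apply: eq_bigr => i _; rewrite !mxE.
Qed.

Lemma amgm2 (x y : R) : x * y <= 2^-1 * (x ^+ 2 + y ^+ 2).
Proof.
rewrite -subr_ge0 (_ : _ - _ = 2^-1 * (x - y) ^+ 2); last by field.
by rewrite mulr_ge0 ?sqr_ge0.
Qed.

(* Weak form of the L2 contraction: the quadratic bound becomes the bilinear one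
   by scaling. *)
Lemma heatk_L2 s (phi psi : X -> R[i]) : 0 < s ->
  cintble mu phi -> cintble mu psi ->
  rintble mu (fun x => normc (phi x) ^+ 2) -> rintble mu (fun x => normc (psi x) ^+ 2) ->
  normc (cint (mu \x mu)%E (fun z => phi z.1 * heatk s (z.1 - z.2) * psi z.2)) <=
  2^-1 * (\int[mu]_x normc (phi x) ^+ 2 + \int[mu]_x normc (psi x) ^+ 2).
Proof.
move=> s0 jphi jpsi j2phi j2psi.
have mphi := jphi.1; have mpsi := jpsi.1.
have [jK eK] := cintble_heatk s0.
have mK := jK.1.
have KM w : normc (heatk s w) <= heat_amp n s by apply: normc_heat_le => //; exact: sqnorm_ge0.
have mKs (x : X) : cmeasurable (fun y : X => heatk s (x - y)).
  by apply: (cmeasurable_comp _ mK); exact: measurable_subr.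
have mKs' (y : X) : cmeasurable (fun x : X => heatk s (x - y)).
  by apply: (cmeasurable_comp _ mK); exact: measurable_sub1.
have mKz : cmeasurable (fun z : X * X => heatk s (z.1 - z.2)).
  by apply: (cmeasurable_comp _ mK); exact: measurable_sub.
have jgen : cintble (mu \x mu)%E (fun z => phi z.1 * heatk s (z.1 - z.2) * psi z.2).
  have [mpp jpp] := cintble_mul jphi jpsi.
  apply: (cintble_le _ (rintbleZ (heat_amp n s) jpp)).
    apply: cmeasurableM; last exact: (cmeasurable_comp _ mpsi).
    by apply: cmeasurableM => //; exact: (cmeasurable_comp _ mphi).
  move=> z; rewrite !Normc.normcM mulrAC mulrC ler_wpM2r ?mulr_ge0 ?normc_ge0//.
pose G y := cint mu (fun x => phi x * heatk s (x - y)).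
have jx y : cintble mu (fun x => phi x * heatk s (x - y)).
  apply: (cintble_le _ (rintbleZ (heat_amp n s) jphi.2)); first exact: cmeasurableM.
  by move=> x; rewrite Normc.normcM mulrC ler_wpM2r ?normc_ge0.
have eG : cint (mu \x mu)%E (fun z => phi z.1 * heatk s (z.1 - z.2) * psi z.2) =
    cint mu (fun y => psi y * G y).
  rewrite -cfubini2//; congr cint; apply/funext => y /=.
  by rewrite -cintZ//; congr cint; apply/funext => x; rewrite mulrC.
have K0 w : 0 <= normc (heatk s w) by exact: normc_ge0.
have jphiK := (int_conv1 jphi.2 jK.2 (fun x => normc_ge0 _) K0).1.
have mphiK : cmeasurable (fun z : X * X => phi z.1 * heatk s (z.1 - z.2)).
  by apply: cmeasurableM => //; exact: (cmeasurable_comp _ mphi).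
have Gb y : normc (G y) <= heat_amp n s * \int[mu]_x normc (phi x).
  apply: (le_trans (normc_cint (jx y))); rewrite -(rintZ _ jphi.2).
  apply: le_rint => [||x]; [exact: (jx y).2|exact: rintbleZ jphi.2|].
  by rewrite Normc.normcM mulrC ler_wpM2r ?normc_ge0.
have jphiK2 : cintble (mu \x mu)%E (fun z => phi z.1 * heatk s (z.1 - z.2)).
  by apply: (cintble_le mphiK jphiK) => z; rewrite Normc.normcM.
have mG : cmeasurable G by exact: (cintble_fubini2 jphiK2).1.
(* Integrated in x, this function gives |G|^2; integrated in y first, it produces the kernel K K^*.
   Equating the two orders expresses the L_2 norm of G through [J]. *)
pose F2 (z : X * X) := ((phi z.1 * heatk s (z.1 - z.2))^*)%C * G z.2.
have jF2 : cintble (mu \x mu)%E F2.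
  apply: (cintble_le _ (rintbleZ (heat_amp n s * \int[mu]_x normc (phi x)) jphiK)).
    by apply: cmeasurableM; [exact: cmeasurable_conj|exact: (cmeasurable_comp _ mG)].
  move=> z; rewrite /F2 Normc.normcM normc_conj Normc.normcM mulrC.
  by rewrite ler_wpM2r ?mulr_ge0 ?normc_ge0.
have G2 y : cint mu (fun x => F2 (x, y)) = (normc (G y) ^+ 2)%:C%C.
  have jc : cintble mu (fun x => ((phi x * heatk s (x - y))^*)%C).
    case: (jx y) => mjx jjx; split; first exact: cmeasurable_conj.
    by under eq_fun do rewrite normc_conj.
  have cG : ((G y)^*)%C = cint mu (fun x => ((phi x * heatk s (x - y))^*)%C).
    by rewrite (cint_conj (jx y)).
  rewrite -mul_conjc cG -(cintZ (G y) jc).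
  by congr cint; apply/funext => x; rewrite /F2 /= mulrC.
have jG2 : rintble mu (fun y => normc (G y) ^+ 2).
  by have := cintble_fubini2 jF2; rewrite (funext G2) => /cintble_Re.
(* For fixed x' the function G is expanded as an integral in x, and the integral in y of the two
   kernels is then [heatk_conv_conj]. *)
have GK x' : cint mu (fun y => F2 (x', y)) =
    cint mu (fun x => ((phi x')^*)%C * (phi x * (J s (x - x'))%:C%C)).
  pose F3 (z : X * X) := phi z.1 * heatk s (z.1 - z.2) * ((heatk s (x' - z.2))^*)%C.
  have jF3 : cintble (mu \x mu)%E F3.
    apply: (cintble_le _ (rintbleZ (heat_amp n s) jphiK)).
      apply: cmeasurableM => //; apply: cmeasurable_conj.
      exact: (cmeasurable_comp _ (mKs x')).
    move=> z; rewrite /F3 Normc.normcM normc_conj Normc.normcM mulrC.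
    by rewrite ler_wpM2r ?mulr_ge0 ?normc_ge0.
  have e3 y : cint mu (fun x => F3 (x, y)) = ((heatk s (x' - y))^*)%C * G y.
    rewrite -(cintZ _ (jx y)); congr cint; apply/funext => x.
    by rewrite /F3 /= mulrC.
  have e4 x : cint mu (fun y => F3 (x, y)) = phi x * (J s (x - x'))%:C%C.
    have [j e] := heatk_conv_conj x x' s0.
    rewrite -e -(cintZ _ j); congr cint; apply/funext => y.
    by rewrite /F3 -mulrA.
  have j4 := cintble_fubini1 jF3.
  have e5 : cint mu (fun x => phi x * (J s (x - x'))%:C%C) =
      cint mu (fun y => ((heatk s (x' - y))^*)%C * G y).
    rewrite -(funext e4) (cfubini1 jF3) -(cfubini2 jF3); congr cint.
    by apply/funext => y; rewrite e3.
  have j5 := cintble_fubini2 jF3.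
  move: j4 j5; rewrite (funext e4) (funext e3) => j4 j5.
  rewrite (cintZ _ j4) e5 -(cintZ _ j5); congr cint; apply/funext => y.
  by rewrite /F2 rmorphM mulrA.
have eG2 : (\int[mu]_y normc (G y) ^+ 2)%:C%C = cint mu (fun x' => cint mu
    (fun x => ((phi x')^*)%C * (phi x * (J s (x - x'))%:C%C))).
  rewrite -cint_real -(funext G2) (cfubini2 jF2) -(cfubini1 jF2); congr cint.
  by apply/funext => x'; rewrite GK.
have [jJs eJ] := jJ s0.
have J0 w : 0 <= J s w by rewrite /J mulr_ge0 ?expR_ge0 ?exprn_ge0 ?invr_ge0 ?sqrtr_ge0.
have phi20 x : 0 <= normc (phi x) ^+ 2 by exact: sqr_ge0.
have [j1 e1] := int_conv1 j2phi jJs phi20 J0.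
have [j2 e2] := int_conv2 j2phi jJs phi20 J0.
(* Schur's test: |phi x'| |phi x| is at most half the sum of the squares, and J is a nonnegative
   kernel of mass 1 in either variable. *)
have G2le : \int[mu]_y normc (G y) ^+ 2 <= \int[mu]_x normc (phi x) ^+ 2.
  pose F z := ((phi z.2)^*)%C * (phi z.1 * (J s (z.1 - z.2))%:C%C).
  have mF : cmeasurable F.
    apply: cmeasurableM.
      by apply: cmeasurable_conj; exact: (cmeasurable_comp _ mphi).
    apply: cmeasurableM; first exact: (cmeasurable_comp _ mphi).
    apply: cmeasurable_real; apply: (measurableT_comp (rintble_measurable jJs)).
    exact: measurable_sub.
  pose D z := 2^-1 * (normc (phi z.1) ^+ 2 * J s (z.1 - z.2) + normc (phi z.2) ^+ 2 * J s (z.1 - z.2)).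
  have jD : rintble (mu \x mu)%E D by apply: rintbleZ; exact: rintbleD.
  have FD z : normc (F z) <= D z.
    rewrite /F /D !Normc.normcM normc_conj normc_real ger0_norm// -mulrDl mulrA.
    rewrite [leRHS]mulrA ler_wpM2r// addrC; exact: amgm2.
  have jF : cintble (mu \x mu)%E F by exact: (cintble_le mF jD).
  have -> : \int[mu]_y normc (G y) ^+ 2 = normc (cint (mu \x mu)%E F).
    rewrite -(cfubini2 jF) -eG2 normc_real ger0_norm// Rintegral_ge0// => y _; exact: sqr_ge0.
  apply: (le_trans (normc_cint jF)); apply: (le_trans (le_rint jF.2 jD FD)).
  rewrite /D rintZ; last exact: rintbleD.
  by rewrite rintD// e1 e2 eJ mulr1 mulrC mulrDl -splitr.
have jpG : cintble mu (fun y => psi y * G y).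
  have := cintble_fubini2 jgen.
  rewrite (_ : (fun y => _) = (fun y => psi y * G y))//.
  apply/funext => y /=; rewrite -cintZ//; congr cint; apply/funext => x; exact: mulrC.
rewrite eG; apply: (le_trans (normc_cint jpG)).
have jsum : rintble mu (fun y => 2^-1 * (normc (G y) ^+ 2 + normc (psi y) ^+ 2)).
  by apply: rintbleZ; exact: rintbleD.
apply: (le_trans (le_rint jpG.2 jsum _)).
  by move=> y; rewrite Normc.normcM addrC; exact: amgm2.
rewrite rintZ; last exact: rintbleD.
by rewrite rintD// ler_wpM2l// lerD2r.
Qed.

(** The square of the modulus is a double integral of K K^*, hence the mass 1 of [J]. The integral
    itself is a root om^(-n/2), which never has to be determined. *)
Lemma normc_cint_heatk s : 0 < s -> normc (cint mu (heatk s)) = 1.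
Proof.
move=> s0; have [jK eK] := cintble_heatk s0; have mK := jK.1.
have K0 w : 0 <= normc (heatk s w) by exact: normc_ge0.
set kap := cint mu (heatk s).
suff : kap * (kap^*)%C = 1.
  rewrite mul_conjc => /complexI /eqP; rewrite sqrf_eq1 => /orP[/eqP //|/eqP h].
  by have := normc_ge0 kap; rewrite h; lra.
pose f (y : X) := heatk s (0 - y).
have jf : cintble mu f.
  by apply: (iffRL (cintble_push (m1 := mu) (m2 := mu) (measurable_subr 0) (push_subr 0) _ mK)).
have ef : cint mu f = kap.
  by rewrite /kap (cint_push (m1 := mu) (m2 := mu) (measurable_subr 0) (push_subr 0) _ mK).
pose F z := ((heatk s (z.1 - z.2))^*)%C * f z.2.
have jF : cintble (mu \x mu)%E F.
  have [j _] := int_conv2 jf.2 jK.2 (fun x => normc_ge0 _) K0.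
  apply: (cintble_le _ j) => [|z]; last by rewrite Normc.normcM normc_conj mulrC.
  apply: cmeasurableM; last exact: (cmeasurable_comp _ jf.1).
  by apply: cmeasurable_conj; apply: (cmeasurable_comp _ mK); exact: measurable_sub.
have jc y : cintble mu (fun x => ((heatk s (x - y))^*)%C) /\
    cint mu (fun x => ((heatk s (x - y))^*)%C) = (kap^*)%C.
  have j := iffRL (cintble_push (m1 := mu) (m2 := mu) (measurable_sub1 y) (push_subl y) _ mK) jK.
  split; last first.
    rewrite (cint_conj j); congr conjc.
    by rewrite -(cint_push (m1 := mu) (m2 := mu) (measurable_sub1 y) (push_subl y) _ mK).
  case: j => mj jj; split; first exact: cmeasurable_conj.
  by under eq_fun do rewrite normc_conj.
have e1 : cint (mu \x mu)%E F = kap * (kap^*)%C.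
  rewrite -(cfubini2 jF) mulrC -{2}ef -(cintZ _ jf); congr cint; apply/funext => y.
  rewrite -(jc y).2 mulrC -(cintZ _ (jc y).1); congr cint; apply/funext => x.
  by rewrite /F mulrC.
have [jJs eJ] := jJ s0.
rewrite -e1 -(cfubini1 jF).
have E x : cint mu (fun y => F (x, y)) = (J s (0 - x))%:C%C.
  have [_ <-] := heatk_conv_conj 0 x s0.
  by congr cint; apply/funext => y; rewrite /F /f mulrC.
under [X in cint mu X]eq_fun do rewrite E.
rewrite cint_real -(rint_push (m1 := mu) (m2 := mu) (measurable_subr 0) (push_subr 0) _
  (rintble_measurable jJs)).
by rewrite eJ.
Qed.

End heat_kernel.

(** * Interpolation for the heat form *)

Lemma cvg0_ge {R : realType} (u : nat -> R) (l : R) :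
  u @ \oo --> 0 -> (forall k, l <= u k) -> l <= 0.
Proof.
move=> u0 lu; rewrite -(cvg_lim (@Rhausdorff R) u0); apply: limr_ge; last exact: nearW.
by apply/cvg_ex; exists 0.
Qed.

Section partition_functions.
Context {R : realType} (n : nat).
Local Notation mu := (@lebesgue_Rn R n).
Local Notation X := ('rV[R]_n).

Lemma rintble_sum d (T : measurableType d) (m : {measure set T -> \bar R}) (I : Type)
    (s : seq I) (F : I -> T -> R) :
  (forall i, rintble m (F i)) -> rintble m (fun x => \sum_(i <- s) F i x) /\
  \int[m]_x (\sum_(i <- s) F i x) = \sum_(i <- s) \int[m]_x F i x.
Proof.
move=> jF; elim: s => [|i s [ih1 ih2]].
  under eq_fun do rewrite big_nil.
  by rewrite big_nil; split; [exact: integrable0|rewrite /Rintegral integral0].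
under eq_fun do rewrite big_cons.
by rewrite big_cons rintD// ih2; split => //; exact: rintbleD.
Qed.

Lemma oapp_sum (S : nzRingType) (I : finType) (al : I -> S) (o : option I) :
  oapp al 0 o = \sum_i al i * (o == Some i)%:R.
Proof.
case: o => [j|] /=; last by rewrite big1// => i _; rewrite mulr0.
rewrite (bigD1 j)//= eqxx mulr1 big1 ?addr0// => i ij.
by rewrite (inj_eq Some_inj) eq_sym (negbTE ij) mulr0.
Qed.

(* A partial partition of R^n into cells of finite measure, encoded by the
   cell-index function. *)
Definition cells (I : finType) (c : X -> option I) :=
  forall i, measurable [set x | c x = Some i] /\ (mu [set x | c x = Some i] < +oo)%E.

Definition cell_mass (I : finType) (c : X -> option I) i : R := fine (mu [set x | c x = Some i]).

Lemma cell_mass_ge0 (I : finType) (c : X -> option I) i : 0 <= cell_mass c i.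
Proof. exact: fine_ge0. Qed.

Section one_partition.
Variables (I : finType) (c : X -> option I).
Hypothesis hc : cells c.

Lemma cell_int i : rintble mu (fun x => (c x == Some i)%:R) /\
  \int[mu]_x (c x == Some i)%:R = cell_mass c i.
Proof.
have [mA fA] := hc i; set A := [set x | c x = Some i] in mA fA.
have E : (fun x => (c x == Some i)%:R) = (\1_A : X -> R).
  apply/funext => x; rewrite indicE; congr (nat_of_bool _)%:R.
  by apply/eqP/idP => [h|]; rewrite inE.
rewrite E; split.
  by apply: rintbleP => //; rewrite integral_indic ?setIT.
by rewrite /Rintegral integral_indic ?setIT.
Qed.

Lemma cell_sum_int (al : I -> R) : rintble mu (fun x => oapp al 0 (c x)) /\
  \int[mu]_x oapp al 0 (c x) = \sum_i al i * cell_mass c i.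
Proof.
under eq_fun do rewrite oapp_sum.
have j i : rintble mu (fun x => al i * (c x == Some i)%:R).
  by apply: rintbleZ; exact: (cell_int i).1.
have [j' ->] := rintble_sum (index_enum I) j; split => //.
by apply: eq_bigr => i _; rewrite rintZ; [rewrite (cell_int i).2|exact: (cell_int i).1].
Qed.

Lemma cmeasurable_cell_sum (al : I -> R[i]) : cmeasurable (fun x => oapp al 0 (c x)).
Proof.
have e1 : (fun x => cRe (oapp al 0 (c x))) = (fun x => oapp (fun i => cRe (al i)) 0 (c x)).
  by apply/funext => x; case: (c x).
have e2 : (fun x => cIm (oapp al 0 (c x))) = (fun x => oapp (fun i => cIm (al i)) 0 (c x)).
  by apply/funext => x; case: (c x).
by split; rewrite /comp ?e1 ?e2; apply: rintble_measurable; exact: (cell_sum_int _).1.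
Qed.

Variables (th : X -> R[i]) (mth : cmeasurable th) (th1 : forall x, normc (th x) <= 1).

(** A step function times a factor of modulus at most 1. The phase of the function to be
    approximated is kept exactly in th, so that only its modulus has to be discretized. *)
Definition cell_fun (al : I -> R[i]) x := oapp al 0 (c x) * th x.

Lemma normc_cell_fun al x : normc (cell_fun al x) <= oapp (fun i => normc (al i)) 0 (c x).
Proof.
rewrite /cell_fun Normc.normcM; case: (c x) => [i|]; rewrite ![oapp _ _ _]/=.
  by rewrite ler_piMr ?normc_ge0.
by rewrite Normc.normc0 mul0r.
Qed.

Lemma cintble_cell_fun al : cintble mu (cell_fun al).
Proof.
apply: (cintble_le _ (cell_sum_int (fun i => normc (al i))).1).
  by apply: cmeasurableM => //; exact: cmeasurable_cell_sum.
exact: normc_cell_fun.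
Qed.

Lemma cell_fun_L2 al : rintble mu (fun x => normc (cell_fun al x) ^+ 2) /\
  \int[mu]_x normc (cell_fun al x) ^+ 2 <= \sum_i normc (al i) ^+ 2 * cell_mass c i.
Proof.
have [j e] := cell_sum_int (fun i => normc (al i) ^+ 2).
have le x : normc (cell_fun al x) ^+ 2 <= oapp (fun i => normc (al i) ^+ 2) 0 (c x).
  apply: le_trans (_ : (oapp (fun i => normc (al i)) 0 (c x)) ^+ 2 <= _).
    by rewrite lerXn2r ?nnegrE ?normc_ge0 ?normc_cell_fun//; case: (c x) => //= i; exact: normc_ge0.
  by case: (c x) => [i|] //=; rewrite expr0n.
have j2 : rintble mu (fun x => normc (cell_fun al x) ^+ 2).
  apply: (rintble_le _ j) => [|x]; last by rewrite ger0_norm ?sqr_ge0.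
  by apply: measurable_funX; apply: cmeasurable_normc; exact: (cintble_cell_fun al).1.
by split => //; rewrite -e; exact: le_rint.
Qed.

End one_partition.
End partition_functions.

Section heat_interpolation.
Context {R : realType} (n : nat) (om : R[i]).
Hypotheses (om1 : normc om = 1) (om0 : 0 < cRe om).
Local Notation mu := (@lebesgue_Rn R n).
Local Notation X := ('rV[R]_n).
Variables (s : R) (s0 : 0 < s).
Local Notation K := (@heatk R n om s).
Let M := heat_amp n s.

Definition heat_form (phi psi : X -> R[i]) : R[i] :=
  cint (mu \x mu)%E (fun z => phi z.1 * K (z.1 - z.2) * psi z.2).

Lemma cintble_heat_form phi psi : cintble mu phi -> cintble mu psi ->
  cintble (mu \x mu)%E (fun z => phi z.1 * K (z.1 - z.2) * psi z.2).
Proof.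
move=> jphi jpsi; have [mpp jpp] := cintble_mul jphi jpsi.
have [jK _] := cintble_heatk n om0 s0.
apply: (cintble_le _ (rintbleZ M jpp)).
  apply: cmeasurableM; last exact: (cmeasurable_comp _ jpsi.1).
  apply: cmeasurableM; first exact: (cmeasurable_comp _ jphi.1).
  by apply: (cmeasurable_comp _ jK.1); exact: measurable_sub.
move=> z; rewrite !Normc.normcM mulrAC mulrC ler_wpM2r ?mulr_ge0 ?normc_ge0//.
by apply: normc_heat_le => //; exact: sqnorm_ge0.
Qed.

Section two_partitions.
Variables (I J : finType) (c : X -> option I) (c' : X -> option J).
Hypotheses (hc : cells c) (hc' : cells c').
Variables (th th' : X -> R[i]).
Hypotheses (mth : cmeasurable th) (th1 : forall x, normc (th x) <= 1).
Hypotheses (mth' : cmeasurable th') (th1' : forall x, normc (th' x) <= 1).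

Let f := cell_fun c th.
Let f' := cell_fun c' th'.
Let e i : X -> R[i] := cell_fun c th (fun k => (k == i)%:R).
Let e' j : X -> R[i] := cell_fun c' th' (fun k => (k == j)%:R).
Let N i j := heat_form (e i) (e' j).

Lemma heat_form_cells al be : heat_form (f al) (f' be) = \sum_i \sum_j al i * be j * N i j.
Proof.
have E (I0 : finType) (c0 : X -> option I0) t a x :
    cell_fun c0 t a x = \sum_i a i * cell_fun c0 t (fun k => (k == i)%:R) x.
  rewrite /cell_fun oapp_sum mulr_suml; apply: eq_bigr => i _.
  rewrite -mulrA; congr (_ * (_ * _)); case: (c0 x) => [k|] //=.
have je i := cintble_cell_fun hc mth th1 (fun k => (k == i)%:R).
have je' j := cintble_cell_fun hc' mth' th1' (fun k => (k == j)%:R).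
have jN i j := cintble_heat_form (je i) (je' j).
have jj i j := cintbleZ (al i * be j) (jN i j).
transitivity (cint (mu \x mu)%E (fun z => \sum_i \sum_j
    (al i * be j) * (e i z.1 * K (z.1 - z.2) * e' j z.2))).
  congr cint; apply/funext => z; rewrite /f /f' [X in X * _ * _]E [X in _ * X]E.
  rewrite -mulrA mulr_suml; apply: eq_bigr => i _; rewrite mulr_sumr mulr_sumr.
  by apply: eq_bigr => j _; rewrite /e /e'; ring.
rewrite cint_sum; last by move=> i; apply: cintble_sum => j; exact: jj.
apply: eq_bigr => i _; rewrite cint_sum; last by move=> j; exact: jj.
by apply: eq_bigr => j _; rewrite (cintZ _ (jN i j)).
Qed.

Let w i := Num.sqrt (cell_mass c i).
Let w' j := Num.sqrt (cell_mass c' j).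

Let w2 i : w i ^+ 2 = cell_mass c i.
Proof. by rewrite sqr_sqrtr ?cell_mass_ge0. Qed.

Let w2' j : w' j ^+ 2 = cell_mass c' j.
Proof. by rewrite sqr_sqrtr ?cell_mass_ge0. Qed.

Let N_le i j : normc (N i j) <= M * cell_mass c i * cell_mass c' j.
Proof.
have je := cintble_cell_fun hc mth th1 (fun k => (k == i)%:R).
have je' := cintble_cell_fun hc' mth' th1' (fun k => (k == j)%:R).
have jN := cintble_heat_form je je'.
apply: (le_trans (normc_cint jN)).
have [j1 i1] := cell_int hc i; have [j2 i2] := cell_int hc' j.
have jc1 : cintble mu (fun x => ((c x == Some i)%:R)%:C%C).
  apply: (cintble_le _ j1) => [|x]; first by apply: cmeasurable_real; exact: rintble_measurable j1.
  by rewrite normc_real ger0_norm.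
have jc2 : cintble mu (fun x => ((c' x == Some j)%:R)%:C%C).
  apply: (cintble_le _ j2) => [|x]; first by apply: cmeasurable_real; exact: rintble_measurable j2.
  by rewrite normc_real ger0_norm.
have jp : rintble (mu \x mu)%E (fun z => (c z.1 == Some i)%:R * (c' z.2 == Some j)%:R).
  have := cintble_Re (cintble_mul jc1 jc2); congr (rintble _ _).
  by apply/funext => z; rewrite -rmorphM.
have ep : \int[(mu \x mu)%E]_z ((c z.1 == Some i)%:R * (c' z.2 == Some j)%:R) =
    cell_mass c i * cell_mass c' j.
  suff : (\int[(mu \x mu)%E]_z ((c z.1 == Some i)%:R * (c' z.2 == Some j)%:R))%:C%C =
      (cell_mass c i * cell_mass c' j)%:C%C by case.
  have -> : (cell_mass c i * cell_mass c' j)%:C%C = (cell_mass c i)%:C%C * (cell_mass c' j)%:C%C.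
    exact: rmorphM.
  rewrite -i1 -i2 -(cint_real mu (fun x => (c x == Some i)%:R)).
  rewrite -(cint_real mu (fun x => (c' x == Some j)%:R)) -(cint_mul jc1 jc2) -(cint_real (mu \x mu)%E).
  by congr cint; apply/funext => z; rewrite rmorphM.
rewrite -mulrA -ep -(rintZ _ jp); apply: le_rint => [||z].
- exact: jN.2.
- exact: rintbleZ.
have ind (I0 : finType) (c0 : X -> option I0) t k x : (forall x, normc (t x) <= 1) ->
    normc (cell_fun c0 t (fun l => (l == k)%:R) x) <= (c0 x == Some k)%:R.
  move=> t1; apply: le_trans (normc_cell_fun _ t1 _ _) _.
  case: (c0 x) => [l|]; rewrite ![oapp _ _ _]/=; last exact: ler0n.
  rewrite (inj_eq Some_inj).
  by case: (l == k); rewrite ?Normc.normc1 ?Normc.normc0.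
rewrite Normc.normcM (Normc.normcM _ (K _)) mulrAC mulrC ler_pM ?mulr_ge0 ?normc_ge0//.
  by apply: normc_heat_le => //; exact: sqnorm_ge0.
by apply: ler_pM (ind _ _ _ _ _ th1) (ind _ _ _ _ _ th1'); exact: normc_ge0.
Qed.

(** The matrix of the form in the normalized indicators, each divided by the square root of the mass
    of its cell. For a null cell the inverse is 0, and [mE] still recovers N because N vanishes
    there by [N_le]. *)
Let m i j : R[i] := ((w i)^-1)%:C%C * ((w' j)^-1)%:C%C * N i j.

Let mE i j : (w i)%:C%C * (w' j)%:C%C * m i j = N i j.
Proof.
have N0 : w i * w' j = 0 -> N i j = 0.
  move=> /eqP; rewrite mulf_eq0 => h; apply: normc_eq0; apply/eqP; rewrite eq_le normc_ge0 andbT.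
  rewrite (le_trans (N_le i j))// -w2 -w2'.
  by case/orP: h => /eqP ->; rewrite expr0n ?mulr0 ?mul0r.
have [/N0 h|h] := eqVneq (w i * w' j) 0; first by rewrite /m h !mulr0.
rewrite /m !fmorphV -invfM mulrA divff ?mul1r// -rmorphM.
by apply: contra h => /eqP [->].
Qed.

Let m_le i j : normc (m i j) <= M * w i * w' j.
Proof.
have M0 : 0 <= M by exact: heat_amp_ge0.
rewrite /m !Normc.normcM !normc_real !ger0_norm ?invr_ge0 ?sqrtr_ge0//.
have inv_le (x : R) : 0 <= x -> x^-1 * x ^+ 2 <= x.
  move=> x0; have [->|xn] := eqVneq x 0; first by rewrite expr0n mulr0.
  by rewrite expr2 mulrA mulVf// mul1r.
apply: le_trans (_ : (w i)^-1 * (w' j)^-1 * (M * w i ^+ 2 * w' j ^+ 2) <= _).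
  by rewrite ler_wpM2l ?mulr_ge0 ?invr_ge0 ?sqrtr_ge0// w2 w2' N_le.
have -> : (w i)^-1 * (w' j)^-1 * (M * w i ^+ 2 * w' j ^+ 2) =
    M * ((w i)^-1 * w i ^+ 2) * ((w' j)^-1 * w' j ^+ 2).
  by move: (w i)^-1 (w' j)^-1 => a b; ring.
by rewrite !ler_pM ?mulr_ge0 ?invr_ge0 ?sqr_ge0 ?sqrtr_ge0 ?inv_le ?sqrtr_ge0.
Qed.

(** With y the conjugate of the image of x, the squared norm Q of the image is itself a value of the
    heat form. Then [heatk_L2] reads Q <= (|x|^2 + Q) / 2, that is Q <= |x|^2. *)
Let m_contraction : contraction m.
Proof.
move=> x; pose y j := ((\sum_i m i j * x i)^*)%C.
pose al i := ((w i)^-1)%:C%C * x i; pose be j := ((w' j)^-1)%:C%C * y j.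
set Q := \sum_j _.
have eQ : heat_form (f al) (f' be) = Q%:C%C.
  rewrite heat_form_cells exchange_big /Q rmorph_sum; apply: eq_bigr => j _ /=.
  rewrite -mul_conjc -/(y j) mulr_suml; apply: eq_bigr => i _.
  by rewrite /al /be /m; ring.
have je := cintble_cell_fun hc mth th1 al.
have je' := cintble_cell_fun hc' mth' th1' be.
have [j2 l2] := cell_fun_L2 hc mth th1 al.
have [j2' l2'] := cell_fun_L2 hc' mth' th1' be.
have inv_le (a b : R) : 0 <= a -> ((a^-1) * b) ^+ 2 * a ^+ 2 <= b ^+ 2.
  move=> a0; have [->|an] := eqVneq a 0; first by rewrite expr0n mulr0 sqr_ge0.
  by rewrite -exprMn mulrAC mulVf// mul1r.
have b1 : \int[mu]_x normc (f al x) ^+ 2 <= \sum_i normc (x i) ^+ 2.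
  apply: (le_trans l2); apply: ler_sum => i _; rewrite Normc.normcM normc_real -w2.
  by rewrite ger0_norm ?invr_ge0 ?sqrtr_ge0// inv_le ?sqrtr_ge0.
have b2 : \int[mu]_x normc (f' be x) ^+ 2 <= Q.
  apply: (le_trans l2'); apply: ler_sum => j _; rewrite Normc.normcM normc_real -w2'.
  by rewrite ger0_norm ?invr_ge0 ?sqrtr_ge0// normc_conj inv_le ?sqrtr_ge0.
have := heatk_L2 om1 om0 s0 je je' j2 j2'.
rewrite -/(heat_form _ _) eQ normc_real => h.
have := le_trans (ler_norm Q) h.
lra.
Qed.

Lemma heat_form_cells_le (t : R) (v : I -> R) (v' : J -> R) : 2^-1 <= t <= 1 ->
  (forall i, 0 <= v i) -> (forall j, 0 <= v' j) ->
  normc (heat_form (f (fun i => (v i)%:C%C)) (f' (fun j => (v' j)%:C%C))) <=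
  M `^ (2 * t - 1) * (\sum_i cell_mass c i * v i `^ t^-1) `^ t *
    (\sum_j cell_mass c' j * v' j `^ t^-1) `^ t.
Proof.
move=> ht v0 v0'.
have := @riesz_interpolation R I J m M t w v w' v' m_contraction.
rewrite heat_form_cells => /(_ (heat_amp_ge0 n s)).
have -> : \sum_i w i ^+ 2 * v i `^ t^-1 = \sum_i cell_mass c i * v i `^ t^-1.
  by apply: eq_bigr => i _; rewrite w2.
have -> : \sum_j w' j ^+ 2 * v' j `^ t^-1 = \sum_j cell_mass c' j * v' j `^ t^-1.
  by apply: eq_bigr => j _; rewrite w2'.
move=> h; rewrite (_ : \sum_i _ = \sum_i \sum_j m i j * (w i * v i)%:C%C * (w' j * v' j)%:C%C).
  by apply: h => //; move=> *; exact: sqrtr_ge0.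
apply: eq_bigr => i _; apply: eq_bigr => j _.
by rewrite -mE !rmorphM /=; ring.
Qed.

End two_partitions.

(** Cell j is where v lies between (j + 1)/(k + 1) and (j + 2)/(k + 1), the lower end included.
    Values below 1/(k + 1) are left out, which keeps the cells of finite measure, and very large
    values are left out, which keeps the cells finite in number. *)
Definition dyadic_cell (v : X -> R) k x : option 'I_(k.+1 ^ 2) :=
  if Num.truncn (v x * k.+1%:R) is j.+1 then insub j else None.

Definition dyadic_val k (i : 'I_(k.+1 ^ 2)) : R := i.+1%:R / k.+1%:R.

Lemma dyadic_val_ge0 k (i : 'I_(k.+1 ^ 2)) : 0 <= dyadic_val i.
Proof. by rewrite /dyadic_val divr_ge0. Qed.

Section dyadic_approximation.
Variables (v : X -> R) (q : R).
Hypotheses (v0 : forall x, 0 <= v x) (mv : measurable_fun setT v) (q0 : 0 < q).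
Hypothesis jq : rintble mu (fun x => v x `^ q).

Let app k x := oapp (@dyadic_val k) 0 (dyadic_cell v k x).

Lemma dyadic_cellP k x i : dyadic_cell v k x = Some i <->
  i.+1%:R <= v x * k.+1%:R < i.+2%:R.
Proof.
have vk : 0 <= v x * k.+1%:R by rewrite mulr_ge0.
rewrite /dyadic_cell; have /andP[h1 h2] := truncn_itv vk.
split.
  case: (Num.truncn _) h1 h2 => // j h1 h2.
  by case: insubP => // u _ uj [<-]; rewrite [nat_of_ord u]uj h1.
move=> /andP[g1 g2].
have -> : Num.truncn (v x * k.+1%:R) = i.+1 by apply: truncn_def; rewrite g1.
by rewrite valK.
Qed.

Lemma dyadic_le k x : 0 <= app k x <= v x.
Proof.
rewrite /app; case E : (dyadic_cell v k x) => [i|] /=; last by rewrite lexx v0.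
have /dyadic_cellP/andP[h _] := E.
by rewrite dyadic_val_ge0/= /dyadic_val ler_pdivrMr.
Qed.

Lemma dyadic_ge k x : v x <= k%:R -> v x - app k x <= k.+1%:R^-1.
Proof.
move=> vk; have vk0 : 0 <= v x * k.+1%:R by rewrite mulr_ge0.
rewrite /app; case E : (dyadic_cell v k x) => [i|] /=.
  have /dyadic_cellP/andP[_ h] := E.
  rewrite lerBlDr /dyadic_val -{1}[_^-1]mul1r -mulrDl ler_pdivlMr//.
  by rewrite nat1r ltW.
rewrite subr0; move: E; rewrite /dyadic_cell.
have /andP[h1 h2] := truncn_itv vk0.
case: (Num.truncn _) h1 h2 => [_ h2 _|j h1 h2].
  by rewrite -[leRHS]mul1r ler_pdivlMr// ltW.
case: insubP => // /negP; case.
rewrite -(ltr_nat R); apply: lt_le_trans (_ : v x * k.+1%:R <= _).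
  by apply: lt_le_trans h1; rewrite ltr_nat.
by rewrite natrX expr2 ler_wpM2r// (le_trans vk)// ler_nat.
Qed.

(** Finiteness is Chebyshev's inequality: on a cell v is at least the positive number
    [dyadic_val i]. *)
Lemma cells_dyadic k : cells (dyadic_cell v k).
Proof.
move=> i; set E := [set x | _].
have mE : measurable E.
  rewrite -[E]setTI (_ : E = v @^-1` `[i.+1%:R / k.+1%:R, i.+2%:R / k.+1%:R[%classic); first exact: mv.
  apply/seteqP; split=> x.
    by move=> /dyadic_cellP /andP[h1 h2]; rewrite /= in_itv/= ler_pdivrMr// ltr_pdivlMr// h1.
  by rewrite /= in_itv/= ler_pdivrMr// ltr_pdivlMr// => h; apply/dyadic_cellP.
split => //; set c : R := dyadic_val i.
have c0 : 0 < c `^ q by rewrite powR_gt0// divr_gt0.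
have -> : mu E = (\int[mu]_x (\1_E x : R)%:E)%E by rewrite integral_indic ?setIT.
have j := rintbleZ (c `^ q)^-1 jq.
apply: le_lt_trans (rintble_ltey j _); last by move=> x; rewrite mulr_ge0 ?invr_ge0 ?powR_ge0.
apply: ge0_le_int => [|||x].
- exact: measurable_indic.
- exact: rintble_measurable j.
- by move=> x; rewrite indicE.
rewrite indicE; case: (boolP (x \in E)) => [|_]; last by rewrite mulr_ge0 ?invr_ge0 ?powR_ge0.
rewrite inE => /dyadic_cellP /andP[h _].
rewrite mulrC ler_pdivlMr// mul1r ge0_ler_powR ?nnegrE ?v0 ?(ltW q0) ?dyadic_val_ge0//.
by rewrite /c /dyadic_val ler_pdivrMr.
Qed.

Lemma dyadic_norm k :
  \sum_i cell_mass (dyadic_cell v k) i * dyadic_val i `^ q <= \int[mu]_x v x `^ q.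
Proof.
have [j e] := cell_sum_int (@cells_dyadic k) (fun i => dyadic_val i `^ q).
under eq_bigr do rewrite mulrC.
rewrite -e; apply: le_rint => // x.
have := dyadic_le k x; rewrite /app; case: (dyadic_cell v k x) => [i|] /=; last by rewrite powR_ge0.
by move=> /andP[a0 av]; rewrite ge0_ler_powR ?nnegrE ?v0 ?(ltW q0).
Qed.

Lemma measurable_dyadic k : measurable_fun setT (app k).
Proof. exact: rintble_measurable (cell_sum_int (@cells_dyadic k) _).1. Qed.

End dyadic_approximation.

(* Riesz-Thorin between the trivial L1-Linfty bound and the L2 contraction. *)
Lemma heat_form_le (t : R) (phi psi : X -> R[i]) : 2^-1 <= t <= 1 ->
  cmeasurable phi -> cmeasurable psi ->
  rintble mu (fun x => normc (phi x) `^ t^-1) ->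
  rintble mu (fun x => normc (psi x) `^ t^-1) ->
  cintble (mu \x mu)%E (fun z => phi z.1 * K (z.1 - z.2) * psi z.2) ->
  normc (heat_form phi psi) <= M `^ (2 * t - 1) *
    (\int[mu]_x normc (phi x) `^ t^-1) `^ t * (\int[mu]_x normc (psi x) `^ t^-1) `^ t.
Proof.
move=> ht mphi mpsi jphi jpsi jF; have /andP[t12 t1] := ht.
have t0 : 0 < t by rewrite (lt_le_trans _ t12).
have ti0 : 0 < t^-1 by rewrite invr_gt0.
pose v x := normc (phi x); pose w x := normc (psi x).
have v0 x : 0 <= v x by exact: normc_ge0.
have w0 x : 0 <= w x by exact: normc_ge0.
have mv : measurable_fun setT v by exact: cmeasurable_normc.
have mw : measurable_fun setT w by exact: cmeasurable_normc.
have mth := cmeasurable_phase mphi; have mth' := cmeasurable_phase mpsi.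
have th1 x := phase_le1 (phi x); have th1' x := phase_le1 (psi x).
pose vk k x := oapp (@dyadic_val k) 0 (dyadic_cell v k x).
pose wk k x := oapp (@dyadic_val k) 0 (dyadic_cell w k x).
have vkP k x : 0 <= vk k x <= v x by exact: dyadic_le.
have wkP k x : 0 <= wk k x <= w x by exact: dyadic_le.
have cv k := cells_dyadic (k := k) v0 mv ti0 jphi; have cw k := cells_dyadic (k := k) w0 mw ti0 jpsi.
pose fk k := cell_fun (dyadic_cell v k) (fun x => phase (phi x)) (fun i => (dyadic_val i)%:C%C).
pose gk k := cell_fun (dyadic_cell w k) (fun x => phase (psi x)) (fun i => (dyadic_val i)%:C%C).
have fkE k x : fk k x = (vk k x)%:C%C * phase (phi x).
  by rewrite /fk /cell_fun /vk; case: (dyadic_cell v k x).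
have gkE k x : gk k x = (wk k x)%:C%C * phase (psi x).
  by rewrite /gk /cell_fun /wk; case: (dyadic_cell w k x).
set B := _ * _ * _.
have bk k : normc (heat_form (fk k) (gk k)) <= B.
  apply: (le_trans (heat_form_cells_le (cv k) (cw k) mth th1 mth' th1' ht
    (@dyadic_val_ge0 k) (@dyadic_val_ge0 k))).
  have sum0 (u : X -> R) : 0 <= \sum_i cell_mass (dyadic_cell u k) i * dyadic_val i `^ t^-1.
    by apply: sumr_ge0 => i _; rewrite mulr_ge0 ?cell_mass_ge0 ?powR_ge0.
  have int0 (u : X -> R[i]) : 0 <= \int[mu]_x normc (u x) `^ t^-1.
    by apply: Rintegral_ge0 => x _; exact: powR_ge0.
  rewrite /B ler_pM ?mulr_ge0 ?powR_ge0//.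
    rewrite ler_wpM2l ?powR_ge0// ge0_ler_powR ?nnegrE ?(ltW t0)//.
    exact: dyadic_norm.
  rewrite ge0_ler_powR ?nnegrE ?(ltW t0)//; exact: dyadic_norm.
have [jK _] := cintble_heatk n om0 s0.
(* The step functions carry the phases of phi and psi and have smaller moduli. So D bounds the
   modulus of the difference of the integrands, and it is dominated by |K| v w, which is integrable
   by [jF]. *)
pose D k (z : X * X) := normc (K (z.1 - z.2)) * (v z.1 * w z.2 - vk k z.1 * wk k z.2).
have jD0 : rintble (mu \x mu)%E (fun z => normc (K (z.1 - z.2)) * (v z.1 * w z.2)).
  have := jF.2; congr (rintble _ _); apply/funext => z.
  by rewrite !Normc.normcM -/(v _) -/(w _) mulrAC mulrC.
have D0 k z : 0 <= D k z <= normc (K (z.1 - z.2)) * (v z.1 * w z.2).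
  have /andP[a0 av] := vkP k z.1; have /andP[b0 bw] := wkP k z.2.
  apply/andP; split; first by rewrite mulr_ge0 ?normc_ge0// subr_ge0 ler_pM.
  by rewrite ler_wpM2l ?normc_ge0// gerBl mulr_ge0.
have mKz : measurable_fun setT (fun z : X * X => normc (K (z.1 - z.2))).
  by apply: cmeasurable_normc; apply: (cmeasurable_comp _ jK.1); exact: measurable_sub.
have mvk k : measurable_fun setT (vk k) by exact: measurable_dyadic v0 mv ti0 jphi k.
have mwk k : measurable_fun setT (wk k) by exact: measurable_dyadic w0 mw ti0 jpsi k.
have mD k : measurable_fun setT (D k).
  apply: measurable_funM => //; apply: measurable_funB; apply: measurable_funM.
  - exact: (measurableT_comp mv).
  - exact: (measurableT_comp mw).
  - exact: (measurableT_comp (mvk k)).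
  - exact: (measurableT_comp (mwk k)).
have Dcvg : (fun k => \int[(mu \x mu)%E]_z D k z) @ \oo --> 0.
  apply: (rint_cvg0 mD jD0) => [k z|z].
    by have /andP[d0 d1] := D0 k z; rewrite ger0_norm.
  (* Once k exceeds both values, v - vk and w - wk are at most 1/(k + 1), and v w - vk wk = v (w -
     wk) + (v - vk) wk is at most (v + w)/(k + 1). *)
  pose c := normc (K (z.1 - z.2)) * (v z.1 + w z.2).
  apply: (@squeeze_cvgr _ _ _ _ (fun=> 0) (fun k => c * harmonic k)).
  - near=> k; have /andP[-> _] := D0 k z; rewrite andTb.
    have vz : v z.1 <= k%:R by near: k; exact: nbhs_infty_ger.
    have wz : w z.2 <= k%:R by near: k; exact: nbhs_infty_ger.
    have hv := dyadic_ge v0 vz; have hw := dyadic_ge w0 wz.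
    have /andP[a0 av] := vkP k z.1; have /andP[b0 bw] := wkP k z.2.
    rewrite /D /c -mulrA ler_wpM2l ?normc_ge0//.
    have -> : v z.1 * w z.2 - vk k z.1 * wk k z.2 =
      v z.1 * (w z.2 - wk k z.2) + (v z.1 - vk k z.1) * wk k z.2 by ring.
    rewrite [leRHS]mulrDl; apply: lerD; first by rewrite ler_wpM2l.
    by rewrite mulrC ler_pM// subr_ge0.
  - exact: cvg_cst.
  - rewrite -[X in _ --> X](mulr0 c); apply: cvgM; [exact: cvg_cst|exact: cvg_harmonic].
have jk k : cintble (mu \x mu)%E (fun z => fk k z.1 * K (z.1 - z.2) * gk k z.2).
  apply: cintble_heat_form.
  - exact: (cintble_cell_fun (cv k) mth th1).
  - exact: (cintble_cell_fun (cw k) mth' th1').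
have jD k : rintble (mu \x mu)%E (D k).
  apply: (rintble_le (mD k) jD0) => z.
  by have /andP[d0 d1] := D0 k z; rewrite ger0_norm.
have bD k : normc (heat_form phi psi) - B <= \int[(mu \x mu)%E]_z D k z.
  rewrite lerBlDr addrC; have e : heat_form phi psi = heat_form (fk k) (gk k) +
      cint (mu \x mu)%E (fun z => phi z.1 * K (z.1 - z.2) * psi z.2
        - fk k z.1 * K (z.1 - z.2) * gk k z.2).
    by rewrite cintB// addrC subrK.
  have jB := cintbleD jF (cintbleN (jk k)).
  rewrite e; apply: (le_trans (ler_normcD _ _)); apply: lerD; first exact: bk.
  apply: (le_trans (normc_cint jB)); apply: le_rint => [||z].
  - exact: jB.2.
  - exact: jD.
  have /andP[d0 _] := D0 k z.
  have -> : phi z.1 * K (z.1 - z.2) * psi z.2 - fk k z.1 * K (z.1 - z.2) * gk k z.2 =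
      K (z.1 - z.2) * (v z.1 * w z.2 - vk k z.1 * wk k z.2)%:C%C * (phase (phi z.1) * phase (psi z.2)).
    rewrite fkE gkE -{1}(mul_phase (phi z.1)) -{1}(mul_phase (psi z.2)).
    rewrite (rmorphB (real_complex R)) !(rmorphM (real_complex R)) /=; ring.
  rewrite Normc.normcM (Normc.normcM (K _)) normc_real.
  rewrite ger0_norm; last first.
    have /andP[a0 av] := vkP k z.1; have /andP[b0 bw] := wkP k z.2.
    by rewrite subr_ge0 ler_pM.
  rewrite -/(D k z) ler_piMr// Normc.normcM -[leRHS]mulr1 ler_pM ?normc_ge0//.
by rewrite -subr_le0; exact: cvg0_ge Dcvg bD.
Unshelve. all: by end_near. Qed.

End heat_interpolation.

(** * The weak equation tested against Gaussians *)

Section smooth_functions.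
Context {R : realType}.

Lemma is_derive_eqf (V W : normedModType R) (f g : V -> W) x v df :
  (forall y, f y = g y) -> is_derive x v f df -> is_derive x v g df.
Proof. by move=> /funext ->. Qed.

Lemma is_derive_val (V W : normedModType R) (f : V -> W) x v df dg :
  df = dg -> is_derive x v f df -> is_derive x v f dg.
Proof. by move=> ->. Qed.

Lemma is_derive_mul (V : normedModType R) (f g : V -> R) x v df dg :
  is_derive x v f df -> is_derive x v g dg ->
  is_derive x v (fun y => f y * g y) (df * g x + f x * dg).
Proof.
move=> hf hg; apply: (is_derive_val _ (is_deriveM hf hg)).
by rewrite addrC; congr (_ + _); exact: mulrC.
Qed.

Lemma is_derive_scale (V : normedModType R) (c : R) (f : V -> R) x v df :
  is_derive x v f df -> is_derive x v (fun y => c * f y) (c * df).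
Proof. by move=> hf; exact: is_deriveZ. Qed.

Lemma is_derive_sub (V : normedModType R) (f g : V -> R) x v df dg :
  is_derive x v f df -> is_derive x v g dg -> is_derive x v (fun y => f y - g y) (df - dg).
Proof. by move=> hf hg; exact: is_deriveB. Qed.

Lemma is_derive_line (V : normedModType R) (f : V -> R) x v df :
  is_derive x v f df <-> is_derive (0 : R) (1 : R) (fun h : R => f (h *: v + x)) df.
Proof.
have e : 'D_v f x = 'D_1 (fun h : R => f (h *: v + x)) 0.
  rewrite /derive; set g1 := (fun h : R => h^-1 *: _); set g2 := (fun h : R => h^-1 *: _).
  suff -> : g1 = g2 by [].
  by apply/funext => h; rewrite /g1 /g2 /= addr0 scale0r add0r [h *: 1]mulr1.
split=> -[d dv].
- by constructor; [exact: (iffLR (derivable1P f x v) d)|rewrite -dv e].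
- by constructor; [exact: (iffRL (derivable1P f x v) d)|rewrite e].
Qed.

Lemma is_derive_comp (V : normedModType R) (h : R -> R) (f : V -> R) x v dh df :
  is_derive (f x) 1 h dh -> is_derive x v f df ->
  is_derive x v (fun y => h (f y)) (dh * df).
Proof.
move=> hh /is_derive_line hf; apply/is_derive_line.
apply: (@is_derive1_comp R h (fun t => f (t *: v + x)) 0) => //.
by rewrite scale0r add0r.
Qed.

Lemma is_derive_continuous (f : R -> R) (x df : R) : is_derive x 1 f df -> {for x, continuous f}.
Proof. by move=> [d _]; exact/differentiable_continuous/derivable1_diffP. Qed.

(** This is x / m <= exp(x / m) raised to the power m. *)
Lemma pow_expRN_le (m : nat) (x : R) : 0 <= x -> x ^+ m * expR (- x) <= m%:R ^+ m.
Proof.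
move=> x0; case: m => [|m]; first by rewrite !expr0 mul1r -[leRHS]expR0 ler_expR oppr_le0.
rewrite expRN ler_pdivrMr ?expR_gt0//.
have -> : expR x = expR (x / m.+1%:R) ^+ m.+1.
  by rewrite -expRM_natl -mulr_natl mulrCA divff ?mulr1.
rewrite -exprMn lerXn2r ?nnegrE ?mulr_ge0 ?expR_ge0//.
rewrite -ler_pdivrMl// mulrC; apply: le_trans (expR_ge1Dx _).
by rewrite lerDr.
Qed.

(** The functions p(1/t) exp(-1/t), continued by 0 to t <= 0. The polynomial factor is there to make
    the family closed under differentiation, the origin included. *)
Definition bump (p : {poly R}) (t : R) : R :=
  if 0 < t then p.[t^-1] * expR (- t^-1) else 0.

Lemma bump_bounded p : exists2 C, 0 <= C & forall t, `|bump p t| <= C.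
Proof.
exists (\sum_(i < size p) `|p`_i| * i%:R ^+ i).
  by apply: sumr_ge0 => i _; rewrite mulr_ge0 ?exprn_ge0.
move=> t; rewrite /bump; case: ltP => t0; last first.
  by rewrite normr0; apply: sumr_ge0 => i _; rewrite mulr_ge0 ?exprn_ge0.
rewrite horner_coef mulr_suml (le_trans (ler_norm_sum _ _ _))//; apply: ler_sum => i _.
rewrite -mulrA normrM ler_wpM2l// ger0_norm ?mulr_ge0 ?expR_ge0 ?exprn_ge0 ?invr_ge0 ?(ltW t0)//.
by apply: pow_expRN_le; rewrite invr_ge0 ltW.
Qed.

(** Two powers of t split off at the cost of another polynomial. Since bumps are bounded, the
    difference quotient at 0 tends to 0. *)
Lemma bump_sqr p t : bump p t = t ^+ 2 * bump ('X^2 * p) t.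
Proof.
rewrite /bump; case: ltP => t0; last by rewrite mulr0.
rewrite hornerM hornerXn; set e := expR _; set q := p.[_].
by field; rewrite gt_eqF.
Qed.

(** Chain rule: the derivative of p(1/t) exp(-1/t) is (p - p')(1/t) exp(-1/t) / t^2. *)
Definition bump_deriv (p : {poly R}) : {poly R} := 'X^2 * (p - p^`()).

Lemma is_derive_bump p (t : R) : is_derive t 1 (bump p) (bump (bump_deriv p) t).
Proof.
have [t0|t0|->] := ltgtP t 0.
- rewrite {2}/bump ltNge (ltW t0)/=.
  apply: (@near_eq_is_derive _ _ _ (cst 0)) (is_derive_cst _ _ _).
  by near=> y; rewrite /bump ltNge ltW//; near: y; exact: lt_nbhsl.
- rewrite {2}/bump t0.
  apply: (@near_eq_is_derive _ _ _ (fun y : R => p.[y^-1] * expR (- y^-1))).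
    near=> y; rewrite /bump ifT//; near: y; exact: lt_nbhsr.
  have dV : is_derive t 1 (fun y : R => y^-1) (- t ^- 2).
    by apply: (is_derive_val _ (@is_deriveV R id t 1 1 _ _)); rewrite ?gt_eqF// [LHS]mulr1.
  have dp := is_derive_comp (is_derive_poly p t^-1) dV.
  have dN : is_derive t 1 (fun y : R => - y^-1) (- - t ^- 2) by exact: is_deriveN dV.
  have de := is_derive_comp (f := fun y : R => - y^-1) (is_derive_expR (- t^-1)) dN.
  apply: (is_derive_val _ (is_derive_mul dp de)).
  rewrite /bump_deriv hornerM hornerXn hornerD hornerN; set e := expR _; set q := p.[_]; set q' := _.[_].
  by field; rewrite gt_eqF.
- rewrite {2}/bump ltxx.
  have [C C0 hC] := bump_bounded ('X^2 * p).
  have cv : (fun h => h^-1 *: ((bump p \o shift 0) (h *: (1 : R)) - bump p 0)) @ 0^' --> (0 : R).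
    apply/cvgr0Pnorm_le => e e0; near=> h.
    have h0 : h != 0 by near: h; exact: nbhs_dnbhs_neq.
    rewrite /= addr0 [h *: 1]mulr1 {2}/bump ltxx subr0 bump_sqr expr2.
    rewrite [_ *: _]mulrA mulrA mulVf// mul1r normrM.
    apply: le_trans (_ : `|h| * C <= e); first by rewrite ler_wpM2l.
    apply: le_trans (_ : `|h| * (C + 1) <= e); first by rewrite ler_wpM2l// lerDl.
    rewrite -ler_pdivlMr ?ltr_wpDl//; near: h; apply: dnbhs0_le.
    by rewrite divr_gt0// ltr_wpDl.
  constructor; first by apply/cvg_ex; exists 0.
  exact: (cvg_lim (@Rhausdorff R) cv).
Unshelve. all: by end_near. Qed.

(* The real parts of z e^(a t): a family closed under differentiation. *)
Definition cexp_re (a z : R[i]) (t : R) : R := cRe (z * cexp (a * t%:C%C)).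

Lemma is_derive_cexp_re a z (t : R) : is_derive t 1 (cexp_re a z) (cexp_re a (z * a) t).
Proof.
case: a z => [a b] [u v].
have E (z : R[i]) y : cexp_re (Complex a b) z y =
    expR (y * a) * (cRe z * cos (y * b) - cIm z * sin (y * b)).
  rewrite /cexp_re cReM /cexp cReM cImM /= !mulr0 subr0 add0r [y * a]mulrC [y * b]mulrC.
  by ring.
have dl c : is_derive t 1 (fun y : R => y * c) c.
  apply: (is_derive_val _ (is_derive_mul (is_derive_id t 1) (is_derive_cst c t 1))).
  by rewrite mul1r mulr0 addr0.
rewrite (funext (E (Complex u v))).
have de := is_derive_comp (f := fun y : R => y * a) (is_derive_expR (t * a)) (dl a).
have dc := is_derive_scale u (is_derive_comp (f := fun y : R => y * b) (is_derive_cos (t * b)) (dl b)).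
have ds := is_derive_scale v (is_derive_comp (f := fun y : R => y * b) (is_derive_sin (t * b)) (dl b)).
apply: (is_derive_val _ (is_derive_mul de (is_derive_sub dc ds))).
by rewrite E cReM cImM /=; ring.
Qed.

Inductive smooth1 : (R -> R) -> Prop :=
| Smooth1Bump p : smooth1 (bump p)
| Smooth1Cexp a z : smooth1 (cexp_re a z).

Lemma smooth1_derive f : smooth1 f -> exists2 g, smooth1 g & forall t : R, is_derive t 1 f (g t).
Proof.
case=> [p|a z]; [exists (bump (bump_deriv p))|exists (cexp_re a (z * a))].
- exact: Smooth1Bump.
- exact: is_derive_bump.
- exact: Smooth1Cexp.
- exact: is_derive_cexp_re.
Qed.

Section several_variables.
Variable n : nat.
Local Notation X := 'rV[R]_n.
Local Notation ei i := (delta_mx ord0 i : X).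

(** A syntactic class closed under partial derivatives by the rules of calculus. It provides the
    continuity and derivability of partial derivatives of every order that [test_function] demands,
    without computing them. *)
Inductive smooth : (X -> R) -> Prop :=
| SmoothCst c : smooth (fun _ => c)
| SmoothCoord i : smooth (fun x => x ord0 i)
| SmoothAdd f g : smooth f -> smooth g -> smooth (fun x => f x + g x)
| SmoothMul f g : smooth f -> smooth g -> smooth (fun x => f x * g x)
| SmoothComp h f : smooth1 h -> smooth f -> smooth (fun x => h (f x)).

Lemma is_derive_coord i j (x : X) : is_derive x (ei j) (fun y => y ord0 i) ((i == j)%:R : R).
Proof.
apply/is_derive_line.
apply: (@is_derive_eqf _ _ (fun h : R => h * (i == j)%:R + x ord0 i)).
  by move=> h; rewrite !mxE eqxx.
have d1 := is_derive_mul (is_derive_id (0 : R) (1 : R)) (is_derive_cst ((i == j)%:R : R) (0 : R) (1 : R)).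
apply: (is_derive_val _ (is_deriveD d1 (is_derive_cst (x ord0 i) (0 : R) (1 : R)))).
by rewrite mul1r mulr0 !addr0.
Qed.

Lemma smooth_derive f : smooth f -> forall i,
  exists2 g, smooth g & forall x, is_derive x (ei i) f (g x).
Proof.
move=> sf i; elim: sf => {f} [c|j|f g sf [df sdf hf] sg [dg sdg hg]|
    f g sf [df sdf hf] sg [dg sdg hg]|h f /smooth1_derive[dh sdh hh] sf [df sdf hf]].
- by exists (fun _ => 0); [exact: SmoothCst|move=> x; exact: is_derive_cst].
- by exists (fun _ => (j == i)%:R); [exact: SmoothCst|move=> x; exact: is_derive_coord].
- by exists (fun x => df x + dg x); [exact: SmoothAdd|move=> x; exact: is_deriveD].
- exists (fun x => df x * g x + f x * dg x); last by move=> x; exact: is_derive_mul.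
  by apply: SmoothAdd; exact: SmoothMul.
- exists (fun x => dh (f x) * df x); last by move=> x; exact: is_derive_comp.
  by apply: SmoothMul => //; exact: SmoothComp.
Qed.

Lemma smooth_continuous f : smooth f -> continuous f.
Proof.
elim=> {f} [c|j|f g _ hf _ hg|f g _ hf _ hg|h f /smooth1_derive[dh _ hh] _ hf] x.
- exact: cst_continuous.
- exact: coord_continuous.
- by apply: continuousD; [exact: hf|exact: hg].
- by apply: continuousM; [exact: hf|exact: hg].
- by apply: continuous_comp; [exact: hf|exact: is_derive_continuous (hh _)].
Qed.

Lemma smooth_partial f s : smooth f -> smooth (partial s f).
Proof.
move=> sf; elim: s => [//|i s /smooth_derive/(_ i)[g sg hg]] /=.
rewrite (_ : (fun x => _) = g)//; apply/funext => x.
by have [_ ->] := hg x.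
Qed.

Lemma smooth_sum (I : Type) (r : seq I) (F : I -> X -> R) :
  (forall i, smooth (F i)) -> smooth (fun x => \sum_(i <- r) F i x).
Proof.
move=> sF; elim: r => [|i r ih].
  by under eq_fun do rewrite big_nil; exact: SmoothCst.
by under eq_fun do rewrite big_cons; exact: SmoothAdd.
Qed.

Lemma smooth_test_function f : smooth f -> compact (closure [set x | f x != 0]) ->
  test_function f.
Proof.
move=> sf cf; split => // [s|s i x]; first exact/smooth_continuous/smooth_partial.
have [g _ hg] := smooth_derive (smooth_partial s sf) i.
by have [] := hg x.
Qed.

Lemma smooth_sqdist (x : X) : smooth (fun y => sqnorm (y - x)).
Proof.
apply: smooth_sum => i; rewrite (_ : (fun y => _) =
    (fun y : X => (y ord0 i + - x ord0 i) * (y ord0 i + - x ord0 i))).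
  by apply: SmoothMul; apply: SmoothAdd; do ?exact: SmoothCst; exact: SmoothCoord.
by apply/funext => y; rewrite !mxE expr2.
Qed.

Lemma closed_sqball (x : X) (r : R) : closed [set y | sqnorm (y - x) <= r].
Proof.
apply: (@closed_comp _ _ (fun y : X => sqnorm (y - x)) [set t | t <= r]); last exact: closed_le.
by move=> y _; exact: smooth_continuous (smooth_sqdist x) _.
Qed.

Lemma compact_sqball (x : X) (r : R) : compact [set y | sqnorm (y - x) <= r].
Proof.
apply: bounded_closed_compact; last exact: closed_sqball.
exists (`|x| + (1 + `|r|)); split; first exact: num_real.
  move=> M hM y /= hy; apply: le_trans (ltW hM).
  rewrite -[y](subrK x) addrC (le_trans (ler_normD _ _))// lerD2l.
  rewrite [leLHS]/Num.norm /= mx_normrE; apply/bigmax_leP; split => [|[i j] _ /=]; first by rewrite addr_ge0.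
  rewrite ord1; set z := y - x in hy *.
  have zj := le_trans (sqnorm_coord z j) (le_trans hy (ler_norm r)).
  have r0 : 0 <= `|r| by [].
  by rewrite ler_norml; apply/andP; split; nra.
Qed.

Lemma is_derive_sqdist (x y : X) i :
  is_derive y (ei i) (fun y => sqnorm (y - x)) (2 * (y ord0 i - x ord0 i)).
Proof.
apply: (@is_derive_eqf _ _ (fun y : X => \sum_j (y ord0 j - x ord0 j) * (y ord0 j - x ord0 j))).
  by move=> z; apply: eq_bigr => j _; rewrite !mxE expr2.
pose d j : R := (j == i)%:R.
have h j : is_derive y (ei i) (fun y : X => y ord0 j - x ord0 j) (d j).
  apply: (is_derive_val _ (is_derive_sub (is_derive_coord j i y) (is_derive_cst (x ord0 j) y (ei i)))).
  by rewrite subr0.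
rewrite (_ : (fun y => _) = \sum_j (fun y : X => (y ord0 j - x ord0 j) * (y ord0 j - x ord0 j))).
  apply: (is_derive_val _ (is_derive_sum (fun j => is_derive_mul (h j) (h j)))).
  rewrite (bigD1 i)//= big1 ?addr0 /d ?eqxx ?mul1r ?mulr1; first by rewrite mulr_natl mulr2n.
  by move=> j ji; rewrite (negbTE ji) mul0r mulr0 addr0.
by apply/funext => z; rewrite fct_sumE.
Qed.

Lemma partial2_radial (x : X) (H H' H'' : R -> R) i :
  (forall t : R, is_derive t 1 H (H' t)) -> (forall t : R, is_derive t 1 H' (H'' t)) ->
  partial [:: i; i] (fun y => H (sqnorm (y - x))) =
  (fun y => 4 * (y ord0 i - x ord0 i) ^+ 2 * H'' (sqnorm (y - x)) + 2 * H' (sqnorm (y - x))).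
Proof.
move=> h1 h2; rewrite /partial /=.
have -> : (fun y : X => 'D_(ei i) (fun y => H (sqnorm (y - x))) y) =
    (fun y => H' (sqnorm (y - x)) * (2 * (y ord0 i - x ord0 i))).
  by apply/funext => y; have [_ ->] := is_derive_comp (h1 _) (is_derive_sqdist x y i).
apply/funext => y.
have d1 := is_derive_comp (h2 _) (is_derive_sqdist x y i).
have d2 := is_derive_scale 2
  (is_derive_sub (is_derive_coord i i y) (is_derive_cst (x ord0 i) y (ei i))).
have [_ ->] := is_derive_mul d1 d2.
rewrite eqxx subr0 /cst; move: (H'' _) (H' _) (y ord0 i) (x ord0 i) => s2 s1 yi xi /=.
by ring.
Qed.

End several_variables.
End smooth_functions.

Lemma cvg0_sum {R : realType} (I : Type) (r : seq I) (F : I -> nat -> R) :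
  (forall i, F i @ \oo --> 0) -> (fun k => \sum_(i <- r) F i k) @ \oo --> 0.
Proof.
move=> F0; elim: r => [|i r ih].
  by under eq_fun do [rewrite big_nil]; exact: cvg_cst.
under eq_fun do [rewrite big_cons]; have h := cvgD (F0 i) ih.
by rewrite addr0 in h; exact: h.
Qed.

Lemma normcN {R : realType} (z : R[i]) : normc (- z) = normc z.
Proof. by rewrite -mulN1r Normc.normcM (_ : -1 = (-1 : R)%:C%C) ?normc_real ?normrN1 ?mul1r// rmorphN1. Qed.

(** * The weak Laplacian tested against complex Gaussians *)

Section weak_equation.
Context {R : realType} (n : nat).
Local Notation mu := (@lebesgue_Rn R n).
Local Notation X := ('rV[R]_n).
Variables (p p' : R) (p1 : 1 < p) (pp' : p^-1 + p'^-1 = 1).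

Let p0 : 0 < p. Proof. exact: lt_trans p1. Qed.

Let p'0 : 0 < p'.
Proof.
have -> : p' = (1 - p^-1)^-1 by rewrite -pp' addrAC subrr add0r invrK.
by rewrite invr_gt0 subr_gt0 invf_lt1.
Qed.

Lemma rintble_sqdist_gauss (A : R) (x : X) : 0 < A ->
  rintble mu (fun y => expR (- (A * sqnorm (y - x)))).
Proof.
move=> A0; have [j _] := @sqnorm_gauss_integral R n _ A0.
by apply: (iffRL (rintble_push (m1 := mu) (m2 := mu) (measurable_sub1 x) (push_subl x) _
  (rintble_measurable j))).
Qed.

Lemma measurable_sqdist (x : X) : measurable_fun setT (fun y : X => sqnorm (y - x)).
Proof. exact: (measurableT_comp (@measurable_sqnorm R n) (measurable_sub1 x)). Qed.

Lemma rintble_Lp_gauss (u : X -> R[i]) (A : R) (x : X) : 0 < A -> cmeasurable u ->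
  rintble mu (fun y => normc (u y) `^ p) ->
  rintble mu (fun y => normc (u y) * expR (- (A * sqnorm (y - x)))).
Proof.
move=> A0 mu_ ju; have A'0 : 0 < A * p' by rewrite mulr_gt0.
have j2 := rintble_sqdist_gauss x A'0.
have j := rintbleD (rintbleZ p^-1 ju) (rintbleZ p'^-1 j2).
apply: (rintble_le _ j) => [|y].
  apply: measurable_funM; first exact: cmeasurable_normc.
  apply: measurableT_comp => //; apply: measurableT_comp => //.
  by apply: measurable_funM => //; exact: measurable_sqdist.
rewrite ger0_norm ?mulr_ge0 ?normc_ge0 ?expR_ge0//.
apply: (le_trans (conjugate_powR (normc_ge0 (u y)) (expR_ge0 _) p0 p'0 pp')).
by rewrite ![_ / _]mulrC -expRM mulNr mulrAC.
Qed.

Section gaussian_weight.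
Variables (A : R) (A0 : 0 < A) (x : X).
Let N y := sqnorm (y - x).
Let wt y := (1 + N y) * expR (- (A * N y)).

Let N0 y : 0 <= N y. Proof. exact: sqnorm_ge0. Qed.

Lemma weight_le y : wt y <= (1 + 2 / A) * expR (- (A / 2 * N y)).
Proof.
have -> : expR (- (A / 2 * N y)) = expR (A / 2 * N y) * expR (- (A * N y)).
  by rewrite -expRD; congr expR; field.
rewrite mulrA ler_wpM2r ?expR_ge0// mulrDl mul1r; apply: lerD.
  by rewrite -[leLHS]expR0 ler_expR mulr_ge0// divr_ge0// ltW.
have A2 : 0 <= 2 / A by rewrite divr_ge0// ltW.
apply: le_trans (ler_wpM2l A2 (expR_ge1Dx (A / 2 * N y))).
have -> : 2 / A * (1 + A / 2 * N y) = 2 / A + N y by field; rewrite gt_eqF.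
by rewrite lerDr.
Qed.

Variables (u : X -> R[i]) (mu_ : cmeasurable u).
Hypothesis ju : rintble mu (fun y => normc (u y) `^ p).

Let dom C y := C * (1 + 2 / A) * (normc (u y) * expR (- (A / 2 * N y))).

Let jdom C : rintble mu (dom C).
Proof. by apply: rintbleZ; apply: rintble_Lp_gauss => //; rewrite divr_gt0. Qed.

Let le_dom (C : R) y (w : R) : 0 <= C -> `|w| <= C * wt y -> normc (u y * w%:C%C) <= dom C y.
Proof.
move=> C0 h; rewrite Normc.normcM normc_real /dom [leRHS]mulrCA ler_wpM2l ?normc_ge0//.
by apply: (le_trans h); rewrite -[leRHS]mulrA; apply: ler_wpM2l => //; exact: weight_le.
Qed.

Lemma cintble_weight (w : X -> R) (C : R) : 0 <= C -> measurable_fun setT w ->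
  (forall y, `|w y| <= C * wt y) -> cintble mu (fun y => u y * (w y)%:C%C).
Proof.
move=> C0 mw hw; apply: (cintble_le _ (jdom C)) => [|y]; last exact: le_dom.
by apply: cmeasurableM => //; exact: cmeasurable_real.
Qed.

Lemma cint_weight_cvg0 (w : nat -> X -> R) (C : R) : 0 <= C ->
  (forall k, measurable_fun setT (w k)) -> (forall k y, `|w k y| <= C * wt y) ->
  (forall y, w ^~ y @ \oo --> 0) ->
  (fun k => \int[mu]_y normc (u y * (w k y)%:C%C)) @ \oo --> 0.
Proof.
move=> C0 mw hw w0; apply: (rint_cvg0 (g := dom C)) => // [k|k y|y].
- apply: cmeasurable_normc; apply: cmeasurableM => //; exact: cmeasurable_real.
- by rewrite ger0_norm ?normc_ge0// le_dom.
- rewrite (_ : (fun k => _) = (fun k => normc (u y) * `|w k y|)); last first.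
    by apply/funext => k; rewrite Normc.normcM normc_real.
  rewrite -[X in _ --> X](mulr0 (normc (u y))); apply: cvgM; first exact: cvg_cst.
  by rewrite -(normr0 R); apply: cvg_norm; exact: w0.
Qed.

End gaussian_weight.

Section radial_test.
Variables (u : X -> R[i]) (g : 'I_n -> X -> R[i]).
Hypotheses (mu_ : cmeasurable u) (mg : forall i, cmeasurable (g i)).
Hypotheses (ju : rintble mu (fun y => normc (u y) `^ p))
  (jg : forall i, rintble mu (fun y => normc (g i y) `^ p)).
Hypothesis weak : forall i, weak_partial [:: i; i] u (g i).
Variables (a : R[i]) (a0 : 0 < cRe a) (x : X).
Let A := cRe a.
Let N y := sqnorm (y - x).
Let N0 y : 0 <= N y. Proof. exact: sqnorm_ge0. Qed.

Let cexp_re_le z t : `|cexp_re (- a) z t| <= normc z * expR (- (A * t)).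
Proof.
rewrite /cexp_re (le_trans (cRe_le_normc _))// Normc.normcM normc_cexp cReM.
by rewrite mulr0 subr0 cReN mulNr.
Qed.

(** For q = 1 this is exp(1 - 1/(1 - t/(k + 1))) for t < k + 1 and 0 beyond: a cutoff in t = |y -
    x|^2 with compact support, tending to 1 as k grows. Each derivative in t brings a factor - 1/(k
    + 1) and changes q, into [q1] and then [q2]. *)
Let cut (q : {poly R}) k t : R := expR 1 * bump q (1 - harmonic k * t).

Let q1 := bump_deriv (1 : {poly R}).
Let q2 := bump_deriv q1.

Let is_derive_cut q k (t : R) :
  is_derive t 1 (cut q k) (- harmonic k * cut (bump_deriv q) k t).
Proof.
have d1 := is_derive_sub (is_derive_cst (1 : R) t (1 : R)) (is_derive_scale (harmonic k) (is_derive_id t 1)).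
have d2 := is_derive_scale (expR 1) (is_derive_comp (f := fun t : R => 1 - harmonic k * t)
  (is_derive_bump q _) d1).
apply: (is_derive_val _ d2); rewrite /cut /cst; ring.
Qed.

Let cut_cvg q t : (fun k => cut q k t) @ \oo --> cut q 0 0.
Proof.
rewrite /cut mulr0; apply: cvgM; first exact: cvg_cst.
apply: continuous_cvg; first exact: is_derive_continuous (is_derive_bump q _).
apply: cvgB; first exact: cvg_cst.
rewrite -(mul0r t); apply: cvgM; [exact: cvg_harmonic|exact: cvg_cst].
Qed.

Let cut1 : cut 1 0 0 = 1.
Proof. by rewrite /cut mulr0 subr0 /bump ltr01 hornerC mul1r invr1 expRN divff ?gt_eqF ?expR_gt0. Qed.

Let cut_bounded : exists2 C, 0 <= C & forall k t, [/\ `|cut 1 k t| <= C, `|cut q1 k t| <= C & `|cut q2 k t| <= C].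
Proof.
have [C0 C00 h0] := bump_bounded (1 : {poly R}); have [C1 C10 h1] := bump_bounded q1.
have [C2 C20 h2] := bump_bounded q2.
exists (expR 1 * (C0 + C1 + C2)); first by rewrite mulr_ge0 ?expR_ge0 ?addr_ge0.
move=> k t; rewrite /cut !normrM !(ger0_norm (expR_ge0 _)).
set v := 1 - _; have := h0 v; have := h1 v; have := h2 v.
by split; rewrite ler_wpM2l ?expR_ge0//; lra.
Qed.

Let harm01 k : 0 <= (harmonic k : R) <= 1.
Proof. by rewrite harmonic_ge0/= /harmonic invf_le1// ler1n. Qed.

Variable z : R[i].
Let h0 := cexp_re (- a) z.
Let h1 := cexp_re (- a) (z * - a).
Let h2 := cexp_re (- a) (z * - a * - a).
Let H0 k t := cut 1 k t * h0 t.
Let H1 k t := - harmonic k * cut q1 k t * h0 t + cut 1 k t * h1 t.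
Let H2 k t := harmonic k ^+ 2 * cut q2 k t * h0 t - 2 * harmonic k * cut q1 k t * h1 t + cut 1 k t * h2 t.

Let dH0 k (t : R) : is_derive t 1 (H0 k) (H1 k t).
Proof. exact: is_derive_mul (is_derive_cut _ _ _) (is_derive_cexp_re _ _ _). Qed.

Let dH1 k (t : R) : is_derive t 1 (H1 k) (H2 k t).
Proof.
have d1 := is_derive_mul (is_derive_scale (- harmonic k) (is_derive_cut q1 k t)) (is_derive_cexp_re (- a) z t).
have d2 := is_derive_mul (is_derive_cut 1 k t) (is_derive_cexp_re (- a) (z * - a) t).
apply: (is_derive_val _ (is_deriveD d1 d2)).
by rewrite /H2 -/h0 -/h1 -/h2 -/q1 -/q2; ring.
Qed.

Let bounds : exists2 C, 0 <= C & forall k t, 0 <= t -> let e := expR (- (A * t)) in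
  [/\ `|H0 k t| <= C * e, `|H1 k t| <= C * e, `|H2 k t| <= C * e &
   [/\ `|h0 t| <= C * e, `|h1 t| <= C * e & `|h2 t| <= C * e]].
Proof.
have [D D0 hD] := cut_bounded.
pose Z := normc z + normc (z * - a) + normc (z * - a * - a).
have Z0 : 0 <= Z by rewrite !addr_ge0 ?normc_ge0.
(* The factor 4 counts the terms of [H2], the mixed one twice; the last Z covers the functions
   without cutoff. *)
exists (4 * D * Z + Z); first by rewrite addr_ge0 ?mulr_ge0.
move=> k t t0 e; have e0 : 0 <= e by exact: expR_ge0.
have DZ : Z * e <= (4 * D * Z + Z) * e by rewrite ler_wpM2r// lerDr !mulr_ge0.
have b0 : `|h0 t| <= Z * e.
  by apply: (le_trans (cexp_re_le z t)); rewrite ler_wpM2r// /Z -addrA lerDl addr_ge0 ?normc_ge0.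
have b1 : `|h1 t| <= Z * e.
  apply: (le_trans (cexp_re_le _ t)); rewrite ler_wpM2r// /Z addrAC lerDr addr_ge0 ?normc_ge0//.
have b2 : `|h2 t| <= Z * e.
  apply: (le_trans (cexp_re_le _ t)); rewrite ler_wpM2r// /Z lerDr addr_ge0 ?normc_ge0//.
have [c0 c1 c2] := hD k t; have /andP[r0 r1] := harm01 k; set r := harmonic k in r0 r1.
have Ze0 : 0 <= Z * e by rewrite mulr_ge0.
have prod c h : `|c| <= D -> `|h| <= Z * e -> `|c * h| <= D * (Z * e).
  by move=> hc hh; rewrite normrM ler_pM.
have rprod c : `|c| <= D -> `|r * c| <= D.
  by move=> hc; rewrite normrM (ger0_norm r0) -[leRHS]mul1r ler_pM.
have -> : (4 * D * Z + Z) * e = 4 * (D * (Z * e)) + Z * e by ring.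
have De0 : 0 <= D * (Z * e) by rewrite mulr_ge0.
split; [| | |split; lra].
- have := prod _ _ c0 b0; rewrite -/(H0 k t); lra.
- have P1 := prod _ _ (rprod _ c1) b0; have P2 := prod _ _ c0 b1.
  rewrite /H1 mulNr mulNr (le_trans (ler_normD _ _))// normrN; lra.
- have P1 := prod _ _ (rprod _ (rprod _ c2)) b0; have P2 := prod _ _ (rprod _ c1) b1.
  have P3 := prod _ _ c0 b2.
  have -> : H2 k t = r * (r * cut q2 k t) * h0 t + (- (r * cut q1 k t * h1 t) + - (r * cut q1 k t * h1 t)) +
      cut 1 k t * h2 t by rewrite /H2 -/r; ring.
  do ![apply: (le_trans (ler_normD _ _))]; rewrite -?lerBrDr.
  have := ler_normD (- (r * cut q1 k t * h1 t)) (- (r * cut q1 k t * h1 t)).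
  have := ler_normD (r * (r * cut q2 k t) * h0 t) (- (r * cut q1 k t * h1 t) + - (r * cut q1 k t * h1 t)).
  rewrite !normrN; lra.
Qed.

(** The Laplacian of h(N) with N = |y - x|^2 is 4 N h'' + 2 n h'. The Gaussian is no test function,
    but its products [H0 k] with the cutoffs are; with their derivatives they are dominated by one
    Gaussian weight, uniformly in k, and dominated convergence removes the cutoff. *)
Lemma weak_cexp_re :
  [/\ cintble mu (fun y => u y * (4 * N y * h2 (N y) + 2 * n%:R * h1 (N y))%:C%C),
      (forall i, cintble mu (fun y => g i y * (h0 (N y))%:C%C)) &
      cint mu (fun y => u y * (4 * N y * h2 (N y) + 2 * n%:R * h1 (N y))%:C%C) =
      cint mu (fun y => (\sum_i g i y) * (h0 (N y))%:C%C)].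
Proof.
have [C C0 hC] := bounds.
have mN : measurable_fun setT N := measurable_sqdist x.
have mexp z' : measurable_fun setT (fun y => cexp_re (- a) z' (N y)).
  apply: (measurableT_comp (f := cexp_re (- a) z')) => //.
  by apply: continuous_measurable_fun => t; exact: is_derive_continuous (is_derive_cexp_re _ _ _).
have mcut q k : measurable_fun setT (fun y => cut q k (N y)).
  apply: (measurableT_comp (f := cut q k)) => //.
  by apply: continuous_measurable_fun => t; exact: is_derive_continuous (is_derive_cut _ _ _).
have mH0 k : measurable_fun setT (fun y => H0 k (N y)) by apply: measurable_funM; [exact: mcut|exact: mexp].
have mH1 k : measurable_fun setT (fun y => H1 k (N y)).
  by apply: measurable_funD; apply: measurable_funM => //; do ?apply: measurable_funM => //;
    do ?exact: mcut; exact: mexp.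
have mH2 k : measurable_fun setT (fun y => H2 k (N y)).
  apply: measurable_funD; last by apply: measurable_funM; [exact: mcut|exact: mexp].
  by apply: measurable_funB; apply: measurable_funM => //; do ?apply: measurable_funM => //;
    do ?exact: mcut; exact: mexp.
pose P k i (y : X) := 4 * (y ord0 i - x ord0 i) ^+ 2 * H2 k (N y) + 2 * H1 k (N y).
pose W k y := 4 * N y * H2 k (N y) + 2 * n%:R * H1 k (N y).
pose W' y := 4 * N y * h2 (N y) + 2 * n%:R * h1 (N y).
pose wt y := (1 + N y) * expR (- (A * N y)).
have wt1 y : expR (- (A * N y)) <= wt y by rewrite -[leLHS]mul1r ler_wpM2r ?expR_ge0// lerDl N0.
have wtN y : N y * expR (- (A * N y)) <= wt y by rewrite ler_wpM2r ?expR_ge0// lerDr.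
have comb y (c : R) (b1 b2 : R) : 0 <= c -> c <= N y -> `|b2| <= C * expR (- (A * N y)) ->
    `|b1| <= C * expR (- (A * N y)) -> forall m : R, 0 <= m ->
    `|4 * c * b2 + 2 * m * b1| <= (4 + 2 * m) * C * wt y.
  move=> c0 cN hb2 hb1 m m0; set e := expR _ in hb1 hb2.
  have e0 : 0 <= e by exact: expR_ge0.
  have P2 : `|c * b2| <= C * wt y.
    rewrite normrM (ger0_norm c0); apply: (@le_trans _ _ (N y * (C * e))).
      by apply: ler_pM.
    by rewrite mulrCA ler_wpM2l// wtN.
  have P1 : `|b1| <= C * wt y by apply: (le_trans hb1); rewrite ler_wpM2l// wt1.
  have P1' : m * `|b1| <= m * (C * wt y) by rewrite ler_wpM2l.
  rewrite (le_trans (ler_normD _ _))// -!mulrA (normrM 4) (normrM 2) (normrM m).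
  rewrite (ger0_norm m0) !normr_nat.
  have -> : (4 + 2 * m) * (C * wt y) = 4 * (C * wt y) + 2 * (m * (C * wt y)) by ring.
  by apply: lerD; apply: ler_wpM2l.
have WC k y : `|W k y| <= (4 + 2 * n%:R) * C * wt y.
  by have [b0 b1 b2 _] := hC k _ (N0 y); apply: comb.
have W'C y : `|W' y| <= (4 + 2 * n%:R) * C * wt y.
  by have [_ _ _ [b0 b1 b2]] := hC 0%N _ (N0 y); apply: comb.
have coordN (y : X) i : (y ord0 i - x ord0 i) ^+ 2 <= N y.
  by have := sqnorm_coord (y - x) i; rewrite !mxE.
have PC k i y : `|P k i y| <= (4 + 2) * C * wt y.
  have [b0 b1 b2 _] := hC k _ (N0 y).
  by have := comb y _ _ _ (sqr_ge0 _) (coordN y i) b2 b1 1 ler01; rewrite !mulr1.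
have VC k y : `|H0 k (N y)| <= C * wt y.
  by have [b0 _ _ _] := hC k _ (N0 y); apply: (le_trans b0); rewrite ler_wpM2l.
have V'C y : `|h0 (N y)| <= C * wt y.
  by have [_ _ _ [b0 _ _]] := hC 0%N _ (N0 y); apply: (le_trans b0); rewrite ler_wpM2l.
have nC : 0 <= (4 + 2 * n%:R) * C by rewrite mulr_ge0// addr_ge0// mulr_ge0.
have mW k : measurable_fun setT (W k).
  by apply: measurable_funD; apply: measurable_funM => //; apply: measurable_funM.
have mW' : measurable_fun setT W'.
  by apply: measurable_funD; apply: measurable_funM; do ?exact: mexp; exact: measurable_funM.
have mP k i : measurable_fun setT (P k i).
  apply: measurable_funD; apply: measurable_funM => //; apply: measurable_funM => //.
  by apply: measurable_funX; apply: measurable_funB => //; exact: measurable_rV_coord.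
have jW k := cintble_weight a0 mu_ ju nC (mW k) (WC k).
have jW' := cintble_weight a0 mu_ ju nC mW' W'C.
have jP k i := cintble_weight a0 mu_ ju (_ : 0 <= (4 + 2) * C) (mP k i) (PC k i).
have jV k i := cintble_weight a0 (mg i) (jg i) C0 (mH0 k) (VC k).
have jV' i := cintble_weight a0 (mg i) (jg i) C0 (mexp z) V'C.
have PW k y : \sum_i P k i y = W k y.
  rewrite /P big_split /= -mulr_suml -mulr_sumr sumr_const card_ord -[_ *+ n]mulr_natr.
  have <- : N y = \sum_(i < n) (y ord0 i - x ord0 i) ^+ 2.
    by apply: eq_bigr => i _; rewrite !mxE.
  by rewrite /W; ring.
have test k : cint mu (fun y => u y * (W k y)%:C%C) = \sum_i cint mu (fun y => g i y * (H0 k (N y))%:C%C).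
  have sm : smooth (fun y => H0 k (N y)).
    have sa : smooth (fun y => 1 + (- harmonic k) * N y).
      exact (SmoothAdd (SmoothCst n 1) (SmoothMul (SmoothCst n (- harmonic k)) (smooth_sqdist x))).
    have := SmoothMul (SmoothMul (SmoothCst n (expR 1)) (SmoothComp (Smooth1Bump 1) sa))
      (SmoothComp (Smooth1Cexp (- a) z) (smooth_sqdist x)).
    by congr smooth; apply/funext => y; rewrite /H0 /cut mulNr.
  have tf : test_function (fun y => H0 k (N y)).
    apply: smooth_test_function => //; apply: (subclosed_compact _ (@compact_sqball _ _ x k.+1%:R)).
      exact: closed_closure.
    rewrite closureE; apply: smallest_sub; first exact: closed_sqball.
    move=> y /=.
    rewrite /H0 /cut /bump; case: ltP => [+ _|_]; last by rewrite mulr0 mul0r eqxx.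
    by rewrite subr_gt0 /harmonic mulrC ltr_pdivrMr// mul1r => /ltW.
  have wi i : cint mu (fun y => u y * (P k i y)%:C%C) = cint mu (fun y => g i y * (H0 k (N y))%:C%C).
    have := weak i tf; rewrite (partial2_radial x i (dH0 k) (dH1 k)) /= expr2 mulrNN !mulr1 mul1r.
    exact: id.
  rewrite -(eq_bigr _ (fun i _ => wi i)).
  rewrite -cint_sum; last by move=> i; apply: jP; rewrite ?mulr_ge0 ?addr_ge0.
  congr cint; apply/funext => y; rewrite -mulr_sumr -PW; congr (_ * _).
  exact: (rmorph_sum (real_complex R)).
have cv1 y : (fun k => H0 k (N y)) @ \oo --> h0 (N y).
  rewrite -[X in _ --> X]mul1r -cut1; apply: cvgM; [exact: cut_cvg|exact: cvg_cst].
have harm0 (v : nat -> R) (l : R) : v @ \oo --> l -> (fun k => harmonic k * v k) @ \oo --> 0.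
  by move=> hv; rewrite -[X in _ --> X](mul0r l); apply: cvgM => //; exact: cvg_harmonic.
have cv2 y : (fun k => H1 k (N y)) @ \oo --> h1 (N y).
  rewrite -[X in _ --> X]add0r -[h1 _ in X in _ --> X]mul1r -cut1; apply: cvgD; last first.
    by apply: cvgM; [exact: cut_cvg|exact: cvg_cst].
  rewrite -(mul0r (h0 (N y))); apply: cvgM; last exact: cvg_cst.
  under eq_fun do rewrite mulNr.
  by have h := cvgN (harm0 _ _ (@cut_cvg q1 (N y))); rewrite oppr0 in h; exact: h.
have cv3 y : (fun k => H2 k (N y)) @ \oo --> h2 (N y).
  rewrite -[X in _ --> X]add0r -[h2 _ in X in _ --> X]mul1r -cut1; apply: cvgD; last first.
    by apply: cvgM; [exact: cut_cvg|exact: cvg_cst].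
  rewrite -(subr0 0); apply: cvgB.
    rewrite -(mul0r (h0 (N y))); apply: cvgM; last exact: cvg_cst.
    under eq_fun do rewrite expr2 -mulrA.
    exact: (harm0 _ _ (harm0 _ _ (@cut_cvg q2 (N y)))).
  rewrite (_ : (fun k => _) = (fun k => 2 * (harmonic k * (cut q1 k (N y) * h1 (N y))))); last first.
    by apply/funext => k; ring.
  rewrite -(mulr0 2); apply: cvgM; first exact: cvg_cst.
  exact: (harm0 _ _ (cvgM (@cut_cvg q1 (N y)) (cvg_cst (h1 (N y))))).
have D1 : (fun k => \int[mu]_y normc (u y * (W k y - W' y)%:C%C)) @ \oo --> 0.
  apply: (cint_weight_cvg0 (x := x) a0 mu_ ju (C := (4 + 2 * n%:R) * C + (4 + 2 * n%:R) * C)).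
  - by rewrite addr_ge0.
  - by move=> k; exact: measurable_funB.
  - move=> k y; rewrite [leRHS]mulrDl; apply: (le_trans (ler_normB _ _)).
    by apply: lerD; [exact: WC|exact: W'C].
  - move=> y; rewrite -(subrr (W' y)); apply: cvgB; last exact: cvg_cst.
    apply: cvgD; apply: cvgM; [exact: cvg_cst|exact: cv3|exact: cvg_cst|exact: cv2].
have D2 i : (fun k => \int[mu]_y normc (g i y * (H0 k (N y) - h0 (N y))%:C%C)) @ \oo --> 0.
  apply: (cint_weight_cvg0 (x := x) a0 (mg i) (jg i) (C := C + C)).
  - by rewrite addr_ge0.
  - by move=> k; apply: measurable_funB => //; exact: mexp.
  - move=> k y; rewrite [leRHS]mulrDl; apply: (le_trans (ler_normB _ _)).
    by apply: lerD; [exact: VC|exact: V'C].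
  - by move=> y; rewrite -(subrr (h0 (N y))); apply: cvgB; [exact: cv1|exact: cvg_cst].
split; [exact: jW'|exact: jV'|].
rewrite [RHS](_ : _ = \sum_i cint mu (fun y => g i y * (h0 (N y))%:C%C)); last first.
  by rewrite -cint_sum//; congr cint; apply/funext => y; rewrite mulr_suml.
apply/eqP; rewrite -subr_eq0; apply/eqP/normc_eq0/eqP; rewrite eq_le normc_ge0 andbT.
set L := cint mu _; set Q := \sum_i _.
pose d k := \int[mu]_y normc (u y * (W k y - W' y)%:C%C) +
  \sum_i \int[mu]_y normc (g i y * (H0 k (N y) - h0 (N y))%:C%C).
have d0 : d @ \oo --> 0.
  rewrite -(addr0 0); apply: cvgD => //.
  exact: cvg0_sum.
have diff (v : X -> R[i]) (f f' : X -> R) : cintble mu (fun y => v y * (f y)%:C%C) ->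
    cintble mu (fun y => v y * (f' y)%:C%C) ->
    normc (cint mu (fun y => v y * (f y)%:C%C) - cint mu (fun y => v y * (f' y)%:C%C)) <=
    \int[mu]_y normc (v y * (f y - f' y)%:C%C).
  move=> j1 j2; rewrite -cintB//.
  have E : (fun y => v y * (f y)%:C%C - v y * (f' y)%:C%C) = (fun y => v y * (f y - f' y)%:C%C).
    by apply/funext => y; rewrite -mulrBr -rmorphB.
  by have := cintbleD j1 (cintbleN j2); rewrite E; exact: normc_cint.
apply: (cvg0_ge d0) => k.
have -> : L - Q = - (cint mu (fun y => u y * (W k y)%:C%C) - L) +
    \sum_i (cint mu (fun y => g i y * (H0 k (N y))%:C%C) - cint mu (fun y => g i y * (h0 (N y))%:C%C)).
  by rewrite sumrB -test /Q; ring.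
apply: (le_trans (ler_normcD _ _)); apply: lerD.
  by rewrite normcN; exact: diff.
by apply: (le_trans (normc_sum _ _ _)); apply: ler_sum => i _; exact: diff.
Qed.

End radial_test.

(** Test functions are real. The complex Gaussian E is assembled from the choices z = 1 and z = -
    'i, for which the real part of z E is the real and the imaginary part of E. *)
Lemma weak_gauss (u : X -> R[i]) (g : 'I_n -> X -> R[i]) (a : R[i]) (x : X) :
  cmeasurable u -> (forall i, cmeasurable (g i)) ->
  rintble mu (fun y => normc (u y) `^ p) ->
  (forall i, rintble mu (fun y => normc (g i y) `^ p)) ->
  (forall i, weak_partial [:: i; i] u (g i)) -> 0 < cRe a ->
  let E y := cexp (- a * (sqnorm (y - x))%:C%C) in
  cint mu (fun y => u y * (((4 * sqnorm (y - x))%:C%C * a ^+ 2 - (2 * n%:R)%:C%C * a) * E y)) =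
  cint mu (fun y => (\sum_i g i y) * E y).
Proof.
move=> mu_ mg ju jg weak a0 E.
have weak1 := weak_cexp_re mu_ mg ju jg weak a0 x 1.
have weak2 := weak_cexp_re mu_ mg ju jg weak a0 x (- 'i%C).
case: weak1 => j1 k1 e1; case: weak2 => j2 k2 e2.
set rw1 := (fun y => _ * _%:C%C) in j1; set rw2 := (fun y => _ * _%:C%C) in j2.
have iE (z : R[i]) : z = (cRe (1 * z))%:C%C + 'i%C * (cRe (- 'i%C * z))%:C%C.
  by case: z => u1 u2; apply: complexP; rewrite ?cReM ?cImM /=; ring.
have L : (fun y => u y * (((4 * sqnorm (y - x))%:C%C * a ^+ 2 - (2 * n%:R)%:C%C * a) * E y)) =
    (fun y => rw1 y + 'i%C * rw2 y).
  apply/funext => y; rewrite /rw1 /rw2 [X in _ = _ + X]mulrCA -mulrDr; congr (_ * _).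
  rewrite [LHS]iE; congr (_%:C%C + _ * _%:C%C); rewrite /cexp_re -/(E y) expr2.
    by move: (E y) => [e f]; rewrite !(cReM, cImM, cReN, cImN, cReD, cImD) /=; ring.
  by move: (E y) => [e f]; rewrite !(cReM, cImM, cReN, cImN, cReD, cImD) /=; ring.
rewrite L cintD//; last exact: cintbleZ.
rewrite (cintZ _ j2) e1 e2.
have sk (h : X -> R) : (forall i, cintble mu (fun y => g i y * (h y)%:C%C)) ->
    cintble mu (fun y => (\sum_i g i y) * (h y)%:C%C).
  by move=> k; under eq_fun do [rewrite mulr_suml]; exact: cintble_sum.
rewrite -(cintZ _ (sk _ k2)) -cintD; [|exact: sk|exact: cintbleZ (sk _ k2)].
congr cint; apply/funext => y; rewrite [X in _ + X]mulrCA -mulrDr; congr (_ * _).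
exact/esym/iE.
Qed.

End weak_equation.

(** * Approximation of the identity *)

Section young_convolution.
Context {R : realType} (n : nat).
Local Notation mu := (@lebesgue_Rn R n).
Local Notation X := ('rV[R]_n).
Variables (p p' : R) (p1 : 1 < p) (pp' : p^-1 + p'^-1 = 1).

Lemma conj_exp_gt1 : 1 < p'.
Proof.
have p0 : 0 < p by exact: lt_trans p1.
have E : p' = (1 - p^-1)^-1 by rewrite -pp' addrAC subrr add0r invrK.
have i0 : 0 < p^-1 by rewrite invr_gt0.
have i1 : p^-1 < 1 by rewrite invf_lt1.
by rewrite E invf_gt1 ?subr_gt0// ltrBlDr ltrDl.
Qed.

Let p0 : 0 < p. Proof. exact: lt_trans p1. Qed.
Let p'0 : 0 < p'. Proof. exact: lt_trans conj_exp_gt1. Qed.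

Lemma young_le (a b : R) : 0 <= a -> 0 <= b -> a * b <= a `^ p' + b `^ p.
Proof.
move=> a0 b0; rewrite mulrC; apply: (le_trans (conjugate_powR b0 a0 p0 p'0 pp')).
rewrite addrC; apply: lerD; rewrite ler_piMr ?powR_ge0// invf_le1//.
- exact/ltW/conj_exp_gt1.
- exact: ltW.
Qed.

Variables (phi u : X -> R[i]) (k : X -> R).
Hypotheses (mphi : cmeasurable phi) (mu_ : cmeasurable u).
Hypotheses (jphi : rintble mu (fun x => normc (phi x) `^ p')).
Hypotheses (ju : rintble mu (fun x => normc (u x) `^ p)).
Hypotheses (jk : rintble mu k) (k0 : forall x, 0 <= k x).

(** The additive form, with a sum of powers in place of a product of norms, follows pointwise from
    the scalar Young inequality. It suffices for integrability, and where smallness matters the two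
    functions are first rescaled against each other. *)
Lemma young_conv :
  rintble (mu \x mu)%E (fun z => normc (phi z.1) * k (z.1 - z.2) * normc (u z.2)) /\
  \int[(mu \x mu)%E]_z (normc (phi z.1) * k (z.1 - z.2) * normc (u z.2)) <=
  (\int[mu]_x normc (phi x) `^ p' + \int[mu]_x normc (u x) `^ p) * \int[mu]_x k x.
Proof.
have P1 x : 0 <= normc (phi x) `^ p' by exact: powR_ge0.
have P2 x : 0 <= normc (u x) `^ p by exact: powR_ge0.
have [j1 e1] := int_conv1 jphi jk P1 k0.
have [j2 e2] := int_conv2 ju jk P2 k0.
have le z : normc (phi z.1) * k (z.1 - z.2) * normc (u z.2) <=
    normc (phi z.1) `^ p' * k (z.1 - z.2) + normc (u z.2) `^ p * k (z.1 - z.2).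
  by rewrite -mulrDl mulrAC ler_wpM2r// young_le ?normc_ge0.
have j : rintble (mu \x mu)%E (fun z => normc (phi z.1) * k (z.1 - z.2) * normc (u z.2)).
  apply: (rintble_le _ (rintbleD j1 j2)) => [|z].
    apply: measurable_funM; last exact: (measurableT_comp (cmeasurable_normc mu_)).
    apply: measurable_funM; first exact: (measurableT_comp (cmeasurable_normc mphi)).
    by apply: (measurableT_comp (rintble_measurable jk)); exact: measurable_sub.
  by rewrite ger0_norm ?le// !mulr_ge0 ?normc_ge0.
split => //; rewrite mulrDl -e1 -e2 -(rintD j1 j2).
by apply: le_rint => //; exact: rintbleD.
Qed.

Lemma young_mul : rintble mu (fun x => normc (phi x) * normc (u x)).
Proof.
apply: (rintble_le _ (rintbleD jphi ju)) => [|x].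
  by apply: measurable_funM; exact: cmeasurable_normc.
by rewrite ger0_norm ?mulr_ge0 ?normc_ge0// young_le ?normc_ge0.
Qed.

End young_convolution.

(** * Local mean continuity of bounded functions *)

Section mean_continuity.
Context {R : realType} (n : nat).
Local Notation mu := (@lebesgue_Rn R n).
Local Notation X := ('rV[R]_n).

Lemma finite_radius (N : nat) (P : 'I_N -> R -> Prop) :
  (forall i d d', d' <= d -> P i d -> P i d') ->
  (forall i, exists2 d, 0 < d & P i d) -> exists2 d, 0 < d & forall i, P i d.
Proof.
move=> Pm ex; have [f fP] := choice (fun i => let: ex_intro2 d d0 Pd := ex i in ex_intro (fun d => 0 < d /\ P i d) d (conj d0 Pd)).
exists (\big[Num.min/1]_i f i).
  by apply: lt_bigmin => [|i _]; [exact: ltr01|have [] := fP i].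
by move=> i; apply: Pm (fP i).2; exact: bigmin_le_cond.
Qed.

(** Up to 1/(k + 1), r is a combination of the indicators of finitely many level sets, and each
    level set moves continuously in measure by [measurable_shift_cont]. *)
Lemma mean_cont_real (r : X -> R) (M : nat) : measurable_fun setT r ->
  (forall x, 0 <= r x <= M%:R) -> forall m e : R, 0 < e -> exists2 d : R, 0 < d &
  forall h, sqnorm h <= d ->
    (\int[mu]_y (\1_(@sqball R n m) y * `|r (h + y) - r y|)%:E <= e%:E)%E.
Proof.
move=> mr rM m e e0.
have r0 x : 0 <= r x by case/andP: (rM x).
have bfin := @sqball_fin R n m.
set V := fine (mu (sqball m)); have V0 : 0 <= V by exact: fine_ge0.
have VE : mu (sqball m) = V%:E by rewrite fineK// ge0_fin_numE.
(* The error 1/(k + 1) enters once at h + y and once at y; k >= M puts all values of r within the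
   range of the grid. *)
have [k kM kV] : exists2 k : nat, (M <= k)%N & 2 * k.+1%:R^-1 * V <= e / 2.
  pose B := 4 * V / e; have B0 : 0 <= B by rewrite divr_ge0 ?mulr_ge0 ?(ltW e0).
  exists (maxn M (Num.truncn B).+1); first exact: leq_maxl.
  set k := maxn _ _; have Bk : B <= k.+1%:R.
    have /andP[_ h] := truncn_itv B0; apply: (le_trans (ltW h)).
    by rewrite ler_nat; apply: leqW; exact: leq_maxr.
  rewrite mulrAC ler_pdivrMr//.
  have -> : 2 * V = B * (e / 2) by rewrite /B; field; rewrite gt_eqF.
  by rewrite mulrC ler_wpM2l// divr_ge0// ltW.
pose E (i : 'I_(k.+1 ^ 2)) := [set x | dyadic_cell r k x = Some i].
have mE i : measurable (E i).
  rewrite -[E i]setTI (_ : E i = r @^-1` `[i.+1%:R / k.+1%:R, i.+2%:R / k.+1%:R[%classic); first exact: mr.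
  apply/seteqP; split=> x.
    by move=> /(dyadic_cellP r0) /andP[h1 h2]; rewrite /= in_itv/= ler_pdivrMr// ltr_pdivlMr// h1.
  by rewrite /= in_itv/= ler_pdivrMr// ltr_pdivlMr// => h; apply/(dyadic_cellP r0).
pose C : R := \sum_(i < k.+1 ^ 2) @dyadic_val R k i + 1.
have C0 : 0 < C by rewrite ltr_wpDl// sumr_ge0// => i _; exact: dyadic_val_ge0.
pose e' := e / 2 / C; have e'0 : 0 < e' by rewrite !divr_gt0.
have [d d0 hd] : exists2 d, 0 < d & forall i h, sqnorm h <= d ->
    (mu (sqball m `&` shift_diff (E i) h) <= e'%:E)%E.
  apply: finite_radius => [i d d' dd' P h hd'|i]; first by apply: P; exact: le_trans dd'.
  exact: measurable_shift_cont (mE i) m e' e'0.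
exists d => // h hh.
pose ind (A : set X) y : R := \1_A y.
have mB := @measurable_sqball R n m.
have affE y : affine_rV h 1 y = h + y by rewrite /affine_rV scale1r.
have pt y : ind (sqball m) y * `|r (h + y) - r y| <=
    2 * k.+1%:R^-1 * ind (sqball m) y +
    \sum_i @dyadic_val R k i * ind (sqball m `&` shift_diff (E i) h) y.
  rewrite /ind indicE; case: (boolP (y \in sqball m)) => yB; last first.
    by rewrite mulr0 mul0r addr_ge0// sumr_ge0// => i _; rewrite mulr_ge0 ?dyadic_val_ge0.
  rewrite mul1r mulr1.
  pose ap x := oapp (@dyadic_val R k) 0 (dyadic_cell r k x).
  have apP x : `|r x - ap x| <= k.+1%:R^-1.
    have /andP[a0 a1] := dyadic_le r0 k x; rewrite ger0_norm ?subr_ge0//.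
    apply: dyadic_ge => //; have /andP[_ h'] := rM x; apply: (le_trans h').
    by rewrite ler_nat.
  have -> : r (h + y) - r y = (r (h + y) - ap (h + y)) - (r y - ap y) + (ap (h + y) - ap y) by ring.
  apply: (le_trans (ler_normD _ _)); apply: lerD.
    apply: (le_trans (ler_normB _ _)); have := apP (h + y); have := apP y.
    rewrite mulr_natl mulr2n; exact: (fun a b => lerD b a).
  rewrite /ap !oapp_sum -sumrB; apply: (le_trans (ler_norm_sum _ _ _)).
  apply: ler_sum => i _; rewrite -mulrBr normrM ger0_norm ?dyadic_val_ge0//.
  rewrite ler_wpM2l ?dyadic_val_ge0// indicE.
  have [<-|ne] := eqVneq (dyadic_cell r k (h + y) == Some i) (dyadic_cell r k y == Some i).
    by rewrite subrr normr0.
  rewrite mem_set; last first.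
    split; first by rewrite inE in yB.
    rewrite /shift_diff /= /E /= affE; move: ne.
    case: (eqVneq (dyadic_cell r k (h + y)) (Some i)) => h1;
      case: (eqVneq (dyadic_cell r k y) (Some i)) => h2 //= _; [left|right];
      split => //; exact/eqP.
  by case: (_ == Some i); case: (_ == Some i); rewrite ?subrr ?subr0 ?sub0r ?normrN ?normr1 ?normr0.
have mS i : measurable (sqball m `&` shift_diff (E i) h).
  by apply: measurableI => //; exact: measurable_shift_diff.
have indE (A : set X) : measurable A -> (\int[mu]_y (ind A y)%:E = mu A)%E.
  by move=> mA; rewrite integral_indic ?setIT.
have jA (A : set X) : measurable A -> (mu A < +oo)%E -> rintble mu (ind A) /\ \int[mu]_y ind A y = fine (mu A).
  move=> mA fA; split; last by rewrite /Rintegral indE.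
  by apply: rintbleP; [exact: measurable_indic|move=> x; rewrite /ind indicE|rewrite indE].
have [jB eB] := jA _ mB bfin.
have jS i := jA _ (mS i) (le_lt_trans (hd i h hh) (ltry _)).
have jsum i : rintble mu (fun y => @dyadic_val R k i * ind (sqball m `&` shift_diff (E i) h) y).
  by apply: rintbleZ; exact: (jS i).1.
have [js es] := rintble_sum (index_enum _) jsum.
have jtot := rintbleD (rintbleZ (2 * k.+1%:R^-1) jB) js.
have mh : measurable_fun setT (fun y : X => r (h + y)).
  apply: (measurableT_comp mr); rewrite (_ : +%R h = (fun y => affine_rV h 1 y)).
    exact: measurable_affine_rV.
  by apply/funext => y; rewrite affE.
apply: (@le_trans _ _ (\int[mu]_y (2 * k.+1%:R^-1 * ind (sqball m) y +
    \sum_i @dyadic_val R k i * ind (sqball m `&` shift_diff (E i) h) y)%:E)%E).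
  apply: ge0_le_int => [||y|//].
  - apply: measurable_funM; first exact: measurable_indic.
    by apply: measurableT_comp => //; exact: measurable_funB.
  - exact: rintble_measurable jtot.
  - by rewrite mulr_ge0// indicE.
rewrite -EFin_rint// lee_fin rintD//; last exact: rintbleZ.
rewrite (rintZ _ jB) eB es (splitr e); apply: lerD => //.
apply: (@le_trans _ _ (\sum_(i < k.+1 ^ 2) @dyadic_val R k i * e')).
  apply: ler_sum => i _; rewrite (rintZ _ (jS i).1) (jS i).2 ler_wpM2l ?dyadic_val_ge0//.
  rewrite -lee_fin fineK ?hd// ge0_fin_numE//; exact: le_lt_trans (hd i h hh) (ltry _).
rewrite -mulr_suml /e' mulrCA ler_piMr ?divr_ge0 ?(ltW e0)//.
by rewrite ler_pdivrMr// mul1r lerDl.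
Qed.

End mean_continuity.

Section approximate_identity.
Context {R : realType} (n : nat) (om : R[i]).
Hypotheses (om1 : normc om = 1) (om0 : 0 < cRe om).
Local Notation mu := (@lebesgue_Rn R n).
Local Notation X := ('rV[R]_n).
Local Notation K e := (@heatk R n om e).
Variables (p p' : R) (p1 : 1 < p) (pp' : p^-1 + p'^-1 = 1).

Lemma normc_le_ReIm (w : R[i]) : normc w <= `|cRe w| + `|cIm w|.
Proof.
case: w => a b; rewrite [cRe _]/= [cIm _]/=.
have -> : Complex a b = a%:C%C + 'i%C * b%:C%C.
  by apply: complexP; rewrite ?cReD ?cImD ?cReM ?cImM /=; ring.
apply: (le_trans (ler_normcD _ _)); rewrite Normc.normcM !normc_real.
have -> : normc ('i%C : R[i]) = 1 by rewrite Defs.normcE /= expr0n expr1n add0r sqrtr1.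
by rewrite mul1r.
Qed.

Lemma measurable_add : measurable_fun setT (fun z : X * X => z.1 + z.2).
Proof.
apply/measurable_fun_rVP => i.
rewrite (_ : (fun x => _) = (fun z : X * X => z.1 ord0 i + z.2 ord0 i)).
  apply: measurable_funD; exact: (measurableT_comp (@measurable_rV_coord R n i)).
by apply/funext => z; rewrite !mxE.
Qed.

Lemma rintble_tensor (f g : X -> R) : rintble mu f -> rintble mu g ->
  rintble (mu \x mu)%E (fun z => f z.1 * g z.2).
Proof.
move=> jf jg.
have c h : rintble mu h -> cintble mu (fun x => (h x)%:C%C).
  move=> j; split; first by apply: cmeasurable_real; exact: rintble_measurable j.
  apply: (rintble_le _ (integrable_abse j)) => [|x].
    apply: cmeasurable_normc; apply: cmeasurable_real; exact: rintble_measurable j.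
  by rewrite normc_real normr_id.
have := cintble_Re (cintble_mul (c _ jf) (c _ jg)); congr (rintble _ _).
by apply/funext => z; rewrite -rmorphM.
Qed.

(** Height and support are truncated together: where it is 1, u is bounded by m and the point lies
    in a ball, so every power of |u| becomes integrable. *)
Definition cut_ind (u : X -> R[i]) (m : nat) (y : X) : R :=
  ((normc (u y) <= m%:R) && (sqnorm y <= m%:R))%:R.

Lemma cut_ind01 u m y : 0 <= cut_ind u m y <= 1.
Proof. by rewrite /cut_ind ler0n lern1 leq_b1. Qed.

Lemma measurable_cut_ind u m : cmeasurable u -> measurable_fun setT (cut_ind u m).
Proof.
move=> mu_; pose A := [set y | normc (u y) <= m%:R] `&` @sqball R n m%:R.
have mA : measurable A.
  apply: measurableI; last exact: measurable_sqball.
  rewrite -[X in measurable X]setTI (_ : [set y | _] = (fun y => normc (u y)) @^-1` `]-oo, m%:R]%classic).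
    exact: cmeasurable_normc.
  by apply/seteqP; split=> x /=; rewrite in_itv.
rewrite (_ : cut_ind u m = \1_A); first exact: measurable_indic.
apply/funext => y; rewrite /cut_ind indicE; congr (nat_of_bool _)%:R.
by apply/andP/idP => [h|]; rewrite inE.
Qed.

Lemma cut_tail_cvg0 u : cmeasurable u -> rintble mu (fun y => normc (u y) `^ p) ->
  (fun m => \int[mu]_y ((1 - cut_ind u m y) * normc (u y) `^ p)) @ \oo --> 0.
Proof.
move=> mu_ ju; have b m y : 0 <= 1 - cut_ind u m y <= 1.
  by have /andP[i0 i1] := cut_ind01 u m y; rewrite subr_ge0 i1 gerBl.
apply: (rint_cvg0 _ ju) => [m|m y|y].
- apply: measurable_funM; last exact: rintble_measurable ju.
  by apply: measurable_funB => //; exact: measurable_cut_ind.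
- have /andP[b0 b1] := b m y.
  by rewrite ger0_norm ?mulr_ge0 ?powR_ge0// ler_piMl ?powR_ge0.
- apply: cvg_near_cst; near=> m; rewrite /cut_ind.
  rewrite (_ : _ && _ = true) ?subrr ?mul0r//; apply/andP; split.
    by near: m; exact: nbhs_infty_ger.
  by near: m; exact: nbhs_infty_ger.
Unshelve. all: by end_near. Qed.

Variables (phi u : X -> R[i]) (M : nat).
Hypotheses (mphi : cmeasurable phi) (mu_ : cmeasurable u).
Hypotheses (jphi : rintble mu (fun x => normc (phi x) `^ p')).
Hypotheses (ju : rintble mu (fun x => normc (u x) `^ p)).
Hypothesis phiM : forall x, normc (phi x) <= M%:R.

Let p0 : 0 < p. Proof. exact: lt_trans p1. Qed.
Let p'0 : 0 < p'. Proof. exact: lt_trans (conj_exp_gt1 p1 pp'). Qed.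

Lemma mean_cont_phi (m e : R) : 0 < e -> exists2 d : R, 0 < d &
  forall h, sqnorm h <= d ->
    (\int[mu]_y (\1_(@sqball R n m) y * normc (phi (h + y) - phi y))%:E <= e%:E)%E.
Proof.
move=> e0; have e20 : 0 < e / 2 by rewrite divr_gt0.
(* The shift by M makes the real and imaginary parts nonnegative, as [mean_cont_real] requires, and
   cancels in differences. *)
pose r1 x := cRe (phi x) + M%:R; pose r2 x := cIm (phi x) + M%:R.
have mr1 : measurable_fun setT r1 by apply: measurable_funD => //; exact: mphi.1.
have mr2 : measurable_fun setT r2 by apply: measurable_funD => //; exact: mphi.2.
have bd (a : R) x : `|a| <= normc (phi x) -> 0 <= a + M%:R <= (M + M)%:R.
  move=> /le_trans/(_ (phiM x)); rewrite ler_norml => /andP[h1 h2].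
  by rewrite -lerBlDr sub0r h1 natrD lerD2r.
have [d1 d10 h1] := mean_cont_real mr1 (fun x => bd _ x (cRe_le_normc _)) m e20.
have [d2 d20 h2] := mean_cont_real mr2 (fun x => bd _ x (cIm_le_normc _)) m e20.
exists (Num.min d1 d2); first by rewrite lt_min d10.
move=> h; rewrite le_min => /andP[hd1 hd2].
have mh (r : X -> R) : measurable_fun setT r -> measurable_fun setT (fun y => r (h + y)).
  move=> mr; apply: (measurableT_comp mr); rewrite (_ : +%R h = (fun y => affine_rV h 1 y)).
    exact: measurable_affine_rV.
  by apply/funext => y; rewrite /affine_rV scale1r.
have mi : measurable_fun setT (\1_(@sqball R n m) : X -> R).
  by apply: measurable_indic; exact: measurable_sqball.
have mF (r : X -> R) : measurable_fun setT r ->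
    measurable_fun setT (fun y => \1_(@sqball R n m) y * `|r (h + y) - r y|).
  move=> mr; apply: measurable_funM => //; apply: measurableT_comp => //.
  by apply: measurable_funB => //; exact: mh.
rewrite (splitr e) EFinD; apply: le_trans (leeD (h1 h hd1) (h2 h hd2)).
rewrite -ge0_integralD//; try (by move=> y _; rewrite lee_fin mulr_ge0// indicE);
  try (by apply/measurable_EFinP; exact: mF).
apply: ge0_le_int => [||y|y].
- apply: measurable_funM => //; apply: cmeasurable_normc; apply: cmeasurable_add.
    by split; [exact: (mh _ mphi.1)|exact: (mh _ mphi.2)].
  exact: cmeasurableN.
- by apply: measurable_funD; exact: mF.
- by rewrite mulr_ge0 ?normc_ge0// indicE.
rewrite -mulrDr ler_wpM2l ?indicE//.
set w := phi (h + y) - phi y.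
have -> : r1 (h + y) - r1 y = cRe w by rewrite /r1 /w cReD cReN opprD addrACA subrr addr0.
have -> : r2 (h + y) - r2 y = cIm w by rewrite /r2 /w cImD cImN opprD addrACA subrr addr0.
exact: normc_le_ReIm.
Qed.

Let S : R := (Num.sqrt (cRe om))^-1 ^+ n.
Let S2 : R := Num.sqrt (2 / cRe om) ^+ n.

Let S0 : 0 <= S. Proof. by rewrite exprn_ge0// invr_ge0 sqrtr_ge0. Qed.
Let S20 : 0 <= S2. Proof. by rewrite exprn_ge0// sqrtr_ge0. Qed.

(** Half of the Gaussian exponent absorbs |w|^2 at the price 8 e / Re om, and the other half is a
    Gaussian whose mass with the amplitude is S2. The second moment is thus of order e, which makes
    the kernel concentrate at 0. *)
Lemma heatk_moment e : 0 < e ->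
  rintble mu (fun w => normc (K e w) * sqnorm w) /\
  \int[mu]_w (normc (K e w) * sqnorm w) <= 8 / cRe om * e * S2.
Proof.
move=> e0; set c := cRe om; have c0 : 0 < c := om0.
have A0 : 0 < c / (8 * e) by rewrite divr_gt0 ?mulr_gt0.
have [j ej] := @sqnorm_gauss_integral R n _ A0.
have le w : normc (K e w) * sqnorm w <=
    8 / c * e * heat_amp n e * expR (- (c / (8 * e) * sqnorm w)).
  rewrite /heatk normc_heat -/c; set N := sqnorm w.
  have N0 : 0 <= N by exact: sqnorm_ge0.
  have -> : expR (- (c / (4 * e) * N)) = expR (- (c / (8 * e) * N)) / expR (c / (8 * e) * N).
    by rewrite -expRN -expRD; congr expR; field; rewrite gt_eqF.
  set E := expR (- _); set F := expR (_ * N).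
  have F1 : c / (8 * e) * N <= F by apply: le_trans (expR_ge1Dx _); rewrite lerDr.
  have F0 : 0 < F by exact: expR_gt0.
  have h : N / F <= 8 / c * e.
    rewrite ler_pdivrMr//; have -> : N = 8 / c * e * (c / (8 * e) * N) by field; rewrite !gt_eqF.
    by rewrite ler_wpM2l// mulr_ge0 ?divr_ge0 ?ltW.
  have -> : heat_amp n e * (E / F) * N = (heat_amp n e * E) * (N / F) by ring.
  have -> : 8 / c * e * heat_amp n e * E = (heat_amp n e * E) * (8 / c * e) by ring.
  by apply: ler_wpM2l h; apply: mulr_ge0; [exact: heat_amp_ge0|exact: expR_ge0].
have jr := rintbleZ (8 / c * e * heat_amp n e) j.
have jl : rintble mu (fun w => normc (K e w) * sqnorm w).
  apply: (rintble_le _ jr) => [|w]; last by rewrite ger0_norm ?mulr_ge0 ?normc_ge0 ?sqnorm_ge0.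
  by apply: measurable_funM; [apply: cmeasurable_normc; exact: cmeasurable_heatk|exact: measurable_sqnorm].
split => //; apply: (le_trans (le_rint jl jr le)); rewrite (rintZ _ j) ej -!mulrA.
rewrite ler_wpM2l// ler_wpM2l ?invr_ge0 ?(ltW c0)// ler_wpM2l ?(ltW e0)//.
rewrite heat_ampE// -exprMn /S2 lerXn2r ?nnegrE ?mulr_ge0 ?invr_ge0 ?sqrtr_ge0//.
have q0 : 0 < 4 * pi * e by rewrite !mulr_gt0 ?pi_gt0.
rewrite -sqrtrV ?(ltW q0)// -sqrtrM ?invr_ge0 ?(ltW q0)// ler_wsqrtr//.
have id (P d f : R) : 0 < P -> 0 < d -> 0 < f -> (4 * P * f)^-1 * (P / (d / (8 * f))) = 2 / d.
  by move=> P0 d0 f0; field; rewrite !gt_eqF.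
by rewrite id ?pi_gt0.
Qed.

(** The difference is the double integral of (phi x - phi y) K(x - y) u(y). Here u is a truncated
    part plus a tail [u2] small in L_p. The tail is handled by Young's inequality, the truncated
    part by the mean continuity of phi for near points and by the second moment of the kernel for
    distant ones. *)
Lemma heat_form_approx (delta : R) : 0 < delta -> exists2 e0 : R, 0 < e0 &
  forall e, 0 < e -> e <= e0 ->
    normc (heat_form om e phi u - cint mu (K e) * cint mu (fun y => phi y * u y)) <= delta.
Proof.
move=> dl0; pose A := \int[mu]_x normc (phi x) `^ p'.
have A0 : 0 <= A by apply: Rintegral_ge0 => x _; exact: powR_ge0.
have S1 : 0 < S + 1 by rewrite ltr_wpDl.
have A1 : 0 < A + 1 by rewrite ltr_wpDl.
(* Below, phi is multiplied by d1 and the tail by 1/d1, which leaves their product unchanged. The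
   choice d1^p' = B makes the share of phi at most delta / 8; the tolerance e1 for the tail then
   compensates the factor d1^(-p). *)
pose B := delta / (8 * ((A + 1) * (S + 1))).
have B0 : 0 < B by apply: divr_gt0 => //; do ?apply: mulr_gt0.
pose d1 := B `^ p'^-1; have d10 : 0 < d1 by rewrite powR_gt0.
have d1p : d1 `^ p' = B by rewrite /d1 -powRrM mulVf ?gt_eqF// powRr1// ltW.
pose T m := \int[mu]_y ((1 - cut_ind u m y) * normc (u y) `^ p).
pose e1 := d1 `^ p * (delta / (8 * (S + 1))).
have e10 : 0 < e1 by apply: mulr_gt0; [exact: powR_gt0|apply: divr_gt0 => //; exact: mulr_gt0].
have [m Tm] : exists m, T m <= e1.
  have /cvgr0Pnorm_le/(_ _ e10) [N _ hN] := cut_tail_cvg0 mu_ ju.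
  by exists N; apply: le_trans (ler_norm _) _; exact: (hN N (leqnn N)).
pose u2 y := (1 - cut_ind u m y)%:C%C * u y.
have ci01 y := cut_ind01 u m y.
have u2p y : normc (u2 y) `^ p = (1 - cut_ind u m y) * normc (u y) `^ p.
  rewrite /u2 Normc.normcM normc_real /cut_ind; case: (_ && _).
    by rewrite subrr normr0 !mul0r powR0// gt_eqF.
  by rewrite subr0 normr1 !mul1r.
have mci := measurable_cut_ind m mu_.
have mu2 : cmeasurable u2 by apply: cmeasurableM => //; apply: cmeasurable_real; exact: measurable_funB.
have ju2 : rintble mu (fun y => normc (u2 y) `^ p).
  apply: (rintble_le _ ju) => [|y].
    rewrite (funext u2p); apply: measurable_funM; last exact: rintble_measurable ju.
    exact: measurable_funB.
  by rewrite ger0_norm ?powR_ge0// u2p ler_piMl ?powR_ge0// gerBl; have /andP[] := ci01 y.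
pose m1 : R := m%:R + 1; have m10 : 0 < m1 by rewrite ltr_wpDl.
pose e2 := delta / (8 * m1 * (S + 1)).
have e20 : 0 < e2 by apply: divr_gt0 => //; do ?apply: mulr_gt0.
have [d d0 hd] := mean_cont_phi m%:R e20.
set V := fine (mu (@sqball R n m%:R)); have V0 : 0 <= V by exact: fine_ge0.
(* W - 1 is the factor of e in the estimate of the distant part |w|^2 > d; the additional 1 keeps W
   positive. *)
pose W := m1 * (2 * M%:R * V) * (8 / cRe om * S2) / d + 1.
have W0 : 0 < W.
  by rewrite ltr_wpDl// divr_ge0 ?(ltW d0)// !mulr_ge0 ?(ltW m10) ?invr_ge0 ?(ltW om0).
exists (delta / (8 * W)); first by rewrite divr_gt0// mulr_gt0.
move=> e ee0 eW.
have [jK eK] := cintble_heatk n om0 ee0; have mK := jK.1.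
have K0 w : 0 <= normc (K e w) by exact: normc_ge0.
have mKz : cmeasurable (fun z : X * X => K e (z.1 - z.2)).
  by apply: (cmeasurable_comp _ mK); exact: measurable_sub.
have mKn := cmeasurable_normc mKz.
have mp1 : cmeasurable (fun z : X * X => phi z.1) by exact: (cmeasurable_comp _ mphi).
have mp2 : cmeasurable (fun z : X * X => phi z.2) by exact: (cmeasurable_comp _ mphi).
have mu2' : cmeasurable (fun z : X * X => u z.2) by exact: (cmeasurable_comp _ mu_).
have [jF1 _] := young_conv p1 pp' mphi mu_ jphi ju jK.2 K0.
have cF1 : cintble (mu \x mu)%E (fun z => phi z.1 * K e (z.1 - z.2) * u z.2).
  apply: (cintble_le _ jF1) => [|z]; last by rewrite !Normc.normcM.
  by apply: cmeasurableM => //; exact: cmeasurableM.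
have jpu := young_mul p1 pp' mphi mu_ jphi ju.
have cpu : cintble mu (fun y => phi y * u y).
  by apply: (cintble_le _ jpu) => [|y]; [exact: cmeasurableM|rewrite Normc.normcM].
have [jF2 _] := int_conv2 jpu jK.2 (fun x => mulr_ge0 (normc_ge0 _) (normc_ge0 _)) K0.
have cF2 : cintble (mu \x mu)%E (fun z => phi z.2 * K e (z.1 - z.2) * u z.2).
  apply: (cintble_le _ jF2) => [|z]; last by rewrite !Normc.normcM mulrAC.
  by apply: cmeasurableM => //; exact: cmeasurableM.
have eF2 : cint (mu \x mu)%E (fun z => phi z.2 * K e (z.1 - z.2) * u z.2) =
    cint mu (K e) * cint mu (fun y => phi y * u y).
  rewrite -(cfubini2 cF2) -(cintZ _ cpu); congr cint; apply/funext => y /=.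
  rewrite (cint_push (m1 := mu) (m2 := mu) (measurable_sub1 y) (push_subl y) _ mK) mulrC.
  have j := iffRL (cintble_push (m1 := mu) (m2 := mu) (measurable_sub1 y) (push_subl y) _ mK) jK.
  rewrite -(cintZ _ j); congr cint; apply/funext => x; by rewrite mulrAC.
rewrite -eF2 /heat_form -(cintB cF1 cF2).
pose D (z : X * X) := normc (phi z.1 - phi z.2) * normc (K e (z.1 - z.2)).
have cD := cintbleD cF1 (cintbleN cF2).
apply: (le_trans (normc_cint cD)).
(* From |u| <= |u2| + m1 on the ball and |u| <= |u2| outside: [G1] and [G2] bound the terms of phi x
   and phi y against the tail, [G3] bounds the truncated part. *)
pose G1 (z : X * X) := normc (d1%:C%C * phi z.1) * normc (K e (z.1 - z.2)) * normc (d1^-1%:C%C * u2 z.2).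
pose G2 (z : X * X) := normc (d1%:C%C * phi z.2) * normc (d1^-1%:C%C * u2 z.2) * normc (K e (z.1 - z.2)).
pose G3 (z : X * X) := m1 * (\1_(@sqball R n m%:R) z.2 * D z).
have mdphi : cmeasurable (fun x => d1%:C%C * phi x).
  by apply: cmeasurableM => //; exact: cmeasurable_cst.
have mdu : cmeasurable (fun x => d1^-1%:C%C * u2 x).
  by apply: cmeasurableM => //; exact: cmeasurable_cst.
have pdphi x : normc (d1%:C%C * phi x) `^ p' = B * normc (phi x) `^ p'.
  by rewrite Normc.normcM normc_real gtr0_norm// powRM ?normc_ge0 ?(ltW d10)// d1p.
have pdu x : normc (d1^-1%:C%C * u2 x) `^ p = (d1 `^ p)^-1 * normc (u2 x) `^ p.
  rewrite Normc.normcM normc_real gtr0_norm ?invr_gt0// powRM ?normc_ge0 ?invr_ge0 ?(ltW d10)//.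
  by congr (_ * _); rewrite -powR_inv1 ?(ltW d10)// -powRrM mulN1r powRN.
have jdphi : rintble mu (fun x => normc (d1%:C%C * phi x) `^ p').
  by rewrite (funext pdphi); exact: rintbleZ.
have jdu : rintble mu (fun x => normc (d1^-1%:C%C * u2 x) `^ p).
  by rewrite (funext pdu); exact: rintbleZ.
have bsum : (\int[mu]_x normc (d1%:C%C * phi x) `^ p' + \int[mu]_x normc (d1^-1%:C%C * u2 x) `^ p) * S
    <= delta / 4.
  rewrite (funext pdphi) (funext pdu) (rintZ _ jphi) (rintZ _ ju2) -/A.
  have -> : \int[mu]_x normc (u2 x) `^ p = T m by rewrite (funext u2p).
  have b1 : B * A * S <= delta / 8.
    have -> : delta / 8 = B * ((A + 1) * (S + 1)).
      by rewrite /B; move: A1 S1; move: (A + 1) (S + 1) => a1 s1 a10 s10; field; rewrite !gt_eqF.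
    by rewrite -mulrA ler_wpM2l ?(ltW B0)// ler_pM// lerDl.
  have b2 : (d1 `^ p)^-1 * T m * S <= delta / 8.
    apply: (@le_trans _ _ ((d1 `^ p)^-1 * e1 * (S + 1))).
      have T0 : 0 <= T m.
        by apply: Rintegral_ge0 => y _; rewrite mulr_ge0 ?powR_ge0// subr_ge0; have /andP[] := ci01 y.
      rewrite ler_pM ?mulr_ge0 ?invr_ge0 ?powR_ge0 ?lerDl// ler_wpM2l ?invr_ge0 ?powR_ge0//.
    rewrite le_eqVlt; apply/orP; left; apply/eqP; rewrite /e1; set q := d1 `^ p.
    have q0 : q != 0 by rewrite gt_eqF// powR_gt0.
    by move: S1; move: (S + 1) => s1 s10; field; rewrite q0 gt_eqF.
  by rewrite mulrDl; lra.
have [jG1 iG1] := young_conv p1 pp' mdphi mdu jdphi jdu jK.2 K0.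
have bG1 : \int[(mu \x mu)%E]_z G1 z <= delta / 4.
  by apply: (le_trans iG1); rewrite eK -/S; exact: bsum.
have jdd := young_mul p1 pp' mdphi mdu jdphi jdu.
have [jG2 iG2] := int_conv2 jdd jK.2 (fun x => mulr_ge0 (normc_ge0 _) (normc_ge0 _)) K0.
have bG2 : \int[(mu \x mu)%E]_z G2 z <= delta / 4.
  rewrite /G2 iG2 eK -/S; apply: le_trans bsum; rewrite ler_wpM2r// -(rintD jdphi jdu).
  by apply: le_rint => // [|x]; [exact: rintbleD|exact: (young_le p1 pp' (normc_ge0 _) (normc_ge0 _))].
have phi2M (x y : X) : normc (phi x - phi y) <= 2 * M%:R.
  by apply: (le_trans (ler_normcD _ _)); rewrite normcN mulr_natl mulr2n; apply: lerD.
have D2M z : D z <= 2 * M%:R * normc (K e (z.1 - z.2)).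
  by rewrite /D; apply: ler_wpM2r => //; exact: phi2M.
have mB := @measurable_sqball R n m%:R.
have jB : rintble mu (\1_(@sqball R n m%:R) : X -> R) /\ \int[mu]_y (\1_(@sqball R n m%:R) y : R) = V.
  have E : (\int[mu]_y (\1_(@sqball R n m%:R) y : R)%:E = mu (@sqball R n m%:R))%E.
    by rewrite integral_indic ?setIT.
  split; last by rewrite /Rintegral E.
  by apply: rintbleP; [exact: measurable_indic|move=> x; rewrite indicE|rewrite E; exact: sqball_fin].
have i0 (y : X) : 0 <= (\1_(@sqball R n m%:R) y : R) by rewrite indicE.
have [jBK _] := int_conv2 jB.1 jK.2 i0 K0.
have D0 z : 0 <= D z by rewrite mulr_ge0 ?normc_ge0.
have mD : measurable_fun setT D.
  apply: measurable_funM => //; apply: cmeasurable_normc; apply: cmeasurable_add => //.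
  exact: cmeasurableN.
have mi2 : measurable_fun setT (fun z : X * X => \1_(@sqball R n m%:R) z.2 : R).
  by apply: (measurableT_comp (f := \1_(@sqball R n m%:R) : X -> R)) => //; exact: measurable_indic.
have jBD : rintble (mu \x mu)%E (fun z => \1_(@sqball R n m%:R) z.2 * D z).
  apply: (rintble_le _ (rintbleZ (2 * M%:R) jBK)) => [|z]; first exact: measurable_funM.
  rewrite [leLHS]ger0_norm; last exact: mulr_ge0.
  by rewrite [leRHS]mulrCA; exact: ler_wpM2l.
have jG3 : rintble (mu \x mu)%E G3 by exact: rintbleZ.
have bBD : m1 * \int[(mu \x mu)%E]_z (\1_(@sqball R n m%:R) z.2 * D z) <= delta / 4.
  have [jm em] := heatk_moment ee0.
  (* The variable w = x - y replaces x, so that the inner integral in y becomes the mean increment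
     of phi under the shift w. *)
  pose F (z : X * X) := \1_(@sqball R n m%:R) z.2 * (normc (phi (z.1 + z.2) - phi z.2) * normc (K e z.1)).
  have jt := rintble_tensor jK.2 jB.1.
  have mpa : cmeasurable (fun z : X * X => phi (z.1 + z.2)).
    by apply: (cmeasurable_comp _ mphi); exact: measurable_add.
  have jF : rintble (mu \x mu)%E F.
    apply: (rintble_le _ (rintbleZ (2 * M%:R) jt)) => [|z].
      apply: measurable_funM => //; apply: measurable_funM.
        by apply: cmeasurable_normc; apply: cmeasurable_add => //; exact: cmeasurableN.
      exact: (measurableT_comp (cmeasurable_normc mK)).
    rewrite [leLHS]ger0_norm; last by rewrite !mulr_ge0 ?normc_ge0.
    have -> : F z = normc (phi (z.1 + z.2) - phi z.2) * (normc (K e z.1) * \1_(@sqball R n m%:R) z.2).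
      by rewrite /F mulrC -mulrA.
    by apply: ler_wpM2r; [exact: mulr_ge0|exact: phi2M].
  have -> : \int[(mu \x mu)%E]_z (\1_(@sqball R n m%:R) z.2 * D z) = \int[(mu \x mu)%E]_z F z.
    have [_ <-] := rfubini2 jBD; have [_ <-] := rfubini2 jF.
    apply: eq_Rintegral => y _ /=.
    have mf : measurable_fun setT (fun x => F (x, y)).
      exact: (measurableT_comp (rintble_measurable jF) (pair2_measurable y)).
    rewrite (rint_push (m1 := mu) (m2 := mu) (measurable_sub1 y) (push_subl y) (fun x => F (x, y)) mf).
    by apply: eq_Rintegral => x _; rewrite /F /D /= subrK.
  have [jg <-] := rfubini1 jF.
  have jr := rintbleD (rintbleZ e2 jK.2) (rintbleZ (2 * M%:R * V / d) jm).
  have ineq w : \int[mu]_y F (w, y) <= e2 * normc (K e w) + 2 * M%:R * V / d * (normc (K e w) * sqnorm w).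
    have jh : rintble mu (fun y => \1_(@sqball R n m%:R) y * normc (phi (w + y) - phi y)).
      apply: (rintble_le _ (rintbleZ (2 * M%:R) jB.1)) => [|y].
        apply: measurable_funM; first exact: measurable_indic.
        apply: cmeasurable_normc; apply: cmeasurable_add; last exact: cmeasurableN.
        apply: (cmeasurable_comp _ mphi); rewrite (_ : +%R w = (fun y => affine_rV w 1 y)).
          exact: measurable_affine_rV.
        by apply/funext => y; rewrite /affine_rV scale1r.
      rewrite [leLHS]ger0_norm; last by rewrite mulr_ge0 ?normc_ge0.
      by rewrite [leLHS]mulrC; apply: ler_wpM2r => //; exact: phi2M.
    have -> : \int[mu]_y F (w, y) =
        normc (K e w) * \int[mu]_y (\1_(@sqball R n m%:R) y * normc (phi (w + y) - phi y)).
      by rewrite -(rintZ _ jh); apply: eq_Rintegral => y _; rewrite [RHS]mulrC -[RHS]mulrA.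
    (* For small w this is the mean continuity of phi. For large w the increment is at most 2 M and
       1 < |w|^2 / d, which brings in the second moment. *)
    have [wd|wd] := leP (sqnorm w) d.
      apply: (@le_trans _ _ (e2 * normc (K e w))); last first.
        by rewrite lerDl !mulr_ge0 ?invr_ge0 ?(ltW d0) ?sqnorm_ge0.
      by rewrite mulrC ler_wpM2r// -lee_fin EFin_rint// hd.
    apply: (@le_trans _ _ (normc (K e w) * (2 * M%:R * V))).
      rewrite ler_wpM2l// -jB.2 -(rintZ _ jB.1); apply: le_rint => // [|y]; first exact: (rintbleZ _ jB.1).
      by rewrite [leLHS]mulrC; apply: ler_wpM2r => //; exact: phi2M.
    apply: (@le_trans _ _ (2 * M%:R * V / d * (normc (K e w) * sqnorm w))); last first.
      by rewrite lerDr mulr_ge0 ?(ltW e20).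
    have -> : normc (K e w) * (2 * M%:R * V) = 2 * M%:R * V / d * (normc (K e w) * d).
      by field; rewrite gt_eqF.
    rewrite ler_wpM2l ?mulr_ge0 ?invr_ge0 ?(ltW d0)// ler_wpM2l// ltW//.
  have h1 := le_rint jg jr ineq.
  apply: (@le_trans _ _ (m1 * (e2 * S + 2 * M%:R * V / d * (8 / cRe om * e * S2)))).
    rewrite ler_wpM2l ?(ltW m10)//; apply: (le_trans h1).
    rewrite (rintD (rintbleZ e2 jK.2) (rintbleZ _ jm)) (rintZ _ jK.2) (rintZ _ jm) eK -/S lerD2l.
    by rewrite ler_wpM2l ?mulr_ge0 ?invr_ge0 ?(ltW d0).
  have b1 : m1 * (e2 * S) <= delta / 8.
    have -> : delta / 8 = m1 * (e2 * (S + 1)) by rewrite /e2; move: S1; move: (S + 1) => s1 s10; field; rewrite !gt_eqF.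
    by rewrite ler_wpM2l ?(ltW m10)// ler_wpM2l ?(ltW e20)// lerDl.
  have b2 : m1 * (2 * M%:R * V / d * (8 / cRe om * e * S2)) <= delta / 8.
    have -> : m1 * (2 * M%:R * V / d * (8 / cRe om * e * S2)) = (W - 1) * e.
      by rewrite /W; field; rewrite !gt_eqF.
    apply: (@le_trans _ _ (W * (delta / (8 * W)))); last first.
      by rewrite le_eqVlt; apply/orP; left; apply/eqP; field; rewrite gt_eqF.
    rewrite ler_pM ?(ltW ee0)//; last by rewrite gerBl.
    by rewrite /W addrK divr_ge0 ?(ltW d0)// !mulr_ge0 ?(ltW m10) ?invr_ge0 ?(ltW om0).
  rewrite mulrDr (_ : delta / 4 = delta / 8 + delta / 8); first exact: lerD.
  by field.
have jG := rintbleD (rintbleD jG1 jG2) jG3.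
apply: (@le_trans _ _ (\int[(mu \x mu)%E]_z (G1 z + G2 z + G3 z))).
  apply: le_rint => [||z]; [exact: cD.2|exact: jG|].
  rewrite -!mulrA -mulrBl Normc.normcM Normc.normcM.
  have sp : normc (u z.2) <= normc (u2 z.2) + m1 * \1_(@sqball R n m%:R) z.2.
    rewrite /u2 Normc.normcM normc_real /cut_ind indicE.
    have [/andP[a1 a2]|_] := boolP (_ && _); last first.
      by rewrite subr0 normr1 mul1r lerDl mulr_ge0 ?(ltW m10).
    rewrite subrr normr0 mul0r add0r mem_set// mulr1 (le_trans a1)// lerDl//.
  have cancel (a b : R[i]) : normc (d1%:C%C * a) * normc (d1^-1%:C%C * b) = normc a * normc b.
    rewrite !Normc.normcM !normc_real !gtr0_norm ?invr_gt0// mulrACA mulfV ?gt_eqF// mul1r//.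
  rewrite /G1 /G2 /G3 [X in _ <= X + _ + _]mulrAC !cancel /D.
  set k := normc (K e _); set q := normc (phi z.1 - phi z.2).
  have qle : q <= normc (phi z.1) + normc (phi z.2) by rewrite /q (le_trans (ler_normcD _ _))// normcN.
  apply: (@le_trans _ _ (q * (k * (normc (u2 z.2) + m1 * \1_(@sqball R n m%:R) z.2)))).
    by rewrite ler_wpM2l ?normc_ge0// ler_wpM2l// K0.
  rewrite mulrDr mulrDr; apply: lerD; last first.
    by rewrite le_eqVlt; apply/orP; left; apply/eqP; ring.
  rewrite -!mulrDl [leRHS]mulrAC -mulrA; apply: ler_wpM2r => //.
  by rewrite mulr_ge0 ?normc_ge0 ?K0.
rewrite (rintD (rintbleD jG1 jG2) jG3) (rintD jG1 jG2) (rintZ _ jBD).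
apply: le_trans (lerD (lerD bG1 bG2) bBD) _.
rewrite -mulr2n -mulrSr -[leLHS]mulr_natr -mulrA ler_piMr ?(ltW dl0)//.
by rewrite mulrC ler_pdivrMr// mul1r ler_nat.
Qed.

End approximate_identity.

(** * The gamma function *)

Section gamma_function.
Context {R : realType}.
Local Notation leb := (@lebesgue_measure R).
Variables (al : R) (al0 : 0 < al) (al1 : al <= 1).

Let f (t : R) : R := t `^ (al - 1) * expR (- t).
(** This is (t / (1 + t))^al / al, bounded by 1 / al for t > 0. Its derivative h behaves like t^(al
    - 1) at 0 and like t^(-2) at infinity, so a multiple of it majorizes the Gamma integrand and has
    an explicit primitive. *)
Let H (t : R) : R := al^-1 * (1 - (1 + t)^-1) `^ al.
Let h (t : R) : R := (1 - (1 + t)^-1) `^ (al - 1) * (1 + t) ^- 2.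

Let f0 t : 0 <= f t. Proof. by rewrite mulr_ge0 ?powR_ge0 ?expR_ge0. Qed.

Let base_gt0 (t : R) : 0 < t -> 0 < 1 - (1 + t)^-1.
Proof. by move=> t0; rewrite subr_gt0 invf_lt1 ?ltrDl ?addr_gt0. Qed.

Let dH (t : R) : 0 < t -> is_derive t 1 H (h t).
Proof.
move=> t0; have t1 : 1 + t != 0 by rewrite gt_eqF ?addr_gt0.
have d1 : is_derive t 1 (fun y : R => 1 + y) 1.
  by apply: (is_derive_val _ (is_deriveD (is_derive_cst (1 : R) t (1 : R)) (is_derive_id t 1))); rewrite add0r.
have d2 : is_derive t 1 (fun y : R => (1 + y)^-1) (- (1 + t) ^- 2).
  by apply: (is_derive_val _ (is_deriveV t1 d1)); rewrite [LHS]mulr1.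
have d3 := is_derive_sub (is_derive_cst (1 : R) t (1 : R)) d2.
have d4 := is_derive_comp (f := fun y : R => 1 - (1 + y)^-1)
  (is_derive1_powR al (base_gt0 t0)) d3.
apply: (is_derive_val _ (is_derive_scale al^-1 d4)).
by rewrite /h sub0r opprK !mulrA mulVf ?mul1r// gt_eqF.
Qed.

Let powR_decr (x y : R) : 0 < x -> x <= y -> y `^ (al - 1) <= x `^ (al - 1).
Proof.
move=> x0 xy; have y0 := lt_le_trans x0 xy.
rewrite -(opprB 1 al) !powRN lef_pV2 ?posrE ?powR_gt0//.
by rewrite ge0_ler_powR ?nnegrE ?subr_ge0 ?(ltW x0) ?(ltW y0).
Qed.

(** The constant 4 comes from (1 + t)^2 <= 4 exp t, a consequence of 1 + t / 2 <= exp(t / 2). The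
    power is compared through t / (1 + t) <= t and al - 1 <= 0. *)
Let f_le (t : R) : 0 < t -> f t <= 4 * h t.
Proof.
move=> t0; have t1 : 0 < 1 + t by rewrite addr_gt0.
have -> : 4 * h t = (1 - (1 + t)^-1) `^ (al - 1) * (4 * (1 + t) ^- 2) by rewrite /h mulrCA.
apply: ler_pM; rewrite ?powR_ge0 ?expR_ge0//.
  apply: powR_decr; first exact: base_gt0.
  have -> : 1 - (1 + t)^-1 = t / (1 + t) by field; rewrite gt_eqF.
  by rewrite ler_pdivrMr// ler_peMr ?(ltW t0)// lerDl (ltW t0).
rewrite ler_pdivlMr ?exprn_gt0// expRN mulrC ler_pdivrMr ?expR_gt0//.
have -> : expR t = expR (t / 2) ^+ 2 by rewrite -expRM_natl; congr expR; field.
have := expR_ge1Dx (t / 2); have := expR_gt0 (t / 2); move: (expR _) => e e0 e1.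
by nra.
Qed.

Lemma Gamma_integrable : leb.-integrable `]0, +oo[%classic (EFin \o f).
Proof.
have mf : measurable_fun setT f.
  by apply: measurable_funM; [exact: measurable_powR|exact: measurableT_comp].
apply/integrableP; split; first exact/measurable_EFinP/measurable_funTS.
under eq_integral do rewrite /= ger0_norm ?f0//.
(* Compact intervals exhausting the half-line, on which the fundamental theorem of calculus applies.
   The additional 1 at the right end keeps the interval nondegenerate at i = 0. *)
pose F i : set (measurableTypeR R) := `[(i.+1%:R)^-1 : R, i.+1%:R + 1]%classic.
have Fpos i x : F i x -> 0 < x.
  by rewrite /F /= in_itv/= => /andP[h1 _]; apply: lt_le_trans h1; rewrite invr_gt0.
have FU : `]0, +oo[%classic = \bigcup_i F i :> set R.
  apply/seteqP; split=> x; last first.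
    by move=> [i _ /Fpos]; rewrite /= in_itv/= andbT.
  rewrite /= in_itv/= andbT => x0.
  pose k := maxn (Num.truncn x^-1).+1 (Num.truncn x).+1.
  exists k => //; rewrite /F /= in_itv/=; apply/andP; split.
    rewrite -[leRHS]invrK lef_pV2 ?posrE ?invr_gt0//.
    have xi0 : 0 <= x^-1 by rewrite invr_ge0 ltW.
    have /andP[_ h1] := truncn_itv xi0.
    by apply: (le_trans (ltW h1)); rewrite ler_nat ltnW// ltnS leq_maxl.
  have /andP[_ h1] := truncn_itv (ltW x0); apply: (le_trans (ltW h1)).
  by rewrite ler_wpDr// ler_nat ltnW// ltnS leq_maxr.
have cv := @ge0_nondecreasing_set_cvg_integral _ _ R F (fun t => (f t)%:E) leb.
rewrite FU; apply: (@le_lt_trans _ _ (4 / al)%:E); last exact: ltry.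
have Fnd : nondecreasing_seq F.
  move=> i j ij; apply/subsetPset => x; rewrite /F /= !in_itv/= => /andP[h1 h2]; apply/andP; split.
    by apply: le_trans h1; rewrite lef_pV2 ?posrE// ler_nat.
  by apply: (le_trans h2); rewrite lerD2r ler_nat.
rewrite -(cvg_lim (@ereal_hausdorff R) (cv Fnd _ _ _))//=; last first.
- by move=> i x _; rewrite lee_fin.
- move=> i; exact/measurable_EFinP/measurable_funTS.
- by move=> i; exact: measurable_itv.
apply: lime_le.
  apply/cvg_ex; eexists; apply: cv => //; first by move=> i; exact: measurable_itv.
    by move=> i; exact/measurable_EFinP/measurable_funTS.
  by move=> i x _; rewrite lee_fin.
apply: nearW => i; set a : R := (i.+1%:R)^-1; set b : R := i.+1%:R + 1.
have a0 : 0 < a by rewrite invr_gt0.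
have ab : a < b.
  by apply: (@le_lt_trans _ _ 1); [rewrite /a invf_le1// ler1n|rewrite /b ltrDr].
have Hc t : 0 < t -> {for t, continuous H} by move=> /dH; exact: is_derive_continuous.
have hc t : 0 < t -> {for t, continuous h}.
  move=> t0; have t1 : 1 + t != 0 by rewrite gt_eqF ?addr_gt0.
  have c1 : {for t, continuous (fun y : R => 1 + y)}.
    by apply: continuousD; [exact: cst_continuous|exact: cvg_id].
  have c2 : {for t, continuous (fun y : R => (1 + y)^-1)} by exact: continuousV.
  apply: continuousM.
    apply: (@continuous_comp _ _ _ (fun y : R => 1 - (1 + y)^-1) (fun y => y `^ (al - 1))).
      by apply: continuousB => //; exact: cst_continuous.
    exact: is_derive_continuous (is_derive1_powR _ (base_gt0 t0)).
  rewrite (_ : (fun y => (1 + y) ^- 2) = (fun y : R => (1 + y)^-1 * (1 + y)^-1)); last first.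
    by apply/funext => y; rewrite -invfM -expr2.
  exact: continuousM.
have hw : {within `[a, b], continuous h}.
  apply: continuous_in_subspaceT => x; rewrite inE /= in_itv/= => /andP[ax _].
  by apply: hc; exact: lt_le_trans ax.
have ftc : (\int[leb]_(x in `[a, b]) (h x)%:E = (H b)%:E - (H a)%:E)%E.
  apply: continuous_FTC2 => //.
  - split.
    + move=> x; rewrite in_itv/= => /andP[ax _].
      by have [] := dH (lt_trans a0 ax).
    + by apply: cvg_at_right_filter; exact: Hc.
    + by apply: cvg_at_left_filter; apply: Hc; exact: lt_trans ab.
  - move=> x; rewrite in_itv/= => /andP[ax _]; rewrite derive1E.
    by have [_ ->] := dH (lt_trans a0 ax).
have mh : measurable_fun (`[a, b]%classic : set R) h.
  by apply: subspace_continuous_measurable_fun => //; exact: measurable_itv.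
apply: (@le_trans _ _ (\int[leb]_(x in `[a, b]) (4 * h x)%:E)%E).
  apply: ge0_le_integral; first exact: measurable_itv.
  - by move=> x _; rewrite lee_fin f0.
  - exact/measurable_EFinP/measurable_funTS.
  - by apply/measurable_EFinP; exact: measurable_funM.
  - by move=> x Fx; rewrite lee_fin; apply: f_le; exact: Fpos Fx.
under eq_integral do rewrite EFinM.
rewrite ge0_integralZl//=; last 2 first.
- exact/measurable_EFinP.
- by move=> x _; rewrite lee_fin mulr_ge0 ?powR_ge0 ?invr_ge0 ?sqr_ge0.
rewrite ftc -EFinB -EFinM lee_fin ler_wpM2l//.
have Ha : 0 <= H a by rewrite mulr_ge0 ?invr_ge0 ?powR_ge0 ?(ltW al0).
apply: (@le_trans _ _ (H b)); first by rewrite gerBl.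
have b0 := lt_trans a0 ab.
rewrite /H -[leRHS]mulr1 ler_wpM2l ?invr_ge0 ?(ltW al0)//.
apply: (@le_trans _ _ (1 `^ al)); last by rewrite powR1.
apply: ge0_ler_powR; rewrite ?nnegrE ?(ltW al0) ?(ltW (base_gt0 b0))//.
by rewrite gerBl invr_ge0 addr_ge0 ?(ltW b0).
Qed.

(** The incomplete Gamma function. Its derivative and the bounds by 0 and Gamma(al) are all that the
    comparison argument in [Bf_le] asks of it. *)
Lemma Gamma_primitive : exists V : R -> R,
  [/\ forall r : R, 0 < r -> is_derive r 1 V (r `^ (al - 1) * expR (- r)),
      forall r, 0 <= V r & forall r, V r <= Gamma al].
Proof.
have jf := Gamma_integrable.
exists (fun r => \int[leb]_(t in [set` Interval (BRight 0) (BRight r)]) f t).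
have mf : measurable_fun setT f.
  by apply: measurable_funM; [exact: measurable_powR|exact: measurableT_comp].
have sub (r : R) : [set` Interval (BRight 0) (BRight r)] `<=` `]0, +oo[%classic.
  by move=> x; rewrite /= !in_itv/= andbT => /andP[].
split=> [r r0|r|r].
- have ji : leb.-integrable [set` Interval (BRight 0) (BRight (r + 1))] (EFin \o f).
    by apply: (integrableS _ _ _ jf); [exact: measurable_itv|exact: measurable_itv|exact: sub].
  have fc : {for r, continuous f}.
    apply: continuousM; first exact: is_derive_continuous (is_derive1_powR _ r0).
    apply: (@continuous_comp _ _ _ (fun y : R => - y) expR); last exact: continuous_expR.
    by apply: continuousN; exact: cvg_id.
  have [] := @continuous_FTC1 R f (BRight 0) r (r + 1) _ ji _ fc.
  + by rewrite ltrDl.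
  + exact: r0.
  + by move=> d e; constructor; [exact: d|rewrite -derive1E; exact: e].
- by apply: Rintegral_ge0 => x _; exact: f0.
- rewrite /Gamma /Rintegral; apply: fine_le.
  + apply: integrable_fin_num; first exact: measurable_itv.
    by apply: (integrableS _ _ _ jf); [exact: measurable_itv|exact: measurable_itv|exact: sub].
  + exact: integrable_fin_num.
  + apply: ge0_subset_integral => //; first exact/measurable_EFinP/measurable_funTS.
    by move=> x _; rewrite lee_fin.
Qed.

End gamma_function.

(** * The resolvent in complex time *)

Lemma is_derive_cRe_cexp {R : realType} (w : R[i]) (f g : R -> R) (t df dg : R) :
  is_derive t 1 f df -> is_derive t 1 g dg ->
  is_derive t 1 (fun s => cRe (w * cexp (Complex (f s) (g s))))
    (cRe (w * cexp (Complex (f t) (g t)) * Complex df dg)).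
Proof.
move=> hf hg.
have E s : cRe (w * cexp (Complex (f s) (g s))) =
    expR (f s) * (cRe w * cos (g s) - cIm w * sin (g s)).
  by rewrite cReM /cexp /=; ring.
rewrite (funext E).
have de := is_derive_comp (is_derive_expR (f t)) hf.
have dc := is_derive_scale (cRe w) (is_derive_comp (is_derive_cos (g t)) hg).
have ds := is_derive_scale (cIm w) (is_derive_comp (is_derive_sin (g t)) hg).
apply: (is_derive_val _ (is_derive_mul de (is_derive_sub dc ds))).
by rewrite /cexp !(cReM, cImM) /=; ring.
Qed.

Lemma sqnormC {R : realType} n (x y : 'rV[R]_n) : sqnorm (x - y) = sqnorm (y - x).
Proof. by apply: eq_bigr => i _; rewrite !mxE -sqrrN opprB. Qed.

Lemma cmeasurable_sumf d (T : measurableType d) (R : realType) (I : Type) (r : seq I)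
    (f : I -> T -> R[i]) : (forall i, cmeasurable (f i)) ->
  cmeasurable (fun x => \sum_(i <- r) f i x).
Proof.
move=> mf; elim: r => [|i r ih].
  by under eq_fun do [rewrite big_nil]; exact: cmeasurable_cst.
by under eq_fun do [rewrite big_cons]; exact: cmeasurable_add.
Qed.

Section resolvent_pairing.
Context {R : realType} (n : nat) (om lam : R[i]).
Hypotheses (om1 : normc om = 1) (om0 : 0 < cRe om).
Local Notation mu := (@lebesgue_Rn R n).
Local Notation X := ('rV[R]_n).
Local Notation K e := (@heatk R n om e).
Variable c : R.
Hypotheses (c0 : 0 < c) (cE : cRe (lam * (om^*)%C) = - c).

(** The factor e^(lambda z) at z = s / om, where 1 / om is the conjugate of om; its modulus is exp(-
    c s). *)
Let E (s : R) : R[i] := cexp (lam * (om^*)%C * s%:C%C).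

Let normc_E s : normc (E s) = expR (- (c * s)).
Proof. by rewrite normc_cexp cReM cE /= mulr0 subr0 mulNr. Qed.

(* logarithmic derivative of s |-> E s * heat om n s N *)
Let D (s N : R) : R[i] :=
  lam * (om^*)%C - (n%:R / (2 * s))%:C%C + om * (N / (4 * s ^+ 2))%:C%C.

Let is_derive_kernel (w : R[i]) (N s : R) : 0 < s ->
  is_derive s 1 (fun s => cRe (w * (E s * heat om n s N))) (cRe (w * (E s * heat om n s N) * D s N)).
Proof.
move=> s0; set l := lam * (om^*)%C.
pose f (s : R) := cRe l * s - n%:R / 2 * ln (4 * pi * s) - cRe om * (N / (4 * s)).
pose g (s : R) := cIm l * s - cIm om * (N / (4 * s)).
have rC (z : R[i]) (r : R) : cRe (z * r%:C%C) = cRe z * r by rewrite cReM /= mulr0 subr0.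
have iC (z : R[i]) (r : R) : cIm (z * r%:C%C) = cIm z * r by rewrite cImM /= mulr0 add0r.
have EE r : E r * heat om n r N = cexp (Complex (f r) (g r)).
  rewrite /E /heat -cexpD -/l; congr cexp; apply: complexP.
    by rewrite cReD rC [cRe (Complex _ _)]/= [cRe (Complex _ _)]/= /f addrA.
  by rewrite cImD iC [cIm (Complex _ _)]/= [cIm (Complex _ _)]/= /g.
have -> : (fun s => cRe (w * (E s * heat om n s N))) = (fun s => cRe (w * cexp (Complex (f s) (g s)))).
  by apply/funext => r; rewrite EE.
have sn0 : s != 0 by rewrite gt_eqF.
have dinv : is_derive s 1 (fun r : R => N / (4 * r)) (- (N / (4 * s ^+ 2))).
  have d4 : 4 * s != 0 by rewrite mulf_neq0.
  have d1 := is_derive_scale 4 (is_derive_id s (1 : R)).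
  have d2 : is_derive s 1 (fun r : R => (4 * r)^-1) (- (4 * s) ^- 2 * (4 * 1)).
    exact: (is_deriveV d4 d1).
  apply: (is_derive_val _ (is_derive_scale N d2)).
  by field.
have dln : is_derive s 1 (fun r : R => ln (4 * pi * r)) s^-1.
  have q0 : 0 < 4 * pi * s by rewrite !mulr_gt0 ?pi_gt0.
  have d1 := is_derive_scale (4 * pi) (is_derive_id s (1 : R)).
  apply: (is_derive_val _ (is_derive_comp (f := fun r : R => 4 * pi * r) (is_derive1_ln q0) d1)).
  by rewrite mulr1 invfM mulrAC mulVf ?mul1r// gt_eqF// mulr_gt0 ?pi_gt0.
have df : is_derive s 1 f (cRe l - n%:R / 2 * s^-1 + cRe om * (N / (4 * s ^+ 2))).
  have d1 := is_derive_sub (is_derive_sub (is_derive_scale (cRe l) (is_derive_id s (1 : R)))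
    (is_derive_scale (n%:R / 2) dln)) (is_derive_scale (cRe om) dinv).
  by apply: (is_derive_val _ d1); rewrite mulr1 mulrN opprK.
have dg : is_derive s 1 g (cIm l + cIm om * (N / (4 * s ^+ 2))).
  have d1 := is_derive_sub (is_derive_scale (cIm l) (is_derive_id s (1 : R))) (is_derive_scale (cIm om) dinv).
  by apply: (is_derive_val _ d1); rewrite mulr1 mulrN opprK.
apply: (is_derive_val _ (is_derive_cRe_cexp w df dg)).
rewrite EE; congr (cRe (_ * _)); rewrite /D -/l; apply: complexP.
  rewrite cReD cReD cReN rC [cRe (Complex _ _)]/= [cRe ((_ / _)%:C%C)]/=.
  by rewrite -mulrA -invfM.
rewrite cImD cImD cImN iC [cIm (Complex _ _)]/= [cIm ((_ / _)%:C%C)]/=.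
by rewrite oppr0 addr0.
Qed.

Variables (p p' : R) (p1 : 1 < p) (pp' : p^-1 + p'^-1 = 1).
Variables (u f0 : X -> R[i]) (g : 'I_n -> X -> R[i]).
Hypotheses (mu_ : cmeasurable u) (mf0 : cmeasurable f0) (mg : forall i, cmeasurable (g i)).
Hypotheses (ju : rintble mu (fun y => normc (u y) `^ p))
  (jf0 : rintble mu (fun y => normc (f0 y) `^ p))
  (jg : forall i, rintble mu (fun y => normc (g i y) `^ p)).
Hypothesis weak : forall i, weak_partial [:: i; i] u (g i).
Hypothesis resolvent : {ae mu, forall y, \sum_i g i y = - f0 y - lam * u y}.

Variables (phi : X -> R[i]) (M : nat).
Hypothesis mphi : cmeasurable phi.
Hypothesis jphi : rintble mu (fun x => normc (phi x) `^ p').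
Hypothesis phiM : forall x, normc (phi x) <= M%:R.

(** A majorant of the kernel times its logarithmic derivative, uniform for a <= s <= b: the
    amplitude and the negative powers of s are largest at a, the Gaussian is widest at b. It
    licenses differentiation under the integral. *)
Let dom (a b : R) (w : X) : R :=
  heat_amp n a * (normc lam + n%:R / (2 * a) + 1 / (4 * a ^+ 2)) *
    ((1 + sqnorm w) * expR (- (cRe om / (4 * b) * sqnorm w))).

Let dom_le (a b s : R) w : 0 < a -> a <= s -> s <= b ->
  normc (K s w * D s (sqnorm w)) <= dom a b w.
Proof.
move=> a0 as_ sb; have s0 := lt_le_trans a0 as_; have b0 := lt_le_trans s0 sb.
set N := sqnorm w; have N0 : 0 <= N by exact: sqnorm_ge0.
rewrite Normc.normcM /heatk normc_heat -/N /dom -/N.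
have a1 : heat_amp n s <= heat_amp n a.
  rewrite /heat_amp ler_expR lerN2 ler_wpM2l ?divr_ge0// ler_ln ?posrE ?mulr_gt0 ?pi_gt0//.
  by rewrite ler_wpM2l// mulr_ge0 ?pi_ge0.
have a2 : expR (- (cRe om / (4 * s) * N)) <= expR (- (cRe om / (4 * b) * N)).
  rewrite ler_expR lerN2 ler_wpM2r// ler_wpM2l ?(ltW om0)//.
  by rewrite lef_pV2 ?posrE ?mulr_gt0// ler_wpM2l.
have a3 : normc (D s N) <= (normc lam + n%:R / (2 * a) + 1 / (4 * a ^+ 2)) * (1 + N).
  have l0 : 0 <= normc lam by exact: normc_ge0.
  have b1 : normc (lam * (om^*)%C) = normc lam by rewrite Normc.normcM normc_conj om1 mulr1.
  have b2 : normc ((n%:R / (2 * s))%:C%C : R[i]) <= n%:R / (2 * a).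
    rewrite normc_real ger0_norm ?divr_ge0 ?mulr_ge0 ?(ltW s0)//.
    by rewrite ler_wpM2l// lef_pV2 ?posrE ?mulr_gt0// ler_wpM2l.
  have b3 : normc (om * (N / (4 * s ^+ 2))%:C%C) <= N * (1 / (4 * a ^+ 2)).
    rewrite Normc.normcM om1 mul1r normc_real ger0_norm ?divr_ge0 ?mulr_ge0 ?sqr_ge0 ?(ltW s0)//.
    rewrite mul1r ler_wpM2l// lef_pV2 ?posrE ?mulr_gt0 ?exprn_gt0// ler_wpM2l//.
    by rewrite lerXn2r ?nnegrE ?(ltW s0) ?(ltW a0).
  have d0 : 0 <= n%:R / (2 * a) :> R by rewrite divr_ge0 ?mulr_ge0 ?(ltW a0).
  have e0 : 0 <= 1 / (4 * a ^+ 2) :> R by rewrite divr_ge0 ?mulr_ge0 ?sqr_ge0 ?(ltW a0).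
  apply: (le_trans (ler_normcD _ _)); apply: (@le_trans _ _ (normc lam + n%:R / (2 * a) + N * (1 / (4 * a ^+ 2)))).
    apply: lerD b3; apply: (le_trans (ler_normcD _ _)); rewrite normcN b1; exact: lerD.
  rewrite mulrDr mulr1; have := mulr_ge0 l0 N0; have := mulr_ge0 d0 N0; nra.
have h1 := ler_pM (heat_amp_ge0 n s) (expR_ge0 _) a1 a2.
have h2 := ler_pM (mulr_ge0 (heat_amp_ge0 n s) (expR_ge0 _)) (normc_ge0 _) h1 a3.
by apply: (le_trans h2); rewrite le_eqVlt; apply/orP; left; apply/eqP; ring.
Qed.

Let dom_ge0 a b w : 0 < a -> 0 <= dom a b w.
Proof.
move=> a0; rewrite /dom; apply: mulr_ge0.
  apply: mulr_ge0; first exact: heat_amp_ge0.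
  by rewrite !addr_ge0 ?normc_ge0// divr_ge0 ?mulr_ge0 ?sqr_ge0 ?(ltW a0).
by rewrite mulr_ge0 ?expR_ge0// addr_ge0// sqnorm_ge0.
Qed.

Let dom_gauss a b : 0 < a -> 0 < b -> exists C A : R,
  [/\ 0 <= C, 0 < A & forall w, dom a b w <= C * expR (- (A * sqnorm w))].
Proof.
move=> a0 b0; set B := cRe om / (4 * b); have B0 : 0 < B by rewrite divr_gt0 ?mulr_gt0.
pose C1 := heat_amp n a * (normc lam + n%:R / (2 * a) + 1 / (4 * a ^+ 2)).
have C10 : 0 <= C1.
  apply: mulr_ge0; first exact: heat_amp_ge0.
  by rewrite !addr_ge0 ?normc_ge0// divr_ge0 ?mulr_ge0 ?sqr_ge0 ?(ltW a0).
exists (C1 * (1 + 2 / B)), (B / 2); split.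
- by rewrite mulr_ge0// addr_ge0// divr_ge0// ltW.
- by rewrite divr_gt0.
- move=> w; rewrite /dom -/C1 -/B -mulrA ler_wpM2l//.
  by have := weight_le B0 0 w; rewrite subr0.
Qed.

Let rintble_dom a b : 0 < a -> 0 < b -> rintble mu (dom a b).
Proof.
move=> a0 b0; have [C [A [C0 A0 hw]]] := dom_gauss a0 b0.
have [j _] := @sqnorm_gauss_integral R n _ A0.
apply: (rintble_le _ (rintbleZ C j)) => [|w]; last by rewrite ger0_norm ?hw// dom_ge0.
apply: measurable_funM => //; apply: measurable_funM.
  by apply: measurable_funD => //; exact: measurable_sqnorm.
apply: measurableT_comp => //; apply: measurableT_comp => //.
by apply: measurable_funM => //; exact: measurable_sqnorm.
Qed.

Let mD (s : R) : cmeasurable (fun w : X => D s (sqnorm w)).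
Proof.
apply: cmeasurable_add; first exact: cmeasurable_cst.
apply: cmeasurableM; first exact: cmeasurable_cst.
by apply: cmeasurable_real; apply: measurable_funM => //; exact: measurable_sqnorm.
Qed.

Let mK s : cmeasurable (K s). Proof. exact: cmeasurable_heatk. Qed.

(** The kernel times D is the conjugate of om times (lam + Delta) K: with a = om / (4 s), the
    function q is the Laplacian of the Gaussian G. By [weak_gauss] the Laplacian passes to u, where
    lam u + sum_i g i = - f0. *)
Let inner (s : R) (x : X) : 0 < s ->
  cint mu (fun y => u y * (K s (x - y) * D s (sqnorm (x - y)))) =
  - (om^*)%C * cint mu (fun y => f0 y * K s (x - y)).
Proof.
move=> s0; pose a := om * ((4 * s)^-1)%:C%C.
have a0 : 0 < cRe a by rewrite cReM /= mulr0 subr0 mulr_gt0 ?invr_gt0 ?mulr_gt0.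
pose G y := cexp (- a * (sqnorm (y - x))%:C%C).
pose q y := ((4 * sqnorm (y - x))%:C%C * a ^+ 2 - (2 * n%:R)%:C%C * a) * G y.
pose A := (heat_amp n s)%:C%C : R[i].
have KG y : K s (x - y) = A * G y.
  rewrite /heatk /heat /A /heat_amp -cexp_real -cexpD; congr cexp; rewrite sqnormC.
  by case: (om) => o1 o2 in a a0 G q *; apply: complexP;
    rewrite /a ?cReD ?cImD ?cReM ?cImM ?cReN ?cImN ?cReM ?cImM /=; field; rewrite gt_eqF.
have omc : om * (om^*)%C = 1 by rewrite mul_conjc om1 expr1n.
have KD y : K s (x - y) * D s (sqnorm (x - y)) = (om^*)%C * A * (lam * G y + q y).
  rewrite KG /q sqnormC; set N := sqnorm _.
  have -> : D s N = (om^*)%C * (lam + ((4 * N)%:C%C * a ^+ 2 - (2 * n%:R)%:C%C * a)).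
    have sC : s%:C%C != 0 :> R[i] by apply: contra_neq (lt0r_neq0 s0) => -[].
    have R1 : (n%:R / (2 * s))%:C%C = (2 * n%:R)%:C%C * ((4 * s)^-1)%:C%C :> R[i].
      by rewrite -rmorphM; congr (_%:C%C); field; rewrite gt_eqF.
    have R2 : (N / (4 * s ^+ 2))%:C%C = (4 * N)%:C%C * (((4 * s)^-1)%:C%C ^+ 2) :> R[i].
      by rewrite -rmorphXn -rmorphM; congr (_%:C%C); field; rewrite gt_eqF.
    rewrite /D R1 R2 /a; set v := ((4 * s)^-1)%:C%C; set w := (2 * n%:R)%:C%C; set z := (4 * N)%:C%C.
    transitivity (lam * (om^*)%C - w * v * (om * (om^*)%C) + om * (z * v ^+ 2) * (om * (om^*)%C)).
      by rewrite omc !mulr1.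
    by ring.
  by ring.
have jG (v : X -> R[i]) : cmeasurable v -> rintble mu (fun y => normc (v y) `^ p) ->
    cintble mu (fun y => v y * G y).
  move=> mv jv; apply: (cintble_le _ (rintble_Lp_gauss p1 pp' x a0 mv jv)) => [|y].
    apply: cmeasurableM => //; apply: cmeasurable_cexp; apply: cmeasurableM; first exact: cmeasurable_cst.
    by apply: cmeasurable_real; exact: measurable_sqdist.
  by rewrite Normc.normcM normc_cexp cReM cReN /= mulr0 subr0 mulNr.
have juG := jG u mu_ ju; have jfG := jG f0 mf0 jf0.
have jKD : cintble mu (fun y => u y * (K s (x - y) * D s (sqnorm (x - y)))).
  have [C [B [C0 B0 hw]]] := dom_gauss s0 s0.
  apply: (cintble_le _ (rintbleZ C (rintble_Lp_gauss p1 pp' x B0 mu_ ju))) => [|y].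
    apply: cmeasurableM => //; apply: cmeasurableM.
      by apply: (cmeasurable_comp _ (mK s)); exact: measurable_subr.
    by apply: (cmeasurable_comp _ (mD s)); exact: measurable_subr.
  rewrite Normc.normcM [leRHS]mulrCA; apply: ler_wpM2l; first exact: normc_ge0.
  rewrite -(sqnormC x y).
  exact: (le_trans (dom_le (x - y) s0 (lexx s) (lexx s)) (hw (x - y))).
have A0 : A != 0 by apply: contra_neq (lt0r_neq0 (expR_gt0 (- (n%:R / 2 * ln (4 * pi * s))))) => -[].
have om_0 : (om^*)%C != 0.
  by apply/eqP => h; have := omc; rewrite h mulr0 => /eqP; rewrite eq_sym oner_eq0.
have uq y : u y * q y = ((om^*)%C * A)^-1 * (u y * (K s (x - y) * D s (sqnorm (x - y)))) - lam * (u y * G y).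
  by rewrite KD; field; rewrite om_0 A0.
have jq : cintble mu (fun y => u y * q y).
  by rewrite (funext uq); apply: cintbleD; [exact: cintbleZ|apply: cintbleN; exact: cintbleZ].
have wg := weak_gauss p1 pp' x mu_ mg ju jg weak a0.
have -> : (fun y => u y * (K s (x - y) * D s (sqnorm (x - y)))) =
    (fun y => (om^*)%C * A * (lam * (u y * G y) + u y * q y)).
  by apply/funext => y; rewrite KD; ring.
rewrite cintZ; last by apply: cintbleD => //; exact: cintbleZ.
rewrite cintD//; last exact: cintbleZ.
rewrite (cintZ _ juG) [X in _ + X]wg -/G.
rewrite (_ : cint mu (fun y => (\sum_i g i y) * G y) = cint mu (fun y => - (f0 y * G y) - lam * (u y * G y))).
  rewrite (cintB (cintbleN jfG) (cintbleZ lam juG)) (cintN jfG) (cintZ _ juG).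
  have -> : (fun y => f0 y * K s (x - y)) = (fun y => A * (f0 y * G y)).
    by apply/funext => y; rewrite KG mulrCA.
  by rewrite (cintZ _ jfG); ring.
apply: eq_ae_cint.
- apply: cmeasurableM; last first.
    apply: cmeasurable_cexp; apply: cmeasurableM; first exact: cmeasurable_cst.
    by apply: cmeasurable_real; exact: measurable_sqdist.
  by apply: cmeasurable_sumf.
- exact: (cintbleD (cintbleN jfG) (cintbleN (cintbleZ lam juG))).1.
- by apply: filterS resolvent => y ->; ring.
Qed.

Let mKz s : cmeasurable (fun z : X * X => K s (z.1 - z.2)).
Proof. by apply: (cmeasurable_comp _ (mK s)); exact: measurable_sub. Qed.

Let mp1 : cmeasurable (fun z : X * X => phi z.1).
Proof. exact: (cmeasurable_comp _ mphi). Qed.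

Let mv2 (v : X -> R[i]) : cmeasurable v -> cmeasurable (fun z : X * X => v z.2).
Proof. by move=> mv; exact: (cmeasurable_comp _ mv). Qed.

(** A bound uniform in s, from the L_1 norm of the kernel. It is not meant to be sharp: applied to
    u, it shows that [Bf] decays at infinity. *)
Let jform (v : X -> R[i]) s : 0 < s -> cmeasurable v ->
  rintble mu (fun y => normc (v y) `^ p) ->
  cintble (mu \x mu)%E (fun z => phi z.1 * K s (z.1 - z.2) * v z.2) /\
  normc (heat_form om s phi v) <=
    (\int[mu]_x normc (phi x) `^ p' + \int[mu]_x normc (v x) `^ p) * (Num.sqrt (cRe om))^-1 ^+ n.
Proof.
move=> s0 mv jv; have [jK eK] := cintble_heatk n om0 s0.
have [j i] := young_conv p1 pp' mphi mv jphi jv jK.2 (fun w => normc_ge0 _).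
have jc : cintble (mu \x mu)%E (fun z => phi z.1 * K s (z.1 - z.2) * v z.2).
  apply: (cintble_le _ j) => [|z]; last by rewrite !Normc.normcM.
  by apply: cmeasurableM; [exact: cmeasurableM|exact: mv2].
split => //; rewrite -eK; apply: le_trans i; apply: (le_trans (normc_cint jc)).
by apply: le_rint => [||z]; [exact: jc.2|exact: j|rewrite !Normc.normcM].
Qed.

Let form_D s : 0 < s ->
  cintble (mu \x mu)%E (fun z => phi z.1 * (K s (z.1 - z.2) * D s (sqnorm (z.1 - z.2))) * u z.2) /\
  cint (mu \x mu)%E (fun z => phi z.1 * (K s (z.1 - z.2) * D s (sqnorm (z.1 - z.2))) * u z.2) =
  - (om^*)%C * heat_form om s phi f0.
Proof.
move=> s0; have jd := rintble_dom s0 s0.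
have [j _] := young_conv p1 pp' mphi mu_ jphi ju jd (fun w => dom_ge0 s w s0).
have jc : cintble (mu \x mu)%E (fun z => phi z.1 * (K s (z.1 - z.2) * D s (sqnorm (z.1 - z.2))) * u z.2).
  apply: (cintble_le _ j) => [|z].
    apply: cmeasurableM; last exact: mv2.
    apply: cmeasurableM => //; apply: cmeasurableM => //.
    by apply: (cmeasurable_comp _ (mD s)); exact: measurable_sub.
  rewrite Normc.normcM (Normc.normcM (phi _)); apply: ler_wpM2r; first exact: normc_ge0.
  apply: ler_wpM2l; first exact: normc_ge0.
  exact: (dom_le (z.1 - z.2) s0 (lexx s) (lexx s)).
split => //; have [jf _] := jform s0 mf0 jf0.
rewrite /heat_form -(cfubini1 jc) -(cfubini1 jf) -(cintZ _ (cintble_fubini1 jf)).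
congr cint; apply/funext => x.
have [A [B [A0 B0 hw]]] := dom_gauss s0 s0.
have j1 : cintble mu (fun y => u y * (K s (x - y) * D s (sqnorm (x - y)))).
  apply: (cintble_le _ (rintbleZ A (rintble_Lp_gauss p1 pp' x B0 mu_ ju))) => [|y].
    apply: cmeasurableM => //; apply: cmeasurableM.
      by apply: (cmeasurable_comp _ (mK s)); exact: measurable_subr.
    by apply: (cmeasurable_comp _ (mD s)); exact: measurable_subr.
  rewrite Normc.normcM [leRHS]mulrCA; apply: ler_wpM2l; first exact: normc_ge0.
  rewrite -(sqnormC x y).
  exact: (le_trans (dom_le (x - y) s0 (lexx s) (lexx s)) (hw (x - y))).
have A4 : 0 < cRe om / (4 * s) by rewrite divr_gt0 ?mulr_gt0.
have j2 : cintble mu (fun y => f0 y * K s (x - y)).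
  apply: (cintble_le _ (rintbleZ (heat_amp n s) (rintble_Lp_gauss p1 pp' x A4 mf0 jf0))) => [|y].
    by apply: cmeasurableM => //; apply: (cmeasurable_comp _ (mK s)); exact: measurable_subr.
  by rewrite Normc.normcM /heatk normc_heat sqnormC mulrCA.
transitivity (phi x * cint mu (fun y => u y * (K s (x - y) * D s (sqnorm (x - y))))).
  by rewrite -(cintZ _ j1); congr cint; apply/funext => y; rewrite -mulrA; congr (_ * _); exact: mulrC.
rewrite (inner x s0) mulrCA -(cintZ _ j2); congr (_ * _); congr cint; apply/funext => y.
by rewrite -mulrA; congr (_ * _); exact: mulrC.
Qed.

Let Bf s := E s * heat_form om s phi u.

(** The derivative involves f0 and no longer u, because the logarithmic derivative of the kernel is
    the resolvent equation by [form_D]. The factor eta and the real part make the function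
    real-valued, so that the mean value theorem applies. *)
Let is_derive_Bf (eta : R[i]) (s : R) : 0 < s ->
  is_derive s 1 (fun s => cRe (eta * Bf s)) (cRe (eta * (E s * (- (om^*)%C * heat_form om s phi f0)))).
Proof.
(* On the interval from s / 2 to 2 s the majorant [dom] is uniform in time. *)
move=> s0; pose a := s / 2; pose b := 2 * s.
have a0 : 0 < a by rewrite divr_gt0.
have b0 : 0 < b by rewrite mulr_gt0.
have sab : s \in `]a, b[%R.
  by rewrite in_itv/= /a /b ltr_pdivrMr// mulr_natr mulr_natl mulr2n ltrDl s0.
pose w z := eta * phi z.1 * u z.2.
pose f s z := cRe (w z * (E s * K s (z.1 - z.2))).
pose df s z := cRe (w z * (E s * K s (z.1 - z.2)) * D s (sqnorm (z.1 - z.2))).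
have fE r z : f r z = cRe ((eta * E r) * (phi z.1 * K r (z.1 - z.2) * u z.2)).
  by rewrite /f /w; congr cRe; ring.
have dfE r z : df r z = cRe ((eta * E r) * (phi z.1 * (K r (z.1 - z.2) * D r (sqnorm (z.1 - z.2))) * u z.2)).
  by rewrite /df /w; congr cRe; ring.
have pos r : r \in `]a, b[%R -> 0 < r by rewrite in_itv/= => /andP[+ _]; exact: lt_trans.
have jd := rintble_dom a0 b0.
have [j _] := young_conv p1 pp' mphi mu_ jphi ju jd (fun w => dom_ge0 b w a0).
have ef r : 0 < r -> \int[(mu \x mu)%E]_z f r z = cRe (eta * Bf r).
  move=> r0; have [jc _] := jform r0 mu_ ju.
  by rewrite (funext (fE r)) /Bf mulrA /heat_form -(cintZ _ jc).
have edf : \int[(mu \x mu)%E]_z df s z = cRe (eta * (E s * (- (om^*)%C * heat_form om s phi f0))).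
  have [jc <-] := form_D s0.
  by rewrite (funext (dfE s)) mulrA -(cintZ _ jc).
rewrite -edf; apply: (@near_eq_is_derive _ _ _ (fun r => \int[(mu \x mu)%E]_z f r z)).
  near=> r; rewrite ef//; near: r; exact: lt_nbhsr.
apply: (@is_derive_rint _ _ R (mu \x mu)%E f df s a b
  (fun z => normc eta * (normc (phi z.1) * dom a b (z.1 - z.2) * normc (u z.2)))) => //.
- move=> r /pos r0; have [jc _] := jform r0 mu_ ju.
  by rewrite (funext (fE r)); apply: cintble_Re; exact: cintbleZ.
- by move=> r z /pos r0; exact: is_derive_kernel.
- exact: rintbleZ.
- move=> r z rab; have r0 := pos r rab.
  have /andP[ar rb] : a < r < b by move: rab; rewrite in_itv.
  rewrite dfE; apply: (le_trans (cRe_le_normc _)).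
  rewrite Normc.normcM (Normc.normcM eta) normc_E -mulrA; apply: ler_wpM2l; first exact: normc_ge0.
  apply: (@le_trans _ _ (1 * normc (phi z.1 * (K r (z.1 - z.2) * D r (sqnorm (z.1 - z.2))) * u z.2))).
    apply: ler_wpM2r; first exact: normc_ge0.
    by rewrite -[leRHS]expR0 ler_expR oppr_le0 mulr_ge0 ?(ltW c0) ?(ltW r0).
  rewrite mul1r Normc.normcM (Normc.normcM (phi _)); apply: ler_wpM2r; first exact: normc_ge0.
  apply: ler_wpM2l; first exact: normc_ge0.
  exact: (dom_le (z.1 - z.2) a0 (ltW ar) (ltW rb)).
Unshelve. all: by end_near. Qed.

Variables (t : R) (ht : 2^-1 <= t <= 1).
Hypothesis jphi_t : rintble mu (fun x => normc (phi x) `^ t^-1).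
Hypothesis jf0_t : rintble mu (fun x => normc (f0 x) `^ t^-1).
Variable al : R.
Hypotheses (alE : al = 1 - n%:R * (t - 2^-1)) (al0 : 0 < al).

Let P := (\int[mu]_x normc (phi x) `^ t^-1) `^ t * (\int[mu]_x normc (f0 x) `^ t^-1) `^ t.

Let P0 : 0 <= P. Proof. by rewrite mulr_ge0 ?powR_ge0. Qed.

(** The origin of alpha: the exponent - (n/2)(2 t - 1) of 4 pi s equals al - 1. *)
Let amp_powR s : 0 < s -> heat_amp n s `^ (2 * t - 1) = (4 * pi) `^ (al - 1) * s `^ (al - 1).
Proof.
move=> s0; have p0 : 0 < 4 * pi :> R by rewrite mulr_gt0 ?pi_gt0.
rewrite -powRM ?(ltW p0) ?(ltW s0)// /powR gt_eqF ?expR_gt0// gt_eqF ?mulr_gt0 ?pi_gt0//.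
rewrite /heat_amp expRK; congr expR; rewrite alE.
by field.
Qed.

(** By interpolation the derivative of b is at most Q s^(al - 1) exp(- c s) in modulus. Hence h,
    which adds to b the term Q c^(-al) V(c s) with V the incomplete Gamma function, does not
    decrease. Comparison of eps with a large T, where b is small, leaves Q c^(-al) Gamma(al). With
    eta the conjugate phase of [Bf eps], the value b eps is the modulus in question. *)
Let Bf_le (eps : R) : 0 < eps -> normc (Bf eps) <= (4 * pi) `^ (al - 1) * P * (c `^ (- al) * Gamma al).
Proof.
move=> e0; have al1 : al <= 1.
  have /andP[t1 _] := ht; rewrite alE gerBl mulr_ge0// subr_ge0//.
have shuffle (a1 a2 x y : R) : a1 * a2 * x * y = a1 * (x * y) * a2 by ring.
have [V [dV V0 VG]] := Gamma_primitive al0 al1.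
pose Q := (4 * pi) `^ (al - 1) * P.
have Q0 : 0 <= Q by rewrite mulr_ge0 ?powR_ge0.
pose eta := ((phase (Bf eps))^*)%C.
have eta1 : normc eta <= 1 by rewrite /eta normc_conj phase_le1.
pose b s := cRe (eta * Bf s).
pose db s := cRe (eta * (E s * (- (om^*)%C * heat_form om s phi f0))).
pose h s := b s + Q * (c `^ (- al) * V (c * s)).
pose dh s := db s + Q * (s `^ (al - 1) * expR (- (c * s))).
have dhP (s : R) : 0 < s -> is_derive s 1 h (dh s).
  move=> s0; have cs0 : 0 < c * s by rewrite mulr_gt0.
  have d1 := is_derive_comp (f := fun r : R => c * r) (dV _ cs0) (is_derive_scale c (is_derive_id s (1 : R))).
  apply: (is_derive_val _ (is_deriveD (is_derive_Bf eta s0) (is_derive_scale Q (is_derive_scale (c `^ (- al)) d1)))).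
  rewrite -/(db s) /dh; congr (_ + Q * _).
  rewrite powRM ?(ltW c0) ?(ltW s0)// mulr1.
  have -> : c `^ (- al) * (c `^ (al - 1) * s `^ (al - 1) * expR (- (c * s)) * c) =
      c `^ (- al) * c `^ (al - 1) * c * (s `^ (al - 1) * expR (- (c * s))) by ring.
  rewrite -powRD; last by rewrite (gt_eqF c0) implybT.
  rewrite (_ : - al + (al - 1) = -1); last by ring.
  by rewrite powR_inv1 ?(ltW c0)// mulVf ?mul1r// gt_eqF.
have hcont (x : R) : 0 < x -> {for x, continuous h}.
  move=> x0; exact: (is_derive_continuous (dhP x x0)).
have dh0 s : 0 < s -> 0 <= dh s.
  move=> s0; have [jf _] := jform s0 mf0 jf0.
  have hf := heat_form_le om1 om0 s0 ht mphi mf0 jphi_t jf0_t jf.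
  suff /ler_normlP[h1 _] : `|db s| <= Q * (s `^ (al - 1) * expR (- (c * s))).
    by rewrite /dh -lerBlDl sub0r.
  apply: (le_trans (cRe_le_normc _)).
  rewrite Normc.normcM (Normc.normcM (E s)) (Normc.normcM (- _)) normcN normc_conj om1 mul1r normc_E.
  apply: (@le_trans _ _ (1 * (expR (- (c * s)) * normc (heat_form om s phi f0)))).
    by apply: ler_wpM2r => //; rewrite mulr_ge0 ?expR_ge0 ?normc_ge0.
  rewrite mul1r /Q mulrA [leRHS]mulrC; apply: ler_wpM2l; first exact: expR_ge0.
  by apply: (le_trans hf); rewrite (amp_powR s0) shuffle -/P; exact: lexx.
have [_ bu] := jform e0 mu_ ju.
pose C := (\int[mu]_x normc (phi x) `^ p' + \int[mu]_x normc (u x) `^ p) * (Num.sqrt (cRe om))^-1 ^+ n.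
have decay s : 0 < s -> b s <= expR (- (c * s)) * C.
  move=> s0; have [_ hs] := jform s0 mu_ ju.
  apply: (le_trans (ler_norm _)); apply: (le_trans (cRe_le_normc _)).
  rewrite Normc.normcM /Bf (Normc.normcM (E s)) normc_E.
  apply: (@le_trans _ _ (1 * (expR (- (c * s)) * normc (heat_form om s phi u)))).
    by apply: ler_wpM2r => //; rewrite mulr_ge0 ?expR_ge0 ?normc_ge0.
  by rewrite mul1r; apply: ler_wpM2l; [exact: expR_ge0|exact: hs].
have beps : b eps = normc (Bf eps) by rewrite /b /eta conj_phase_mul.
have C0 : 0 <= C by apply: le_trans bu; exact: normc_ge0.
have main (T : R) : eps < T -> normc (Bf eps) <= expR (- (c * T)) * C + Q * (c `^ (- al) * Gamma al).
  move=> eT; have T0 := lt_trans e0 eT.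
  have cont : {within `[eps, T], continuous h}.
    apply: continuous_in_subspaceT => x; rewrite inE /= in_itv/= => /andP[ex _].
    exact: hcont (lt_le_trans e0 ex).
  have [x xe hx] := MVT eT (fun x xe => dhP x (lt_trans e0 (andP (xe : eps < x < T)).1)) cont.
  have x0 : 0 < x by move: xe; rewrite in_itv/= => /andP[ex _]; exact: lt_trans ex.
  have hh : h eps <= h T by rewrite -subr_ge0 hx mulr_ge0 ?dh0// subr_ge0 ltW.
  rewrite -beps; apply: (@le_trans _ _ (h eps)).
    by rewrite /h lerDl !mulr_ge0 ?powR_ge0.
  apply: (le_trans hh); apply: lerD; first exact: decay.
  by apply: ler_wpM2l => //; apply: ler_wpM2l; [exact: powR_ge0|exact: VG].
rewrite -/Q; apply/ler_addgt0Pl => d d0.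
(* Since exp(c T) >= c T, the remaining term exp(- c T) C is at most d as soon as c T d >= C. *)
pose T := eps + C / (c * d) + 1.
have CT0 : 0 <= C / (c * d) by rewrite divr_ge0// mulr_ge0 ?ltW.
have eT : eps < T by rewrite /T -addrA ltrDl ltr_wpDl.
apply: (le_trans (main T eT)); rewrite lerD2r.
rewrite expRN ler_pdivrMl ?expR_gt0//; have T0 := lt_trans e0 eT.
apply: (@le_trans _ _ (c * T * d)); last first.
  by apply: ler_wpM2r; [exact: ltW|apply: le_trans (expR_ge1Dx _); rewrite lerDr].
apply: (@le_trans _ _ (c * (C / (c * d)) * d)).
  by rewrite le_eqVlt; apply/orP; left; apply/eqP; field; rewrite !gt_eqF.
by apply: ler_wpM2r; [exact: ltW|apply: ler_wpM2l; [exact: ltW|rewrite /T addrAC lerDr addr_ge0 ?(ltW e0)//]].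
Qed.

(** As the time e tends to 0, the form of phi and u approaches the pairing times the integral of the
    kernel, a number of modulus 1, while the modulus of the form is exp(c e) |Bf e|. *)
Lemma resolvent_pairing_le :
  normc (cint mu (fun y => phi y * u y)) <= (4 * pi) `^ (al - 1) * P * (c `^ (- al) * Gamma al).
Proof.
set Q := _ * (_ * _); have Q0 : 0 <= Q := le_trans (normc_ge0 _) (Bf_le ltr01).
apply/ler_addgt0Pl => d d0.
have d20 : 0 < d / 2 by rewrite divr_gt0.
have [e0 e00 he] := heat_form_approx om0 p1 pp' mphi mu_ jphi ju phiM d20.
(* The factor q > 1 leaves room for exp(c e), and (q - 1) Q <= d / 2; the denominator has Q + 1
   because Q may vanish. *)
pose q := 1 + d / (2 * (Q + 1)).
have Q1 : 0 < Q + 1 by rewrite ltr_wpDl.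
have q1 : 1 < q by rewrite ltrDl divr_gt0 ?mulr_gt0.
have lq : 0 < ln q by exact: ln_gt0.
pose e := Num.min e0 (ln q / c).
have ee0 : 0 < e by rewrite lt_min e00 divr_gt0.
have ee : e <= e0 by rewrite ge_min lexx.
have ec : c * e <= ln q by rewrite mulrC -ler_pdivlMr// ge_min lexx orbT.
have := he e ee0 ee; set hf := heat_form om e phi u; set I := cint mu (fun y => phi y * u y) => hh.
have nk := normc_cint_heatk n om1 om0 ee0.
have -> : normc I = normc (cint mu (K e) * I) by rewrite Normc.normcM nk mul1r.
have -> : cint mu (K e) * I = - (hf - cint mu (K e) * I) + hf by ring.
apply: (le_trans (ler_normcD _ _)); rewrite normcN (splitr d) -addrA; apply: lerD => //.
have hfE : normc hf = expR (c * e) * normc (Bf e).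
  by rewrite /Bf Normc.normcM normc_E mulrA -expRD subrr expR0 mul1r.
rewrite hfE; apply: (@le_trans _ _ (q * Q)).
  apply: ler_pM; rewrite ?expR_ge0 ?normc_ge0 ?Bf_le//.
  by rewrite -[leRHS]lnK ?posrE ?(lt_trans ltr01)// ler_expR.
rewrite /q mulrDl mul1r [leRHS]addrC; apply: lerD => //.
have -> : d / (2 * (Q + 1)) * Q = d / 2 * (Q / (Q + 1)).
  by move: Q1; move: (Q + 1) => r r0; field; rewrite gt_eqF.
by rewrite ler_piMr ?(ltW d20)// ler_pdivrMr// mul1r lerDl.
Qed.

End resolvent_pairing.

(** * The Birman-Schwinger operator *)

Lemma powR_hoelder_le {R : realType} (I U V t rho tau : R) : 0 <= I -> 0 <= U -> 0 <= V ->
  0 < t -> I <= U `^ (rho / t) * V `^ (tau / t) -> I `^ t <= U `^ rho * V `^ tau.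
Proof.
move=> I0 U0 V0 t0 h.
apply: (@le_trans _ _ ((U `^ (rho / t) * V `^ (tau / t)) `^ t)).
  by apply: ge0_ler_powR; rewrite ?nnegrE ?mulr_ge0 ?powR_ge0 ?(ltW t0).
by rewrite powRM ?powR_ge0// -!powRrM !divfK ?gt_eqF.
Qed.

Lemma powR_absorb {R : realType} (j U G F D t : R) : 0 < t < 1 -> 0 <= U <= j ->
  0 <= G -> 0 <= F -> 0 <= D -> j <= G * (U `^ t * F) * D -> j `^ (1 - t) <= G * F * D.
Proof.
move=> /andP[t0 t1] /andP[U0 Uj] G0 F0 D0 h; have j0 := le_trans U0 Uj.
have [->|jn0] := eqVneq j 0; first by rewrite powR0 ?subr_eq0 ?gt_eqF// !mulr_ge0.
have jp : 0 < j by rewrite lt_neqAle eq_sym jn0.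
rewrite -(@ler_pM2l _ (j `^ t)) ?powR_gt0//.
rewrite -powRD ?jn0 ?implybT// subrKC powRr1//; apply: (le_trans h).
have -> : j `^ t * (G * F * D) = G * (j `^ t * F) * D by ring.
apply: ler_wpM2r => //; apply: ler_wpM2l => //; apply: ler_wpM2r => //.
by apply: ge0_ler_powR; rewrite ?nnegrE ?(ltW t0).
Qed.

(** * Hoelder's inequality in terms of inverse exponents *)

Section multipliers.
Context d (T : measurableType d) (R : realType) (mu : {measure set T -> \bar R}).
Implicit Types (f a : T -> R[i]) (t tau rho A : R).

(* The exponent of an L_r space is encoded by its inverse [t = 1/r]. *)
Definition ipow t f (x : T) : R := normc (f x) `^ t^-1.

Definition inorm t f : R := (\int[mu]_x ipow t f x) `^ t.

(** Multiplication by a maps L_(1/tau) to L_(1/(rho + tau)) with norm at most A, for every tau. The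
    value rho = 0 is the case of an essentially bounded a, so that finite and infinite exponents
    obey one rule. *)
Definition multiplier rho A a := forall tau f, 0 < tau -> cmeasurable f ->
  rintble mu (ipow tau f) ->
  rintble mu (ipow (rho + tau) (fun x => a x * f x)) /\
  inorm (rho + tau) (fun x => a x * f x) <= A * inorm tau f.

Lemma measurable_ipow t f : cmeasurable f -> measurable_fun setT (ipow t f).
Proof.
by move=> mf; apply: (measurableT_comp (measurable_powR _)); exact: cmeasurable_normc.
Qed.

Lemma ipow_ge0 t f x : 0 <= ipow t f x. Proof. exact: powR_ge0. Qed.

Lemma int_ipow_ge0 t f : 0 <= \int[mu]_x ipow t f x.
Proof. by apply: Rintegral_ge0 => x _; exact: powR_ge0. Qed.

Lemma inorm_ge0 t f : 0 <= inorm t f. Proof. exact: powR_ge0. Qed.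

Lemma cLnorm_inorm (p : R) f : 0 < p -> mem_Lp mu p%:E f ->
  rintble mu (ipow p^-1 f) /\ cLnorm mu p%:E f = (inorm p^-1 f)%:E.
Proof.
move=> p0 [mf]; have E : cLnorm mu p%:E f = ((\int[mu]_x (ipow p^-1 f x)%:E) `^ p^-1)%E.
  rewrite /cLnorm Lnorm.unlock; congr (_ `^ _)%E; apply: eq_integral => x _.
  by rewrite /ipow invrK abse_EFin ger0_norm ?normc_ge0// poweR_EFin.
rewrite E => fin.
have j : rintble mu (ipow p^-1 f).
  apply: rintbleP => [|x|]; [exact: measurable_ipow|exact: ipow_ge0|].
  move: fin; case: (integral _ _ _) => [r|//|//] h; first exact: ltry.
  by move: h; rewrite poweRyr ?gt_eqF ?invr_gt0.
by split => //; rewrite -EFin_rint// poweR_EFin.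
Qed.

Lemma rhoelder (F G : T -> R) (P Q : R) : measurable_fun setT F -> measurable_fun setT G ->
  (forall x, 0 <= F x) -> (forall x, 0 <= G x) -> 0 < P -> 0 < Q -> P^-1 + Q^-1 = 1 ->
  rintble mu (fun x => F x `^ P) -> rintble mu (fun x => G x `^ Q) ->
  rintble mu (fun x => F x * G x) /\
  \int[mu]_x (F x * G x) <= (\int[mu]_x F x `^ P) `^ P^-1 * (\int[mu]_x G x `^ Q) `^ Q^-1.
Proof.
move=> mF mG F0 G0 P0 Q0 PQ jF jG; have := hoelder mu mF mG P0 Q0 PQ.
have N (H : T -> R) (q : R) : (forall x, 0 <= H x) -> rintble mu (fun x => H x `^ q) ->
    'N[mu]_q%:E[EFin \o H]%E = ((\int[mu]_x H x `^ q) `^ q^-1)%:E.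
  move=> H0 jH; have -> : 'N[mu]_q%:E[EFin \o H]%E = ((\int[mu]_x (H x `^ q)%:E) `^ q^-1)%E.
    rewrite Lnorm.unlock; congr (_ `^ _)%E; apply: eq_integral => x _.
    by rewrite /= ger0_norm.
  by rewrite -(EFin_rint jH) poweR_EFin.
have FG0 x : 0 <= F x * G x by rewrite mulr_ge0.
rewrite (N _ _ F0 jF) (N _ _ G0 jG) Lnorm1.
have -> : (\int[mu]_x `|(EFin \o (F \* G)%R) x| = \int[mu]_x (F x * G x)%:E)%E.
  by apply: eq_integral => x _; rewrite /= ger0_norm.
move=> h; have j : rintble mu (fun x => F x * G x).
  apply: rintbleP => //; first exact: measurable_funM.
  by apply: le_lt_trans h _; rewrite -EFinM ltry.
by split => //; rewrite -lee_fin EFinM EFin_rint.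
Qed.

Lemma ipowM t f a : ipow t (fun x => a x * f x) = (fun x => ipow t a x * ipow t f x).
Proof. by apply/funext => x; rewrite /ipow Normc.normcM powRM ?normc_ge0. Qed.

(** Hoelder's inequality with the conjugate exponents t / rho and t / tau, t = rho + tau, applied to
    |a|^(1/t) and |f|^(1/t). In this form none of 1/rho, 1/tau, 1/t has to be at least 1. *)
Lemma multiplier_fin rho a : 0 < rho -> cmeasurable a -> rintble mu (ipow rho a) ->
  multiplier rho (inorm rho a) a.
Proof.
move=> r0 ma ja tau f t0 mf jf; have : 0 < rho + tau by rewrite addr_gt0.
have : rho + tau = rho + tau by [].
move: {2 3 4 5}(rho + tau) => t tE tt.
have PQ : (t / rho)^-1 + (t / tau)^-1 = 1.
  by rewrite !invf_div -mulrDl tE divff ?gt_eqF.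
have pw (q : R) (h : T -> R[i]) : 0 < q -> (fun x => ipow t h x `^ (t / q)) = ipow q h.
  by move=> q0; apply/funext => x; rewrite /ipow -powRrM mulrA mulVf ?gt_eqF// mul1r.
have ea := pw _ a r0; have ef := pw _ f t0.
have [j le] : rintble mu (fun x => ipow t a x * ipow t f x) /\
    \int[mu]_x (ipow t a x * ipow t f x) <=
    (\int[mu]_x ipow rho a x) `^ (t / rho)^-1 * (\int[mu]_x ipow tau f x) `^ (t / tau)^-1.
  rewrite -ea -ef; apply: rhoelder PQ _ _; rewrite ?divr_gt0//.
  - exact: measurable_ipow.
  - exact: measurable_ipow.
  - by move=> x; exact: ipow_ge0.
  - by move=> x; exact: ipow_ge0.
  - exact: (eq_ind_r (rintble mu) ja ea).
  - exact: (eq_ind_r (rintble mu) jf ef).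
have E := ipowM t f a; split; first by rewrite E.
rewrite /inorm E; move: le.
rewrite !invf_div; apply: powR_hoelder_le; rewrite ?int_ipow_ge0//.
by apply: Rintegral_ge0 => x _; rewrite mulr_ge0 ?ipow_ge0.
Qed.

Lemma multiplier_infty A a : 0 <= A -> cmeasurable a ->
  {ae mu, forall x, normc (a x) <= A} -> multiplier 0 A a.
Proof.
move=> A0 ma aA tau f t0 mf jf; rewrite add0r.
have mp := measurable_ipow tau (cmeasurableM ma mf).
have jA := rintbleZ (A `^ tau^-1) jf.
have le : (\int[mu]_x (ipow tau (fun x => (a x * f x)%R) x)%:E <=
    \int[mu]_x (A `^ tau^-1 * ipow tau f x)%:E)%E.
  apply: ae_ge0_le_integral => //.
  - by move=> x _; rewrite lee_fin ipow_ge0.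
  - exact/measurable_EFinP.
  - by move=> x _; rewrite lee_fin mulr_ge0 ?powR_ge0 ?ipow_ge0.
  - by apply/measurable_EFinP; exact: rintble_measurable jA.
  apply: filterS aA => x ax _; rewrite lee_fin ipowM.
  apply: ler_wpM2r; first exact: ipow_ge0.
  by apply: ge0_ler_powR; rewrite ?nnegrE ?normc_ge0 ?invr_ge0 ?(ltW t0).
have j : rintble mu (ipow tau (fun x => a x * f x)).
  apply: rintbleP => //; first exact: ipow_ge0.
  apply: le_lt_trans le _; apply: rintble_ltey jA _ => x.
  by rewrite mulr_ge0 ?powR_ge0 ?ipow_ge0.
split => //; move: le; rewrite -EFin_rint// -EFin_rint// lee_fin rintZ// => le.
rewrite /inorm; apply: (@le_trans _ _ ((A `^ tau^-1 * \int[mu]_x ipow tau f x) `^ tau)).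
  apply: ge0_ler_powR; rewrite ?nnegrE ?(ltW t0)// ?int_ipow_ge0//.
  by rewrite mulr_ge0 ?powR_ge0 ?int_ipow_ge0.
rewrite powRM ?powR_ge0 ?int_ipow_ge0// -powRrM mulVf ?gt_eqF// powRr1//.
Qed.

Lemma Lp_multiplier (r : \bar R) a : (0 < r)%E -> mem_Lp mu r a ->
  exists A, [/\ 0 <= A, cLnorm mu r a = A%:E & multiplier (fine (r^-1)%E) A a].
Proof.
case: r => [r|_|//].
  rewrite lte_fin => r0 ha; have [j E] := cLnorm_inorm r0 ha; case: ha => ma _.
  exists (inorm r^-1 a); split => //; first exact: inorm_ge0.
  by rewrite inver gt_eqF//=; apply: multiplier_fin => //; rewrite invr_gt0.
move=> [ma fa]; rewrite invey /=.
exists (fine (cLnorm mu +oo%E a)); rewrite fine_ge0 ?cLnorm_ge0//.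
have fa' : cLnorm mu +oo%E a \is a fin_num by rewrite ge0_fin_numE ?cLnorm_ge0.
rewrite fineK//; split => //; apply: multiplier_infty => //; first by rewrite fine_ge0 ?cLnorm_ge0.
have : {ae mu, forall x, ((normc (a x))%:E <= cLnorm mu +oo%E a)%E}.
  rewrite /cLnorm Lnorm.unlock; case: ifPn => [m0|].
    have := ess_sup_ge mu (abse \o (fun x => (normc (a x))%:E)).
    by apply: filterS => x /=; rewrite ger0_norm ?normc_ge0.
  rewrite lt0e measure_ge0 andbT negbK => /eqP m0.
  by exists setT.
by apply: filterS => x; rewrite -{1}(fineK fa') lee_fin.
Qed.

Lemma eq_ae_inorm t f (g : T -> R[i]) : cmeasurable f -> cmeasurable g ->
  {ae mu, forall x, f x = g x} -> rintble mu (ipow t f) ->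
  rintble mu (ipow t g) /\ inorm t f = inorm t g.
Proof.
move=> mf mg fg jf.
have E : (\int[mu]_x (ipow t f x)%:E = \int[mu]_x (ipow t g x)%:E)%E.
  apply: ae_eq_integral => //; try by apply/measurable_EFinP; exact: measurable_ipow.
  by apply: filterS fg => x fgx _; rewrite /ipow fgx.
split; last by rewrite /inorm /Rintegral E.
apply: rintbleP => [|x|]; [exact: measurable_ipow|exact: ipow_ge0|].
by rewrite -E; apply: rintble_ltey jf _ => x; exact: ipow_ge0.
Qed.

End multipliers.

(** * The resolvent estimate from L_(1/t) to L_(1/(1-t)) by duality *)

Section resolvent_dual.
Context {R : realType} (n : nat) (om lam : R[i]).
Hypotheses (om1 : normc om = 1) (om0 : 0 < cRe om).
Local Notation mu := (@lebesgue_Rn R n).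
Local Notation X := ('rV[R]_n).
Variable c : R.
Hypotheses (c0 : 0 < c) (cE : cRe (lam * (om^*)%C) = - c).
Variables (p p' : R).
Hypotheses (p1 : 1 < p) (pp' : p^-1 + p'^-1 = 1).
Variables (u f0 : X -> R[i]) (g : 'I_n -> X -> R[i]).
Hypotheses (mu_ : cmeasurable u) (mf0 : cmeasurable f0) (mg : forall i, cmeasurable (g i)).
Hypotheses (ju : rintble mu (fun y => normc (u y) `^ p))
  (jf0 : rintble mu (fun y => normc (f0 y) `^ p))
  (jg : forall i, rintble mu (fun y => normc (g i y) `^ p)).
Hypothesis weak : forall i, weak_partial [:: i; i] u (g i).
Hypothesis resolvent : {ae mu, forall y, \sum_i g i y = - f0 y - lam * u y}.
Variables (t al : R).
Hypotheses (ht : 2^-1 <= t) (t1 : t < 1) (jf0_t : rintble mu (ipow t f0)).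
Hypotheses (alE : al = 1 - n%:R * (t - 2^-1)) (al0 : 0 < al).

Let t0 : 0 < t. Proof. by apply: lt_le_trans ht; rewrite invr_gt0. Qed.
Let s0 : 0 < 1 - t. Proof. by rewrite subr_gt0. Qed.

Lemma rintble_sqball (h : X -> R) (m B : R) : measurable_fun setT h ->
  (forall y, `|h y| <= B * \1_(@sqball R n m) y) -> rintble mu h.
Proof.
move=> mh hB; have j : rintble mu (\1_(@sqball R n m)).
  apply: rintbleP => [|x|].
  - by apply: measurable_indic; exact: measurable_sqball.
  - by rewrite indicE ler0n.
  - rewrite integral_indic ?setIT//; [exact: sqball_fin|exact: measurable_sqball].
exact: rintble_le mh (rintbleZ B j) hB.
Qed.

(* [phi m] is a truncation of the extremal function |u|^(1/(1-t)-1) sgn(u)^* of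
   Hoelder duality, bounded and compactly supported. *)
Let w y : R := normc (u y).
Let v m y : R := cut_ind u m y * w y `^ (t / (1 - t)).
Let phi m y : R[i] := (v m y)%:C%C * ((phase (u y))^*)%C.
Let J m : R := \int[mu]_y (cut_ind u m y * ipow (1 - t) u y).
Let Kc := (4 * pi) `^ (al - 1) * inorm mu t f0 * (c `^ (- al) * Gamma al).

Let mw : measurable_fun setT w. Proof. exact: cmeasurable_normc. Qed.
Let w0 y : 0 <= w y. Proof. exact: normc_ge0. Qed.
Let e0 : 0 < t / (1 - t). Proof. by rewrite divr_gt0. Qed.

Let mv m : measurable_fun setT (v m).
Proof.
apply: measurable_funM; first exact: measurable_cut_ind.
exact: (measurableT_comp (measurable_powR _)).
Qed.

Let mphi m : cmeasurable (phi m).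
Proof.
apply: cmeasurableM; first by apply: cmeasurable_real.
by apply: cmeasurable_conj; exact: cmeasurable_phase.
Qed.

Let v0 m y : 0 <= v m y.
Proof. by rewrite mulr_ge0 ?powR_ge0//; have /andP[] := cut_ind01 u m y. Qed.

Let phiv m y : normc (phi m y) <= v m y.
Proof.
rewrite Normc.normcM normc_real ger0_norm// normc_conj.
by apply: ler_piMr => //; exact: phase_le1.
Qed.

Let cut_le (q : R) m y : 0 <= q ->
  cut_ind u m y * w y `^ q <= m%:R `^ q * \1_(@sqball R n m%:R) y.
Proof.
move=> q0; rewrite /cut_ind; case: (boolP (_ && _)) => [/andP[h1 h2]|_].
  rewrite mul1r indicE mem_set// mulr1.
  by apply: ge0_ler_powR; rewrite ?nnegrE ?ler0n.
by rewrite mul0r mulr_ge0 ?powR_ge0// indicE ler0n.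
Qed.

Let M m := (Num.truncn (m%:R `^ (t / (1 - t)) : R)).+1.

Let vM m y : v m y <= (M m)%:R * \1_(@sqball R n m%:R) y.
Proof.
apply: (le_trans (cut_le m y (ltW e0))); apply: ler_wpM2r; first by rewrite indicE ler0n.
by apply: ltW; rewrite /M truncnS_gt.
Qed.

Let phiM m y : normc (phi m y) <= (M m)%:R.
Proof.
apply: (le_trans (phiv m y)); apply: (le_trans (vM m y)).
by rewrite indicE ler_piMr ?ler0n// lern1 leq_b1.
Qed.

Let jphi m (q : R) : 0 < q -> rintble mu (fun y => normc (phi m y) `^ q).
Proof.
move=> q0; apply: (@rintble_sqball _ m%:R ((M m)%:R `^ q)) => [|y].
  by apply: (measurableT_comp (measurable_powR _)); exact: cmeasurable_normc.
have h := le_trans (phiv m y) (vM m y).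
rewrite ger0_norm ?powR_ge0//; move: h; rewrite indicE; case: (_ \in _).
  rewrite [nat_of_bool _]/= mulr1n !mulr1 => h.
  by apply: ge0_ler_powR; rewrite ?nnegrE ?normc_ge0 ?ler0n ?(ltW q0).
rewrite [nat_of_bool _]/= mulr0n !mulr0 => h.
have -> : normc (phi m y) = 0 by apply/le_anti; rewrite h normc_ge0.
by rewrite powR0 ?gt_eqF.
Qed.

Let jJ m : rintble mu (fun y => cut_ind u m y * ipow (1 - t) u y).
Proof.
apply: (@rintble_sqball _ m%:R (m%:R `^ (1 - t)^-1)) => [|y].
  by apply: measurable_funM; [exact: measurable_cut_ind|exact: measurable_ipow].
rewrite ger0_norm; last first.
  by rewrite mulr_ge0 ?ipow_ge0//; have /andP[] := cut_ind01 u m y.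
by apply: cut_le; rewrite invr_ge0 ltW.
Qed.

Let J0 m : 0 <= J m.
Proof.
by apply: Rintegral_ge0 => y _; rewrite mulr_ge0 ?ipow_ge0.
Qed.

Let phi_u m : cint mu (fun y => phi m y * u y) = (J m)%:C%C.
Proof.
rewrite -cint_real; congr cint; apply/funext => y.
rewrite /phi -mulrA conj_phase_mul -rmorphM; congr (_%:C)%C.
rewrite /v -mulrA; congr (_ * _); rewrite /ipow -/(w y).
have [->|wn0] := eqVneq (w y) 0; first by rewrite mulr0 powR0 ?invr_neq0 ?gt_eqF.
rewrite -{2}(powRr1 (w0 y)) -powRD ?wn0 ?implybT//; congr (_ `^ _).
by have := s0; move=> h; field; rewrite gt_eqF.
Qed.

Let int_phi m : \int[mu]_y normc (phi m y) `^ t^-1 <= J m.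
Proof.
apply: le_rint; [by apply: jphi; rewrite invr_gt0|exact: jJ|] => y.
apply: (@le_trans _ _ (v m y `^ t^-1)).
  by apply: ge0_ler_powR; rewrite ?nnegrE ?normc_ge0 ?invr_ge0 ?(ltW t0).
rewrite /v /cut_ind; case: (_ && _); last by rewrite !mul0r powR0 ?invr_neq0 ?gt_eqF.
rewrite !mul1r -powRrM /ipow -/(w y) (_ : t / (1 - t) / t = (1 - t)^-1)//.
by have := s0; have := t0; move=> h h'; field; rewrite !gt_eqF.
Qed.

(** The pairing of [phi m] with u is J, and the integral of |phi m|^(1/t) is at most J, so that the
    pairing bound reads J <= Kc J^t. Truncation makes J finite, and J^t can be divided out. *)
Let J_le m : J m `^ (1 - t) <= Kc.
Proof.
have p'0 := lt_trans ltr01 (conj_exp_gt1 p1 pp').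
have ti0 : 0 < t^-1 by rewrite invr_gt0.
have ht' : 2^-1 <= t <= 1 by rewrite ht ltW.
have := resolvent_pairing_le om1 om0 c0 cE p1 pp' mu_ mf0 mg ju jf0 jg weak resolvent
  (mphi m) (jphi m p'0) (phiM m) ht' (jphi m ti0) jf0_t alE al0.
rewrite phi_u normc_real (ger0_norm (J0 m)) => h.
have GG : 0 <= Gamma al.
  by apply: Rintegral_ge0 => x _; rewrite mulr_ge0 ?powR_ge0 ?expR_ge0.
apply: (powR_absorb _ _ _ _ _ h); rewrite ?t0 ?powR_ge0 ?int_phi ?mulr_ge0 ?powR_ge0 ?andbT//.
by apply: Rintegral_ge0 => x _; exact: powR_ge0.
Qed.

(** The bound on the truncated integrals does not depend on m. Monotone convergence therefore yields
    both the membership of u in L_(1/(1-t)), known before only for L_p, and the estimate of its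
    norm. *)
Lemma resolvent_dual_le : rintble mu (ipow (1 - t) u) /\ inorm mu (1 - t) u <= Kc.
Proof.
have JK m : J m <= Kc `^ (1 - t)^-1.
  have := @ge0_ler_powR _ (1 - t)^-1 _ (J m `^ (1 - t)) Kc.
  rewrite !nnegrE invr_ge0 (ltW s0) powR_ge0 => /(_ isT isT (le_trans (powR_ge0 _ _) (J_le m)) (J_le m)).
  by rewrite -powRrM divff ?gt_eqF// (powRr1 (J0 m)).
pose g' m y := (cut_ind u m y * ipow (1 - t) u y)%:E.
have mc : (\int[mu]_x g' m x)%E @[m --> \oo] --> (\int[mu]_x limn (g'^~ x))%E.
  apply: cvg_monotone_convergence => //.
  - by move=> m; apply/measurable_EFinP; exact: rintble_measurable (jJ m).
  - by move=> m x _; rewrite lee_fin mulr_ge0 ?ipow_ge0.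
  - move=> x _ a b ab; rewrite lee_fin; apply: ler_wpM2r; first exact: ipow_ge0.
    rewrite /cut_ind ler_nat; case: (boolP (_ && _)) => // /andP[h1 h2].
    by rewrite !(le_trans h1, le_trans h2) ?ler_nat.
have lx x : limn (g'^~ x) = (ipow (1 - t) u x)%:E.
  apply: cvg_lim => //; apply: cvg_near_cst; near=> m; rewrite /g' /cut_ind.
  rewrite (_ : _ && _ = true) ?mul1r//; apply/andP; split.
    by near: m; exact: nbhs_infty_ger.
  by near: m; exact: nbhs_infty_ger.
have le : (\int[mu]_x (ipow (1 - t) u x)%:E <= (Kc `^ (1 - t)^-1)%:E)%E.
  have <- : (\int[mu]_x limn (g'^~ x) = \int[mu]_x (ipow (1 - t) u x)%:E)%E.
    by apply: eq_integral => x _; exact: lx.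
  rewrite -(cvg_lim _ mc)//; apply: lime_le; first by apply/cvg_ex; eexists; exact: mc.
  by apply: nearW => m; rewrite -EFin_rint// lee_fin; exact: JK.
have j : rintble mu (ipow (1 - t) u).
  apply: rintbleP => //; [exact: measurable_ipow|exact: ipow_ge0|].
  by apply: le_lt_trans le _; rewrite ltry.
split => //; move: le; rewrite -EFin_rint// lee_fin => le; rewrite /inorm.
have K0 : 0 <= Kc := le_trans (powR_ge0 _ _) (J_le 0%N).
have := @ge0_ler_powR _ (1 - t) (ltW s0) _ _ _ _ le.
rewrite !nnegrE int_ipow_ge0 powR_ge0 => /(_ isT isT) /le_trans; apply.
by rewrite -powRrM mulVf ?gt_eqF// powRr1.
Unshelve. all: by end_near. Qed.

End resolvent_dual.

(** * Almost-everywhere representatives of L_p classes *)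

Section Lp_pointwise.
Context d (T : measurableType d) (R : realType) (mu : {measure set T -> \bar R}).
Context (p : R) (p1 : 1 <= p).
Local Notation LX := (Lp mu p1).

Lemma Lp_repr_mem (F : LX) : mem_Lp mu p%:E (Lp_repr F).
Proof. exact: Lp_funP (repr F). Qed.

Lemma cmeasurable_repr (F : LX) : cmeasurable (Lp_repr F).
Proof. by case: (Lp_repr_mem F). Qed.

Lemma Lp_reprD (F G : LX) : {ae mu, forall x, Lp_repr (F + G) x = Lp_repr F x + Lp_repr G x}.
Proof.
have := Lp_class_reprP (repr F + repr G); rewrite Lp_classD !Lp_reprK.
by apply: filterS => x ->; rewrite raddfD.
Qed.

Lemma Lp_reprZ (c : R[i]) (F : LX) : {ae mu, forall x, Lp_repr (c *: F) x = c * Lp_repr F x}.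
Proof.
have := Lp_class_reprP (c *: repr F).
by apply: filterS => x e; rewrite [LHS]e linearZ.
Qed.

Lemma Lp_repr0 : {ae mu, forall x, Lp_repr (0 : LX) x = 0}.
Proof.
have z : Lp_class (0 : Lp_fun mu p1) = 0 by rewrite /Lp_class raddf0.
have := Lp_class_reprP (0 : Lp_fun mu p1); rewrite z.
by apply: filterS => x ->; rewrite raddf0.
Qed.

Lemma Lp_repr_sum (I : Type) (r : seq I) (G : I -> LX) :
  {ae mu, forall x, Lp_repr (\sum_(i <- r) G i) x = \sum_(i <- r) Lp_repr (G i) x}.
Proof.
elim: r => [|i r ih].
  by rewrite big_nil; apply: filterS Lp_repr0 => x ->; rewrite big_nil.
rewrite big_cons; apply: filterS2 ih (Lp_reprD (G i) (\sum_(i <- r) G i)) => x e1 e2.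
by rewrite e2 e1 big_cons.
Qed.

Lemma Lp_normE (F : LX) : `|F| = (inorm mu p^-1 (Lp_repr F))%:C%C.
Proof.
have [_ e] := cLnorm_inorm (lt_le_trans ltr01 p1) (Lp_repr_mem F).
by rewrite -[LHS]/((fine (cLnorm mu p%:E (Lp_repr F)))%:C%C) e.
Qed.

Lemma rintble_repr (F : LX) : rintble mu (ipow p^-1 (Lp_repr F)).
Proof. by case: (cLnorm_inorm (lt_le_trans ltr01 p1) (Lp_repr_mem F)). Qed.

Lemma rintble_repr_pow (F : LX) : rintble mu (fun x => normc (Lp_repr F x) `^ p).
Proof. by have := rintble_repr F; rewrite /ipow invrK. Qed.

End Lp_pointwise.

(** By continuity of Q and density of the domain of S, some D in the domain is close to F with Q D
    close to Q F, and there the bound for S applies. N is the norm as a real number, the norm of V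
    having values in R[i]. *)
Lemma bounded_extension_le {R : realType} (V : normedModType R[i]) (N : V -> R)
    (S : operator V) (Q : {linear V -> V}) (C : R) :
  (forall G, `|G| = (N G)%:C%C) -> 0 <= C ->
  is_bounded_extension S Q -> (forall F G, S (F, G) -> N G <= C * N F) ->
  forall F, N (Q F) <= C * N F.
Proof.
move=> NE C0 [dom cQ ext] le F.
(* Replacing F by D costs C dl on the right side and dl on the left, together (C + 1) dl = d. *)
apply/ler_addgt0Pr => d d0; set dl := d / (C + 1).
have C10 : 0 < C + 1 by rewrite ltr_wpDl.
have dl0 : 0 < dl by rewrite divr_gt0.
have dlC : 0 < dl%:C%C :> R[i] by rewrite ltcR.
pose W := ball F (dl%:C)%C `&` Q @^-1` ball (Q F) (dl%:C)%C.
have nW : nbhs F W.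
  apply: filterI; first exact: nbhsx_ballx.
  by apply: (cQ F); exact: nbhsx_ballx.
have [|D [DW [G DG]]] := dom (W°) _ (@open_interior _ W); first by exists F.
have [DF DQ] := interior_subset DW.
have GQ : G = Q D := ext _ DG.
move: DF DQ; rewrite -!ball_normE /ball_ /= => DF DQ.
have NED G' : (N G' + dl)%:C%C = `|G'| + dl%:C%C by rewrite NE -rmorphD.
have h1 : N D <= N F + dl.
  rewrite -lecR NED -NE -{1}(subrKC F D); apply: (le_trans (ler_normD _ _)).
  by rewrite lerD2l distrC ltW.
have h2 : N (Q F) <= N G + dl.
  rewrite -lecR NED -NE -{1}(subrKC G (Q F)); apply: (le_trans (ler_normD _ _)).
  by rewrite lerD2l GQ ltW.
apply: (le_trans h2); have -> : C * N F + d = C * (N F + dl) + dl.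
  by rewrite /dl; field; rewrite gt_eqF.
by rewrite lerD2r; apply: (le_trans (le _ _ DG)); exact: ler_wpM2l.
Qed.

(** An eigenvector for -1 satisfies N F = N (Q F) <= C N F with N F > 0. *)
Lemma bounded_extension_eigen {R : realType} (V : normedModType R[i]) (N : V -> R)
    (S : operator V) (Q : {linear V -> V}) (C : R) :
  (forall G, `|G| = (N G)%:C%C) -> 0 <= C ->
  is_bounded_extension S Q -> (forall F G, S (F, G) -> N G <= C * N F) ->
  op_eigenvalue (op_of_fun Q) (-1) -> 1 <= C.
Proof.
move=> NE C0 ext le [F F0]; rewrite /op_of_fun /= scaleN1r => QF.
have NF : 0 < N F by rewrite -ltcR -NE normr_gt0.
rewrite -(ler_pM2r NF) mul1r; have := bounded_extension_le NE C0 ext le F.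
by rewrite -QF -lecR -!NE normrN NE lecR.
Qed.

Section birman_schwinger_bound.
Context {R : realType} (n : nat) (p p' : R) (p1 : 1 < p) (pp' : p^-1 + p'^-1 = 1).
Local Notation mu := (@lebesgue_Rn R n).
Local Notation LX := (Lp mu (ltW p1) : normedModType R[i]).
Variables (a b : 'rV[R]_n -> R[i]) (ma : cmeasurable a) (mb : cmeasurable b).
Variables (rho sig A B t al : R).
Hypotheses (A0 : 0 <= A) (B0 : 0 <= B).
Hypotheses (ha : multiplier mu rho A a) (hb : multiplier mu sig B b).
Hypotheses (ht : 2^-1 <= t) (t1 : t < 1) (trho : t = rho + p^-1) (tsig : 1 - t = p^-1 - sig).
Hypotheses (alE : al = 1 - n%:R * (t - 2^-1)) (al0 : 0 < al).
Local Notation K := ((4 * pi) `^ (al - 1) * Gamma al * A * B).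

Let mul_chain (k1 k2 k3 I1 I2 I3 : R) : 0 <= k1 -> 0 <= k2 -> 0 <= k3 -> 0 <= B ->
  I3 <= A * I1 -> I2 <= k1 * I3 * (k2 * k3) -> B * I2 <= k1 * k3 * A * B * k2 * I1.
Proof.
move=> k10 k20 k30 B0' leF leu.
apply: (@le_trans _ _ (B * (k1 * (A * I1) * (k2 * k3)))); last first.
  by rewrite le_eqVlt; apply/orP; left; apply/eqP; ring.
apply: (ler_wpM2l B0'); apply: (le_trans leu); apply: (ler_wpM2r (mulr_ge0 k20 k30)).
exact: ler_wpM2l.
Qed.

(** The operator is a relation, so its hypothesis supplies e = a F and k with (H_0 - lam) k = e,
    both in L_p, and G = b k. Hoelder puts e in L_(1/t), [resolvent_dual_le] puts k in L_(1/(1-t)),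
    and Hoelder with sig + (1 - t) = 1/p returns to L_p. *)
Lemma birman_schwinger_le (om lam : R[i]) (c : R) : normc om = 1 -> 0 < cRe om -> 0 < c ->
  cRe (lam * (om^*)%C) = - c -> forall F G : LX, birman_schwinger a b lam (F, G) ->
  inorm mu p^-1 (Lp_repr G) <= K * c `^ (- al) * inorm mu p^-1 (Lp_repr F).
Proof.
move=> om1 om0 c0 cE F G [k [e mulF [sob [g weak eg]]] mulG].
have {}weak : forall i, weak_partial [:: i; i] (Lp_repr k) (Lp_repr (g i)) := weak.
have {}eg : e + lam *: k = - \sum_i g i := eg.
rewrite /mul_operator /= in mulF mulG.
have pi0 : 0 < p^-1 by rewrite invr_gt0 (lt_trans ltr01).
have cm := @cmeasurable_repr _ _ _ mu _ (ltW p1).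
have resolvent : {ae mu, forall y,
    \sum_i Lp_repr (g i) y = - Lp_repr e y - lam * Lp_repr k y}.
  have z0 : \sum_i g i + (e + lam *: k) = 0 by rewrite eg subrr.
  have h0 := @Lp_repr0 _ _ _ mu _ (ltW p1); rewrite -z0 in h0.
  have h1 := Lp_reprD (\sum_i g i) (e + lam *: k).
  have h2 := Lp_reprD e (lam *: k).
  have h3 := Lp_reprZ lam k.
  have h4 := Lp_repr_sum (index_enum _) g.
  apply: filterS2 (filterI h0 h1) (filterI h2 (filterI h3 h4)) => y [e0 e1] [e2 [e3 e4]].
  move: e0; rewrite e1 e2 e3 e4 => /eqP; rewrite addr_eq0 => /eqP ->.
  by rewrite opprD.
have [jaF leF] := ha pi0 (cm F) (rintble_repr F); rewrite -trho in jaF leF.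
have aF : {ae mu, forall x, a x * Lp_repr F x = Lp_repr e x}.
  by apply: filterS mulF => x ->.
have [je eqe] := eq_ae_inorm (cmeasurableM ma (cm F)) (cm e) aF jaF.
rewrite eqe in leF.
have [ju leu] := resolvent_dual_le om1 om0 c0 cE p1 pp' (cm k) (cm e) (fun i => cm (g i))
  (rintble_repr_pow k) (rintble_repr_pow e) (fun i => rintble_repr_pow (g i)) weak resolvent
  ht t1 je alE al0.
have s0 : 0 < 1 - t by rewrite subr_gt0.
have [jG leG] := hb s0 (cm k) ju.
have tp : sig + (1 - t) = p^-1 by rewrite tsig addrC subrK.
rewrite tp in jG leG.
have bk : {ae mu, forall x, b x * Lp_repr k x = Lp_repr G x}.
  by apply: filterS mulG => x ->.
have [_ eqG] := eq_ae_inorm (cmeasurableM mb (cm k)) (cm G) bk jG.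
rewrite -eqG; apply: (le_trans leG).
have GG : 0 <= Gamma al.
  by apply: Rintegral_ge0 => x _; rewrite mulr_ge0 ?powR_ge0 ?expR_ge0.
exact: (mul_chain (powR_ge0 (4 * pi) (al - 1)) (powR_ge0 c (- al)) GG B0 leF leu).
Qed.

Lemma eigenvalue_bound (om lam : R[i]) (c : R) (Q : {linear LX -> LX}) : normc om = 1 ->
  0 < cRe om -> 0 < c -> cRe (lam * (om^*)%C) = - c ->
  is_bounded_extension (birman_schwinger a b lam : operator LX) Q ->
  op_eigenvalue (op_of_fun Q) (-1) -> c `^ al <= K.
Proof.
move=> om1 om0 c0 cE [dom cQ ext] eig.
set C := K * c `^ (- al).
have GG : 0 <= Gamma al.
  by apply: Rintegral_ge0 => x _; rewrite mulr_ge0 ?powR_ge0 ?expR_ge0.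
have C0 : 0 <= C by rewrite !mulr_ge0 ?powR_ge0.
pose N (G : LX) := inorm mu p^-1 (Lp_repr G).
have NE (G : LX) : `|G| = (N G)%:C%C by exact: Lp_normE.
have C1 := bounded_extension_eigen NE C0 (And3 dom cQ ext)
  (fun D G => @birman_schwinger_le om lam c om1 om0 c0 cE D G) eig.
by move: C1; rewrite /C powRN ler_pdivlMr ?powR_gt0// mul1r.
Qed.

End birman_schwinger_bound.

(* As [eta] tends to |Im lam|, [om] tends to the imaginary axis; the intermediate
   parametrization by [T] keeps everything rational. *)
Lemma rotation_exists {R : realType} (lam : R[i]) (eta : R) : 0 < eta < `|cIm lam| ->
  exists om c, [/\ normc om = 1, 0 < cRe om, eta <= c & cRe (lam * (om^*)%C) = - c].
Proof.
case: lam => x y /andP[e0 ey]; rewrite [cIm _]/= in ey.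
(* In the rational parametrization of the circle, c >= eta means (|y| + eta) T^2 + 2 x T <= |y| -
   eta. For T <= 1 the left side is at most (|y| + eta + 2 |x|) T, and T is chosen to make this
   equal to |y| - eta. *)
pose T := (`|y| - eta) / (`|y| + eta + 2 * `|x|).
have d0 : 0 < `|y| + eta + 2 * `|x|.
  by rewrite ltr_wpDr ?mulr_ge0// ltr_wpDl.
have T0 : 0 < T by rewrite divr_gt0// subr_gt0.
have T1 : T <= 1.
  rewrite ler_pdivrMr// mul1r -addrA lerD2l.
  by have := normr_ge0 x; move: e0; move: (`|x|) => X; lra.
have q0 : 0 < 1 + T ^+ 2 by rewrite ltr_pwDl// sqr_ge0.
have sy : Num.sg y ^+ 2 = 1.
  by rewrite sqr_sg -normr_eq0 gt_eqF// (lt_trans e0 ey).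
have yE : y * Num.sg y = `|y| by rewrite mulrC -normrEsg.
pose c := (`|y| * (1 - T ^+ 2) - 2 * x * T) / (1 + T ^+ 2).
exists (Complex (2 * T / (1 + T ^+ 2)) (- (Num.sg y * (1 - T ^+ 2) / (1 + T ^+ 2)))), c; split.
- rewrite Defs.normcE [cRe _]/= [cIm _]/= -[RHS]sqrtr1; congr Num.sqrt.
  have -> : (- (Num.sg y * (1 - T ^+ 2) / (1 + T ^+ 2))) ^+ 2 =
      Num.sg y ^+ 2 * ((1 - T ^+ 2) / (1 + T ^+ 2)) ^+ 2 by ring.
  by rewrite sy; field; rewrite gt_eqF.
- by rewrite [cRe _]/= divr_gt0// mulr_gt0.
- rewrite ler_pdivlMr//.
  have TT : T ^+ 2 <= T by rewrite expr2 ler_piMr// ltW.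
  have TE : T * (`|y| + eta + 2 * `|x|) = `|y| - eta by rewrite divfK// gt_eqF.
  have xT : x * T <= `|x| * T by apply: ler_wpM2r; [exact: ltW|exact: ler_norm].
  have hh : (`|y| + eta) * T ^+ 2 <= (`|y| + eta) * T.
    by apply: ler_wpM2l => //; rewrite addr_ge0 ?normr_ge0 ?ltW.
  move: TE xT hh; move: (`|y|) (`|x|) (T ^+ 2) => Y X T2; nra.
- rewrite cReM [cRe _]/= [cIm _]/= [cRe (_^*)%C]/= [cIm (_^*)%C]/= opprK /c -yE.
  by field; rewrite gt_eqF.
Qed.

Lemma inve_fine {R : realType} (r : \bar R) : (0 < r)%E ->
  (r^-1 = (fine r^-1)%:E)%E.
Proof. by case: r => [r|_|//]; [rewrite lte_fin => r0; rewrite inver gt_eqF|rewrite invey]. Qed.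

Theorem theorem4p7 (R : realType) (n : nat) (hn : (3 <= n)%N)
  (p p' : R) (hp : 1 < p) (hp' : p^-1 + p'^-1 = 1)
  (r s : \bar R) (hr : (0 < r)%E) (hs : (p%:E <= s)%E)
  (hrs : (r^-1 - s^-1)%E = (1 - 2 * p^-1)%:E)
  (hr_ge : ((2^-1 - p^-1)%:E <= r^-1)%E)
  (hr_le : (r^-1 <= (1 - p^-1)%:E)%E)
  (hrs_lt : (r^-1 + s^-1 < (2 * n%:R^-1)%:E)%E)
  (a b : 'rV[R]_n -> R[i])
  (ha : mem_Lp (lebesgue_Rn n) r a) (hb : mem_Lp (lebesgue_Rn n) s b)
  (hMa : exists2 nu : R, 0 < nu < p' & (Mnorm nu p' a < +oo)%E)
  (hMb : exists2 mu : R, 0 < mu < p & (Mnorm mu p b < +oo)%E)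
  (hq : vanishes_at_infinity (fun x => a x * b x))
  (H : operator (Lp (lebesgue_Rn n) (ltW hp)))
  (hH : is_schrodinger a b H)
  (alpha : R)
  (halpha : alpha = 1 - n%:R * (fine (r^-1)%E + fine (s^-1)%E) / 2)
  (lambda : R[i]) (hlambda : op_eigenvalue H lambda)
  (hIm : cIm lambda != 0) :
  ((`|cIm lambda| `^ alpha)%:E <=
     ((4 * pi) `^ (alpha - 1) * Gamma alpha)%:E *
       cLnorm (lebesgue_Rn n) r a * cLnorm (lebesgue_Rn n) s b)%E.
Proof.
have p0 : 0 < p := lt_trans ltr01 hp.
have s0 : (0 < s)%E by apply: lt_le_trans hs; rewrite lte_fin.
set rho := fine (r^-1)%E in halpha; set sig := fine (s^-1)%E in halpha.
have rE : (r^-1 = rho%:E)%E by exact: inve_fine.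
have sE : (s^-1 = sig%:E)%E by exact: inve_fine.
rewrite rE sE -EFinB in hrs; have {}hrs : rho - sig = 1 - 2 * p^-1 by case: hrs.
rewrite rE lee_fin in hr_ge; rewrite rE sE -EFinD lte_fin in hrs_lt.
have n3 : 3 <= n%:R :> R by rewrite ler_nat.
have n0 : 0 < n%:R :> R by exact: lt_le_trans n3.
have nV : n%:R * (2 * n%:R^-1) = 2 :> R by rewrite mulrCA divff ?gt_eqF// mulr1.
have nV3 : 2 * n%:R^-1 <= 2 * 3^-1 :> R by rewrite ler_pM2l// lef_pV2 ?posrE.
(* By [hrs], t = (1 + rho + sig) / 2. The lower bound on 1/r is t >= 1/2, and n >= 3 gives rho + sig
   < 2/3, hence t < 1. *)
pose t := rho + p^-1.
have ht : 2^-1 <= t by rewrite /t; lra.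
have t1 : t < 1 by rewrite /t; lra.
have tsig : 1 - t = p^-1 - sig by rewrite /t; lra.
have alE : alpha = 1 - n%:R * (t - 2^-1).
  rewrite halpha; congr (1 - _); rewrite -mulrA; congr (_ * _).
  by rewrite /t; lra.
have al0 : 0 < alpha.
  rewrite halpha -mulrA subr_gt0 mulrA ltr_pdivrMr// mul1r -nV.
  by rewrite ltr_pM2l.
have [A [A0 AE mulA]] := Lp_multiplier hr ha.
have [B [B0 BE mulB]] := Lp_multiplier s0 hb.
rewrite AE BE -!EFinM lee_fin; set K := _ * _ * _ * _.
have GG : 0 <= Gamma alpha.
  by apply: Rintegral_ge0 => x _; rewrite mulr_ge0 ?powR_ge0 ?expR_ge0.
have K0 : 0 <= K by rewrite !mulr_ge0 ?powR_ge0.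
have nonneg : ~~ (0 <= lambda).
  by case: (lambda) hIm => x y /= y0; rewrite lecE /= (negbTE y0).
have [_ _ _ spec] := hH.
have [Q extQ eigQ] := (spec lambda nonneg).1 hlambda.
have bound (eta : R) : 0 < eta < `|cIm lambda| -> eta `^ alpha <= K.
  move=> eta_lt; have [om [c [om1 om0 ec cE]]] := rotation_exists eta_lt.
  have /andP[e0 _] := eta_lt; have c0 := lt_le_trans e0 ec.
  apply: (@le_trans _ _ (c `^ alpha)).
    by apply: ge0_ler_powR; rewrite ?nnegrE ?(ltW al0) ?(ltW e0) ?(ltW c0).
  exact: (eigenvalue_bound hp' ha.1 hb.1 A0 B0 mulA mulB ht t1 erefl tsig alE al0
    om1 om0 c0 cE extQ eigQ).
have y0 : 0 < `|cIm lambda| by rewrite normr_gt0.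
(* Otherwise K^(1/alpha) < |Im lambda|, and the midpoint eta of the two is an admissible value with
   eta^alpha > K. *)
rewrite leNgt; apply/negP => Ky.
have Kr : K `^ alpha^-1 < `|cIm lambda|.
  rewrite ltNge; apply/negP => h; move: Ky; rewrite ltNge => /negP; apply.
  rewrite -[leRHS](powRr1 K0) -(mulVf (lt0r_neq0 al0)) powRrM.
  by apply: ge0_ler_powR; rewrite ?nnegrE ?powR_ge0 ?(ltW al0).
pose eta := (K `^ alpha^-1 + `|cIm lambda|) / 2.
have Kr0 : 0 <= K `^ alpha^-1 by exact: powR_ge0.
have e1 : K `^ alpha^-1 < eta by rewrite /eta midf_lt.
have e2 : eta < `|cIm lambda| by rewrite /eta midf_lt.
have := bound eta; rewrite (le_lt_trans Kr0 e1) e2 => /(_ isT).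
rewrite leNgt => /negP; apply.
rewrite -[ltLHS](powRr1 K0) -(mulVf (lt0r_neq0 al0)) powRrM.
by apply: gt0_ltr_powR; rewrite ?nnegrE ?(le_trans Kr0 (ltW e1)).
Qed.
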